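(* Let $n\ge1$ be an integer. The pair correlation function of the $\mathrm{Sine}_\beta$ process with $\beta=2n$ has the following asymptotics as $\lambda\to 0$: $$\rho_{2n}^{(2)}(0,\lambda)= \frac1{4\pi^2} \cdot \frac{n^{2n} (n!)^3 }{(2n)!\,(3n)! }\,\lambda^{2n}+\mathcal{O}(\lambda^{2n+2}).$$
   Context: The $\mathrm{Sine}_\beta$ process ($\beta>0$) is the translation and reflection invariant simple point process on $\mathbb{R}$ with density $\frac1{2\pi}$ obtained as the $m\to\infty$ point process limit of $m\Lambda_m$, where $\Lambda_m=\{\theta_1,\dots,\theta_m\}\subset[-\pi,\pi)$ has joint density proportional to $\prod_{1\le j<k\le m}|e^{i\theta_j}-e^{i\theta_k}|^\beta$ (circular beta-ensemble). Equivalently, let $Z$ be a two-sided complex Brownian motion with independent standard real and imaginary parts, let $\psi_\lambda(u)$, $\lambda\in\mathbb R$, be the strong solutions (driven by the same $Z$ for all $\lambda$) of $d\psi_\lambda=\lambda\frac{\beta}{4}e^{\frac{\beta}{4}u}du+\Re[(e^{-i\psi_\lambda}-1)dZ]$ with $\lim_{u\to-\infty}\psi_\lambda(u)=0$, and let $\Theta$ be uniform on $[0,2\pi)$ and independent of $Z$; then $\mathrm{Sine}_\beta$ has the law of $\{\lambda\in\mathbb{R}:\psi_\lambda(0)=\Theta \bmod 2\pi\}$. For a simple point process $\Xi$ on $\mathbb R$, with $\Xi(A)$ the number of points in $A$, the pair correlation function is the symmetric function $\rho^{(2)}:\mathbb R^2\to\mathbb R_+$ with $E[\Xi(D_1)\Xi(D_2)]=\int_{D_1}\int_{D_2}\rho^{(2)}(x,y)\,dy\,dx$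 for all disjoint Borel sets $D_1,D_2$; it is determined up to Lebesgue-null sets. For $\mathrm{Sine}_\beta$ it is denoted $\rho^{(2)}_\beta$; by invariance $\rho^{(2)}_\beta(x,y)=\rho^{(2)}_\beta(0,|y-x|)$, and the continuous version of $\lambda\mapsto\rho^{(2)}_{\beta}(0,\lambda)$ is used. *)

(* Defs.v *)
From HB Require Import structures.
From mathcomp Require Import all_boot all_order all_algebra.
From mathcomp Require Import all_classical all_reals all_analysis.
From mathcomp Require Import measurable_realfun complex.
Import Order.TTheory GRing.Theory Num.Theory.
Import numFieldNormedType.Exports.
Set Implicit Arguments.
Unset Strict Implicit.
Unset Printing Implicit Defensive.
Local Open Scope classical_set_scope.
Local Open Scope ring_scope.

Definition locally_finite (R : realType) (A : set R) : Prop :=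
  forall a b : R, finite_set (A `&` `[a, b]).

(* A simple point configuration is identified with its set of points. *)
Record config (R : realType) := Config {
  points :> set R;
  points_locally_finite : locally_finite points
}.

(* The number of points in A; +oo if there are infinitely many. *)
Definition npoints (R : realType) (X : config R) (A : set R) : \bar R :=
  counting (points X `&` A).

Record test_fun (R : realType) := TestFun {
  test_fun_val :> R -> R;
  test_fun_continuous : continuous test_fun_val;
  test_fun_compact : compact (closure [set x | test_fun_val x != 0])
}.

HB.instance Definition _ (R : realType) := gen_eqMixin (test_fun R).
HB.instance Definition _ (R : realType) := gen_choiceMixin (test_fun R).

(* The sum over the points of X has finitely many nonzero terms, so that the
   finitely supported big operator is the integral of f against the counting
   measure of X. *)
Definition vague_eval (R : realType) (X : config R) :
    {ptws test_fun R -> R} :=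
  fun f => \sum_(x \in points X) f x.

HB.instance Definition _ (R : realType) := gen_eqMixin (config R).
HB.instance Definition _ (R : realType) := gen_choiceMixin (config R).

(* Vague topology: the coarsest one making X |-> \sum_(x in X) f x continuous
   for every continuous compactly supported f. *)
HB.instance Definition _ (R : realType) :=
  Topological.copy (config R) (initial_topology (@vague_eval R)).

Definition simple_point_process (R : realType) (d : measure_display)
    (T : measurableType d) (Xi : T -> config R) : Prop :=
  forall A : set R, measurable A ->
    measurable_fun [set: T] (fun w => npoints (Xi w) A).

Definition cis (R : realType) (t : R) : R[i]%C := (cos t +i* sin t)%C.

Definition circular_weight (R : realType) (beta : R) (m : nat)
    (t : m.-tuple R) : R :=
  \prod_(j < m) \prod_(k < m | (j < k)%N)
    (ComplexField.Normc.normc (cis (tnth t j) - cis (tnth t k)) `^ beta).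

(* Integral over [-pi, pi)^m, as an iterated Lebesgue integral. *)
Fixpoint cube_integral (R : realType) (m : nat) :
    (m.-tuple R -> R) -> R :=
  match m with
  | 0%N => fun G => G [tuple]
  | m'.+1 => fun G =>
      \int[@lebesgue_measure R]_(x in `[(- pi)%R, pi%R[)
        cube_integral (fun t : m'.-tuple R => G [tuple of x :: t])
  end.

(* Expectation of G (theta_1, ..., theta_m) when the theta_j have joint density
   proportional to circular_weight beta on [-pi, pi)^m. *)
Definition circular_expectation (R : realType) (beta : R) (m : nat)
    (G : m.-tuple R -> R) : R :=
  cube_integral (fun t => G t * circular_weight beta t)
  / cube_integral (@circular_weight R beta m).

Lemma scaled_points_locally_finite (R : realType) (m : nat) (t : m.-tuple R) :
  locally_finite [set m%:R * tnth t j | j in [set: 'I_m]].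
Proof.
move=> a b; apply: (@sub_finite_set _ _ [set m%:R * tnth t j | j in [set: 'I_m]]).
  exact: subIsetl.
by apply: finite_image; exact: finite_finset.
Qed.

Definition scaled_config (R : realType) (m : nat) (t : m.-tuple R) : config R :=
  Config (scaled_points_locally_finite t).

(* Xi has the law of the Sine_beta process: it is the limit in distribution,
   for the vague topology, of m * Lambda_m, where Lambda_m is the circular
   beta-ensemble of size m. *)
Definition is_Sine (R : realType) (beta : R) (d : measure_display)
    (T : measurableType d) (P : probability T R) (Xi : T -> config R) : Prop :=
  simple_point_process Xi /\
  forall F : config R -> R, continuous F -> bounded_fun F ->
    circular_expectation beta (fun t : m.-tuple R => F (scaled_config t))
      @[m --> \oo] --> \int[P]_w F (Xi w).

Definition is_pair_correlation (R : realType) (d : measure_display)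
    (T : measurableType d) (P : probability T R) (Xi : T -> config R)
    (rho : R -> R -> R) : Prop :=
  [/\ measurable_fun [set: R * R] (fun z : R * R => rho z.1 z.2),
      forall x y, 0 <= rho x y,
      forall x y, rho x y = rho y x &
      forall D1 D2 : set R, measurable D1 -> measurable D2 ->
        D1 `&` D2 = set0 ->
        (\int[P]_w (npoints (Xi w) D1 * npoints (Xi w) D2) =
         \int[@lebesgue_measure R]_(x in D1)
           \int[@lebesgue_measure R]_(y in D2) (rho x y)%:E)%E].

(* Main.v *)
(** Place two of m = N + 2 points of the circular ensemble at angles x and y.
    Integrating out the others leaves |e^{ix} - e^{iy}|^{2n} J(x - y), where J is
    the integral of prod_l |e^{ix} - z_l|^{2n} |e^{iy} - z_l|^{2n} against the
    weight of N points. Since beta = 2n is even, everything is a Laurent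
    polynomial in the z_l, and comparing degrees shows that J is a sum of
    cosines of frequencies at most d = nN with nonnegative coefficients. Hence
    J(0) (1 - d^2 u^2 / 2) <= J(u) <= J(0). Both J(0) and the partition functions
    are Morris integrals, which Aomoto's recursion evaluates. At u = lambda / m,
    as m tends to infinity, this gives
    kappa lambda^{2n} (1 - n^2 lambda^2 / 2) <= rho(0, lambda) <= kappa lambda^{2n}.

    The bounds pass to the limit process through products of truncated linear
    statistics, which are bounded and vaguely continuous. The error made by the
    truncation comes from three points in two intervals of length a, one of
    which contains two of them; it is O(a^{2n+2}), negligible against a^2. *)

Require Import Defs.
From mathcomp Require Import all_boot all_order all_fingroup all_algebra.
From mathcomp Require Import all_classical all_reals all_analysis.
From mathcomp Require Import measurable_realfun.
From mathcomp Require Import complex ring lra zify.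
Import Order.TTheory GRing.Theory Num.Theory.
Import numFieldNormedType.Exports.
Local Open Scope classical_set_scope.
Local Open Scope ring_scope.
Set Implicit Arguments.
Unset Strict Implicit.
Unset Printing Implicit Defensive.

(** * Integration over the circle *)

(** The law of the process is known only through limits of [circular_expectation], an iterated
    integral of functions of a configuration for which no measurability is at hand. Two devices
    avoid the question. Integrals of nonnegative functions are monotone without measurability, so
    the comparisons put an arbitrary function on one side and, on the other, a finite sum of
    products of continuous functions of one angle, whose iterated integral is explicit. And the
    identities between such integrals come from Laurent polynomials on the torus: a derivative has
    integral zero, and so has a homogeneous function of nonzero degree.

    No closed form of the partition function is used, only ratios. The expansion of J is even, which
    is why the relative error is quadratic in lambda; its constant n^2 / 2 comes from d / m <= n,
    uniformly in m.

    Truncation is asymmetric: the upper bound needs every level, since the pair count is unbounded;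
    the lower bound uses level 1 alone, since a short interval rarely holds two points. *)

Section CircleIntegral.
Context {R : realType}.
Local Notation mu := (@lebesgue_measure R).
Local Notation circ := [set` `[(- pi)%R, (pi : R)[].
Local Notation circ1 := [set` `[(- pi)%R, (pi : R)]].
Local Notation re := complex.Re.
Local Notation im := complex.Im.
Local Notation C := R[i]%C.
Implicit Types (f g : R -> R) (h k : R -> C).

(** Nonnegative integrals are suprema over the simple functions below the integrand, so a larger
    integrand enlarges the family. No measurability is assumed, in view of functions of random
    configurations. *)
Lemma le_ge0_integral d (T : measurableType d) (m : {measure set T -> \bar R})
    (D : set T) (f g : T -> \bar R) :
  (forall x, D x -> 0 <= f x)%E -> (forall x, D x -> f x <= g x)%E ->
  (\int[m]_(x in D) f x <= \int[m]_(x in D) g x)%E.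
Proof.
move=> f0 fg.
have g0 x : D x -> (0 <= g x)%E by move=> Dx; exact: le_trans (f0 x Dx) (fg x Dx).
rewrite !ge0_integralE//; apply: le_ereal_sup => _ [u /= uf <-]; exists u => //= x.
apply: le_trans (uf x) _; rewrite /patch; case: ifP => //.
by rewrite inE; exact: fg.
Qed.

Lemma continuous_circ_integrable f :
  continuous f -> mu.-integrable circ (EFin \o f).
Proof.
move=> cf.
have h : mu.-integrable circ1 (EFin \o f).
  apply: continuous_compact_integrable; first exact: segment_compact.
  by apply: continuous_subspaceT.
apply: integrableS h => //.
by apply: subset_itvl; rewrite bnd_simp.
Qed.

Lemma circ_fin_num f : continuous f -> (\int[mu]_(x in circ) (f x)%:E)%E \is a fin_num.
Proof.
by move=> cf; apply: integrable_fin_num => //; exact: continuous_circ_integrable.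
Qed.

(** Continuity of [g] makes both integrals finite, which is essential because [fine] sends an
    infinite one to 0; [f] is otherwise arbitrary. *)
Lemma le_Rintegral_circ f g :
  continuous g -> (forall x, 0 <= f x) -> (forall x, f x <= g x) ->
  \int[mu]_(x in circ) f x <= \int[mu]_(x in circ) g x.
Proof.
move=> cg f0 fg; apply: fine_le.
- rewrite ge0_fin_numE; last by apply: integral_ge0 => x _; rewrite lee_fin.
  apply: (@le_lt_trans _ _ (\int[mu]_(x in circ) (g x)%:E)%E).
    by apply: le_ge0_integral => x _; rewrite lee_fin.
  have := circ_fin_num cg.
  rewrite ge0_fin_numE//.
  by apply: integral_ge0 => x _; rewrite lee_fin (le_trans (f0 x)).
- exact: circ_fin_num cg.
- by apply: le_ge0_integral => x _; rewrite lee_fin.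
Qed.

(** Here the arbitrary function is the larger one, and [B] keeps its integral finite. As [g] may be
    negative, it is first replaced by its positive part, which is still below [f]. *)
Lemma ge_Rintegral_circ f g (B : R) :
  continuous g -> (forall x, 0 <= f x <= B) -> (forall x, g x <= f x) ->
  \int[mu]_(x in circ) g x <= \int[mu]_(x in circ) f x.
Proof.
move=> cg f0 gf.
have cg' : continuous (fun x => Num.max (g x) 0).
  by move=> x; apply: continuous_max; [exact: cg | exact: cst_continuous].
apply: (@le_trans _ _ (\int[mu]_(x in circ) Num.max (g x) 0)).
  apply: le_Rintegral => //; try exact: continuous_circ_integrable.
  by move=> x _; rewrite le_max lexx.
have h0 x : 0 <= Num.max (g x) 0 by rewrite le_max lexx orbT.
have hf x : Num.max (g x) 0 <= f x.
  by rewrite ge_max gf; case/andP: (f0 x) => ->.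
apply: fine_le.
- exact: circ_fin_num cg'.
- rewrite ge0_fin_numE; last first.
    by apply: integral_ge0 => x _; rewrite lee_fin; case/andP: (f0 x).
  apply: (@le_lt_trans _ _ (\int[mu]_(x in circ) (cst B x)%:E)%E).
    by apply: le_ge0_integral => x _; rewrite lee_fin; case/andP: (f0 x).
  have := @circ_fin_num (cst B) (@cst_continuous _ _ _).
  rewrite ge0_fin_numE//.
  by apply: integral_ge0 => x _; rewrite lee_fin; case/andP: (f0 0) => /le_trans; apply.
- by apply: le_ge0_integral => x _; rewrite lee_fin.
Qed.

Definition ccont h := continuous (fun x => re (h x)) /\ continuous (fun x => im (h x)).

Definition cint h : C :=
  ((\int[mu]_(x in circ) re (h x)) +i* (\int[mu]_(x in circ) im (h x)))%C.

Lemma ccontD h k : ccont h -> ccont k -> ccont (fun x => h x + k x).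
Proof.
move=> [h1 h2] [k1 k2]; split => x /=; under eq_fun do rewrite raddfD/=.
  by apply: cvgD; [exact: h1 | exact: k1].
by apply: cvgD; [exact: h2 | exact: k2].
Qed.

Lemma ccontM h k : ccont h -> ccont k -> ccont (fun x => h x * k x).
Proof.
move=> [h1 h2] [k1 k2].
have ReM (a b : C) : re (a * b) = re a * re b - im a * im b by case: a b => [? ?] [].
have ImM (a b : C) : im (a * b) = re a * im b + im a * re b by case: a b => [? ?] [].
split => x /=.
  under eq_fun do rewrite ReM.
  by apply: cvgB; apply: cvgM; [exact: h1 | exact: k1 | exact: h2 | exact: k2].
under eq_fun do rewrite ImM.
by apply: cvgD; apply: cvgM; [exact: h1 | exact: k2 | exact: h2 | exact: k1].
Qed.

Lemma ccont_cst (c : C) : ccont (fun=> c).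
Proof. by split => x; exact: cst_continuous. Qed.

Lemma ccont_real f : continuous f -> ccont (fun x => (f x)%:C%C).
Proof. by move=> cf; split => //= x; exact: cst_continuous. Qed.

Lemma cintD h k : ccont h -> ccont k -> cint (fun x => h x + k x) = cint h + cint k.
Proof.
move=> [h1 h2] [k1 k2]; rewrite /cint.
under eq_Rintegral do rewrite raddfD/=.
rewrite RintegralD//; [|exact: continuous_circ_integrable..].
under [X in (_ +i* X)%C]eq_Rintegral do rewrite raddfD/=.
by rewrite RintegralD//; exact: continuous_circ_integrable.
Qed.

Lemma cintZr h (c : C) : ccont h -> cint (fun x => h x * c) = cint h * c.
Proof.
move=> [h1 h2]; case: c => a b; rewrite /cint.
have ReM (u : C) : re (u * (a +i* b)%C) = re u * a - im u * b by case: u.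
have ImM (u : C) : im (u * (a +i* b)%C) = re u * b + im u * a by case: u.
have ci f c : continuous f -> mu.-integrable circ (EFin \o (fun x => f x * c)).
  move=> cf; apply: continuous_circ_integrable => x.
  by apply: cvgM; [exact: cf | exact: cst_continuous].
under eq_Rintegral do rewrite ReM.
rewrite RintegralB//; [|exact: ci..].
under [X in (_ +i* X)%C]eq_Rintegral do rewrite ImM.
rewrite RintegralD//; [|exact: ci..].
by rewrite !RintegralZr//; exact: continuous_circ_integrable.
Qed.

Lemma cint0 : cint (fun=> 0) = 0.
Proof. by rewrite /cint /= !Rintegral_cst//= !mul0r. Qed.

Lemma ccont_sum (I : Type) (s : seq I) (F : I -> R -> C) :
  (forall i, ccont (F i)) -> ccont (fun x => \sum_(i <- s) F i x).
Proof.
move=> cF; elim: s => [|i s IH].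
  by have := ccont_cst 0; congr ccont; apply/funext => x; rewrite big_nil.
have := ccontD (cF i) IH; congr ccont.
by apply/funext => x; rewrite big_cons.
Qed.

Lemma cint_sumZr (I : Type) (s : seq I) (F : I -> R -> C) (K : I -> C) :
  (forall i, ccont (F i)) ->
  cint (fun x => \sum_(i <- s) F i x * K i) = \sum_(i <- s) cint (F i) * K i.
Proof.
move=> cF; elim: s => [|i s IH].
  by rewrite big_nil -[RHS]cint0; congr cint; apply/funext => x; rewrite big_nil.
rewrite big_cons -IH -cintZr// -cintD.
- by congr cint; apply/funext => x; rewrite big_cons.
- by apply: ccontM => //; exact: ccont_cst.
- by apply: ccont_sum => j; apply: ccontM => //; exact: ccont_cst.
Qed.

End CircleIntegral.

(** * Iterated integrals of finite-rank functions *)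

Section FiniteRank.
Context {R : realType}.
Local Notation re := complex.Re.
Local Notation im := complex.Im.
Local Notation C := R[i]%C.

(* Finite sums of products of continuous one-variable functions: on them the
   iterated integral is explicit, so no Fubini theorem is needed. *)
Definition finrank (N : nat) (f : N.-tuple R -> C) : Prop :=
  exists (I : finType) (c : I -> C) (H : I -> 'I_N -> R -> C),
    (forall i j, ccont (H i j)) /\
    forall t, f t = \sum_i c i * \prod_j H i j (tnth t j).

Definition cubeC (N : nat) (f : N.-tuple R -> C) : C :=
  (cube_integral (fun t => re (f t)) +i* cube_integral (fun t => im (f t)))%C.

Lemma eq_cube_integral (N : nat) (f g : N.-tuple R -> R) :
  f =1 g -> cube_integral f = cube_integral g.
Proof. by move=> /funext ->. Qed.

Lemma eq_cubeC (N : nat) (f g : N.-tuple R -> C) : f =1 g -> cubeC f = cubeC g.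
Proof. by move=> /funext ->. Qed.

Lemma eq_finrank (N : nat) (f g : N.-tuple R -> C) :
  f =1 g -> finrank f -> finrank g.
Proof. by move=> /funext ->. Qed.

Lemma cubeC_cons (N : nat) (f : N.+1.-tuple R -> C) :
  cubeC f = cint (fun x => cubeC (fun t : N.-tuple R => f [tuple of x :: t])).
Proof. by []. Qed.

Lemma cubeC_finrank (N : nat) (I : finType) (c : I -> C) (H : I -> 'I_N -> R -> C) :
  (forall i j, ccont (H i j)) ->
  cubeC (fun t => \sum_i c i * \prod_j H i j (tnth t j)) =
  \sum_i c i * \prod_j cint (H i j).
Proof.
elim: N c H => [|N IH] c H cH.
  rewrite /cubeC /=; set s := (X in (re X +i* _)%C); rewrite -/s.
  rewrite (_ : (re s +i* im s)%C = s); last by case: s.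
  by apply: eq_bigr => i _; rewrite !big_ord0.
rewrite cubeC_cons.
transitivity (cint (fun x => \sum_i H i ord0 x * (c i * \prod_j cint (H i (lift ord0 j))))).
  congr cint; apply/funext => x.
  rewrite (eq_cubeC (g := fun t : N.-tuple R => \sum_i (c i * H i ord0 x) *
     \prod_j H i (lift ord0 j) (tnth t j))).
    rewrite (IH (fun i => c i * H i ord0 x) (fun i j => H i (lift ord0 j))) //.
    by apply: eq_bigr => i _; rewrite mulrCA mulrA.
  move=> t; apply: eq_bigr => i _; rewrite big_ord_recl tnth0 mulrA.
  by congr (_ * _); apply: eq_bigr => j _; rewrite tnthS.
rewrite cint_sumZr //.
by apply: eq_bigr => i _; rewrite big_ord_recl mulrCA.
Qed.

Lemma finrank_cst (N : nat) (c : C) : finrank (fun _ : N.-tuple R => c).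
Proof.
exists unit, (fun=> c), (fun _ _ _ => 1); split => [i j|t].
  exact: ccont_cst.
rewrite (big_pred1 tt) //=.
by rewrite big1_eq mulr1.
Qed.

Lemma finrank_coord (N : nat) (j : 'I_N) (h : R -> C) :
  ccont h -> finrank (fun t : N.-tuple R => h (tnth t j)).
Proof.
move=> ch; exists unit, (fun=> 1), (fun _ k => if k == j then h else fun=> 1).
split => [_ k|t]; first by case: ifP => // _; exact: ccont_cst.
rewrite (big_pred1 tt) //=.
by rewrite (bigD1 j) //= eqxx big1 ?mulr1 ?mul1r // => k /negPf ->.
Qed.

Lemma finrankD (N : nat) (f g : N.-tuple R -> C) :
  finrank f -> finrank g -> finrank (fun t => f t + g t).
Proof.
move=> [I [c [H [cH fE]]]] [J [d [K [cK gE]]]].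
exists (I + J)%type, (fun i => match i with inl i => c i | inr j => d j end),
  (fun i => match i with inl i => H i | inr j => K j end).
by split => [[i|j] k //|t]; rewrite big_sumType fE gE.
Qed.

Lemma finrankM (N : nat) (f g : N.-tuple R -> C) :
  finrank f -> finrank g -> finrank (fun t => f t * g t).
Proof.
move=> [I [c [H [cH fE]]]] [J [d [K [cK gE]]]].
exists (I * J)%type, (fun i => c i.1 * d i.2), (fun i k x => H i.1 k x * K i.2 k x).
split => [[i j] k /=|t]; first exact: ccontM.
rewrite fE gE mulr_suml -(pair_bigA _ (fun i j => (c i * d j) *
   \prod_k (H i k (tnth t k) * K j k (tnth t k)))) /=.
apply: eq_bigr => i _; rewrite mulr_sumr; apply: eq_bigr => j _.
by rewrite big_split /= mulrACA.
Qed.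

Lemma finrankZ (N : nat) (a : C) (f : N.-tuple R -> C) :
  finrank f -> finrank (fun t => a * f t).
Proof. by apply: finrankM; exact: finrank_cst. Qed.

Lemma finrank_sum (N : nat) (I : Type) (s : seq I) (P : pred I) (F : I -> N.-tuple R -> C) :
  (forall i, P i -> finrank (F i)) -> finrank (fun t => \sum_(i <- s | P i) F i t).
Proof.
move=> fF; elim: s => [|i s IH].
  by apply: (eq_finrank _ (finrank_cst N 0)) => t; rewrite big_nil.
case Pi: (P i); last first.
  by apply: (eq_finrank _ IH) => t; rewrite big_cons Pi.
by apply: (eq_finrank _ (finrankD (fF i Pi) IH)) => t; rewrite big_cons Pi.
Qed.

Lemma finrank_prod (N : nat) (I : Type) (s : seq I) (P : pred I) (F : I -> N.-tuple R -> C) :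
  (forall i, P i -> finrank (F i)) -> finrank (fun t => \prod_(i <- s | P i) F i t).
Proof.
move=> fF; elim: s => [|i s IH].
  by apply: (eq_finrank _ (finrank_cst N 1)) => t; rewrite big_nil.
case Pi: (P i); last first.
  by apply: (eq_finrank _ IH) => t; rewrite big_cons Pi.
by apply: (eq_finrank _ (finrankM (fF i Pi) IH)) => t; rewrite big_cons Pi.
Qed.

Lemma finrankX (N : nat) (f : N.-tuple R -> C) (k : nat) :
  finrank f -> finrank (fun t => f t ^+ k).
Proof.
move=> ff; elim: k => [|k IH]; first exact: finrank_cst.
by apply: (eq_finrank _ (finrankM ff IH)) => t; rewrite exprS.
Qed.

Lemma cubeCZ (N : nat) (a : C) (f : N.-tuple R -> C) :
  finrank f -> cubeC (fun t => a * f t) = a * cubeC f.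
Proof.
move=> [I [c [H [cH fE]]]].
rewrite (eq_cubeC fE) cubeC_finrank // mulr_sumr.
rewrite (eq_cubeC (g := fun t => \sum_i (a * c i) * \prod_j H i j (tnth t j))).
  by rewrite (cubeC_finrank (fun i => a * c i)) //; apply: eq_bigr => i _; rewrite mulrA.
by move=> t; rewrite fE mulr_sumr; apply: eq_bigr => i _; rewrite mulrA.
Qed.

Lemma cubeCD (N : nat) (f g : N.-tuple R -> C) :
  finrank f -> finrank g -> cubeC (fun t => f t + g t) = cubeC f + cubeC g.
Proof.
move=> [I [c [H [cH fE]]]] [J [d [K [cK gE]]]].
rewrite (eq_cubeC fE) (eq_cubeC gE) !cubeC_finrank //.
pose e (i : I + J) := match i with inl i => c i | inr j => d j end.
pose L (i : I + J) := match i with inl i => H i | inr j => K j end.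
rewrite (eq_cubeC (g := fun t => \sum_i e i * \prod_k L i k (tnth t k))).
  by rewrite cubeC_finrank ?big_sumType // => -[].
by move=> t; rewrite big_sumType fE gE.
Qed.

Lemma cubeC_sum (N : nat) (I : Type) (s : seq I) (P : pred I) (F : I -> N.-tuple R -> C) :
  (forall i, P i -> finrank (F i)) ->
  cubeC (fun t => \sum_(i <- s | P i) F i t) = \sum_(i <- s | P i) cubeC (F i).
Proof.
move=> fF; elim: s => [|i s IH].
  rewrite big_nil (eq_cubeC (g := fun t => 0 * 1)); last by move=> t; rewrite big_nil mul0r.
  by rewrite cubeCZ ?mul0r //; exact: finrank_cst.
rewrite big_cons; case Pi: (P i); last first.
  by rewrite -IH; apply: eq_cubeC => t; rewrite big_cons Pi.
rewrite -IH -cubeCD //; first by apply: eq_cubeC => t; rewrite big_cons Pi.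
  exact: fF.
exact: finrank_sum.
Qed.

Definition permt (N : nat) (s : {perm 'I_N}) (t : N.-tuple R) : N.-tuple R :=
  [tuple tnth t (s j) | j < N].

(** On a sum of products, permuting the angles only reindexes the factors of each product of
    one-variable integrals. *)
Lemma cubeC_perm (N : nat) (s : {perm 'I_N}) (f : N.-tuple R -> C) :
  finrank f -> cubeC (fun t => f (permt s t)) = cubeC f.
Proof.
move=> [I [c [H [cH fE]]]].
rewrite (eq_cubeC fE) cubeC_finrank //.
rewrite (eq_cubeC (g := fun t => \sum_i c i * \prod_j H i ((s^-1)%g j) (tnth t j))).
  rewrite (cubeC_finrank _ (H := fun i j => H i ((s^-1)%g j))) //; apply: eq_bigr => i _; congr (_ * _).
  by rewrite [RHS](reindex_inj (@perm_inj _ (s^-1)%g)).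
move=> t; rewrite fE; apply: eq_bigr => i _; congr (_ * _).
rewrite [RHS](reindex_inj (@perm_inj _ s)); apply: eq_bigr => j _.
by rewrite tnth_mktuple permK.
Qed.

Lemma finrank_cons (N : nat) (f : N.+1.-tuple R -> C) (x : R) :
  finrank f -> finrank (fun t : N.-tuple R => f [tuple of x :: t]).
Proof.
move=> [I [c [H [cH fE]]]].
exists I, (fun i => c i * H i ord0 x), (fun i j => H i (lift ord0 j)); split => // t.
rewrite fE; apply: eq_bigr => i _; rewrite big_ord_recl tnth0 mulrA.
by congr (_ * _); apply: eq_bigr => j _; rewrite tnthS.
Qed.

(** The inner integral is a finite combination of the factors in the first angle, so it can be the
    continuous side of the one-variable comparisons. *)
Lemma ccont_cubeC_cons (N : nat) (f : N.+1.-tuple R -> C) :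
  finrank f -> ccont (fun x => cubeC (fun t : N.-tuple R => f [tuple of x :: t])).
Proof.
move=> [I [c [H [cH fE]]]].
have := @ccont_sum R I (index_enum I) (fun i x => H i ord0 x * (c i * \prod_j cint (H i (lift ord0 j)))).
move=> /(_ (fun i => ccontM (cH i ord0) (ccont_cst _))); congr ccont.
apply/funext => x; apply/esym.
rewrite (eq_cubeC (g := fun t : N.-tuple R => \sum_i (c i * H i ord0 x) *
     \prod_j H i (lift ord0 j) (tnth t j))).
  rewrite (cubeC_finrank (fun i => c i * H i ord0 x) (H := fun i j => H i (lift ord0 j))) //.
  by apply: eq_bigr => i _; rewrite mulrCA mulrA.
move=> t; rewrite fE; apply: eq_bigr => i _; rewrite big_ord_recl tnth0 mulrA.
by congr (_ * _); apply: eq_bigr => j _; rewrite tnthS.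
Qed.

Definition rfinrank (N : nat) (f : N.-tuple R -> R) := finrank (fun t => (f t)%:C%C).

Lemma cube_integral0 (N : nat) : cube_integral (fun _ : N.-tuple R => 0) = 0.
Proof.
by elim: N => //= N ->; rewrite Rintegral_cst ?mul0r.
Qed.

Lemma cubeC_real (N : nat) (f : N.-tuple R -> R) :
  cubeC (fun t => (f t)%:C%C) = (cube_integral f)%:C%C.
Proof. by rewrite /cubeC /= cube_integral0. Qed.

Lemma continuous_cube_cons (N : nat) (f : N.+1.-tuple R -> R) : rfinrank f ->
  continuous (fun x => cube_integral (fun t : N.-tuple R => f [tuple of x :: t])).
Proof.
move=> /ccont_cubeC_cons [h _].
rewrite (_ : (fun x => _) = fun x => re (cubeC (fun t : N.-tuple R => (f [tuple of x :: t])%:C%C))) //.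
Qed.

Lemma cube_integral_ge0 (N : nat) (f : N.-tuple R -> R) :
  (forall t, 0 <= f t) -> 0 <= cube_integral f.
Proof.
elim: N f => //= N IH f f0; apply: fine_ge0; apply: integral_ge0 => x _.
by rewrite lee_fin; exact: IH.
Qed.

(** Only the upper function has finite rank: the lower one will be a truncated statistic of the
    configuration, about whose inner integrals nothing is known. *)
Lemma le_cube_integral (N : nat) (f g : N.-tuple R -> R) : rfinrank g ->
  (forall t, 0 <= f t) -> (forall t, f t <= g t) ->
  cube_integral f <= cube_integral g.
Proof.
elim: N f g => //= N IH f g rg f0 fg; apply: le_Rintegral_circ.
- exact: continuous_cube_cons.
- by move=> x; exact: cube_integral_ge0.
- by move=> x; apply: IH => //; by apply: (finrank_cons (N := N) (f := fun t => (g t)%:C%C)).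
Qed.

(** The uniform bound keeps every inner integral of [f] finite, so that none collapses to the
    default value 0. *)
Lemma ge_cube_integral (N : nat) (B : R) (f g : N.-tuple R -> R) : rfinrank g ->
  (forall t, 0 <= f t <= B) -> (forall t, g t <= f t) ->
  cube_integral g <= cube_integral f.
Proof.
elim: N f g => //= N IH f g rg f0 gf.
apply: (@ge_Rintegral_circ _ _ _ (cube_integral (fun _ : N.-tuple R => B))).
- exact: continuous_cube_cons.
- move=> x; apply/andP; split.
    by apply: cube_integral_ge0 => t; case/andP: (f0 [tuple of x :: t]).
  apply: le_cube_integral; first exact: finrank_cst.
    by move=> t; case/andP: (f0 [tuple of x :: t]).
  by move=> t; case/andP: (f0 [tuple of x :: t]).
- by move=> x; apply: IH => //; by apply: (finrank_cons (N := N) (f := fun t => (g t)%:C%C)).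
Qed.

End FiniteRank.

(** * Characters of the torus and the Euler operator *)

Section Characters.
Context {R : realType}.
Local Notation mu := (@lebesgue_measure R).
Local Notation circ := [set` `[(- pi)%R, (pi : R)[].
Local Notation C := R[i]%C.

Lemma cisD (x y : R) : cis (x + y) = cis x * cis y.
Proof.
apply/eqP; rewrite eq_complex /= cosD sinD; apply/andP; split => //.
by rewrite addrC.
Qed.

Lemma cis0 : cis (0 : R) = 1.
Proof. by apply/eqP; rewrite eq_complex /= cos0 sin0 !eqxx. Qed.

Lemma cis_neq0 (x : R) : cis x != 0.
Proof.
apply: contra_eq_neq (cisD x (- x)) => ->; rewrite mul0r subrr cis0.
exact: oner_neq0.
Qed.

Lemma cisN (x : R) : cis (- x) = (cis x)^-1.
Proof. by apply: (mulfI (cis_neq0 x)); rewrite -cisD subrr cis0 mulfV // cis_neq0. Qed.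

Lemma conj_cis (x : R) : ((cis x)^*)%C = (cis x)^-1.
Proof. by rewrite -cisN /cis cosN sinN. Qed.

Lemma cis_expn (x : R) (k : nat) : cis x ^+ k = cis (k%:R * x).
Proof.
elim: k => [|k IH]; first by rewrite mul0r cis0.
by rewrite exprS IH -cisD -[k.+1]add1n natrD mulrDl mul1r.
Qed.

Lemma cis_expz (x : R) (e : int) : cis x ^ e = cis (e%:~R * x).
Proof.
case: e => k; first by rewrite -exprnP cis_expn.
by rewrite NegzE mulrNz mulNr cisN -cis_expn exprnN.
Qed.

Lemma ccont_cis_expz (e : int) : ccont (fun x : R => cis x ^ e).
Proof.
have -> : (fun x : R => cis x ^ e) = (fun x => cis (e%:~R * x)).
  by apply/funext => x; exact: cis_expz.
have cm : continuous (fun x : R => e%:~R * x).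
  by move=> x; apply: mulrl_continuous.
split => x /=.
  by apply: (continuous_comp (cm x)); exact: continuous_cos.
by apply: (continuous_comp (cm x)); exact: continuous_sin.
Qed.

Lemma sin_intpi (e : int) : sin (e%:~R * pi : R) = 0.
Proof.
have H (k : nat) : sin (k%:R * pi : R) = 0.
  by elim: k => [|k IH]; rewrite ?mul0r ?sin0 // -natr1 mulrDl mul1r sinDpi IH oppr0.
by case: e => k; rewrite ?NegzE ?mulrNz ?mulNr ?sinN H ?oppr0.
Qed.

Lemma Rintegral_circ_FTC (f F : R -> R) : continuous f ->
  (forall x : R, is_derive x 1 F (f x)) ->
  \int[mu]_(x in circ) f x = F pi - F (- pi).
Proof.
move=> cf dF.
have pipos : (- pi : R) < pi by have := pi_gt0 R; lra.
have cF x : {for x, continuous F}.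
  by apply: differentiable_continuous; apply/derivable1_diffP; have [] := dF x.
rewrite Rintegral_itv_bndo_bndc; last by apply: continuous_circ_integrable.
rewrite /Rintegral (continuous_FTC2 (F := F)) //.
- exact: continuous_subspaceT.
- split; first by move=> x _; have [] := dF x.
    by apply: cvg_at_right_filter; exact: cF.
  by apply: cvg_at_left_filter; exact: cF.
- by move=> x _; rewrite derive1E; have [_ ->] := dF x.
Qed.

Lemma cint_cis_expz (e : int) :
  cint (fun x : R => cis x ^ e) = if e == 0 then (2 * pi)%:C%C else 0.
Proof.
have [->|e0] := eqVneq e 0.
  rewrite (_ : (fun=> _) = (fun=> 1)) //.
  rewrite /cint /= !Rintegral_cst ?mul0r ?mul1r //.
  have -> : fine (mu circ) = 2 * pi; last by [].
  rewrite [mu _]lebesgue_measure_itv /= lte_fin.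
  have -> : (- pi < pi :> R) by have := pi_gt0 R; lra.
  by rewrite /= opprK mulr_natl mulr2n.
have -> : (fun x : R => cis x ^ e) = (fun x => cis (e%:~R * x)).
  by apply/funext => x; exact: cis_expz.
have e0' : e%:~R != 0 :> R by rewrite intr_eq0.
have cm : continuous (fun x : R => e%:~R * x).
  by move=> x; apply: mulrl_continuous.
have cc : continuous (fun x : R => cos (e%:~R * x)).
  by move=> x; apply: (continuous_comp (cm x)); exact: continuous_cos.
have cs : continuous (fun x : R => sin (e%:~R * x)).
  by move=> x; apply: (continuous_comp (cm x)); exact: continuous_sin.
have dS (x : R) : is_derive x 1 (fun x => sin (e%:~R * x) / e%:~R) (cos (e%:~R * x)).
  by apply: is_derive_eq; rewrite /GRing.scale /=; field.
have dC (x : R) : is_derive x 1 (fun x => - cos (e%:~R * x) / e%:~R) (sin (e%:~R * x)).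
  by apply: is_derive_eq; rewrite /GRing.scale /=; field.
rewrite /cint /= (Rintegral_circ_FTC cc dS) (Rintegral_circ_FTC cs dC).
by rewrite mulrN sinN cosN sin_intpi !(oppr0, mul0r, subrr).
Qed.

End Characters.
Arguments cis {R} t : simpl never.

Section EulerOperator.
Context {R : realType}.
Local Notation C := R[i]%C.

Definition character (N : nat) (e : 'I_N -> int) (t : N.-tuple R) : C :=
  \prod_j cis (tnth t j) ^ e j.

(* The Euler operator \sum_j a_j z_j d/dz_j, z_j = cis t_j, maps the Laurent
   polynomial f to g. *)
Definition eulerd (N : nat) (a : 'I_N -> int) (f g : N.-tuple R -> C) : Prop :=
  exists (I : finType) (c : I -> C) (e : I -> 'I_N -> int),
    (forall t, f t = \sum_i c i * character (e i) t) /\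
    (forall t, g t = \sum_i c i * (\sum_j a j * e i j)%:~R * character (e i) t).

Variable N : nat.
Implicit Types (a : 'I_N -> int) (f g : N.-tuple R -> C).

Lemma eulerd_finrankl a f g : eulerd a f g -> finrank f.
Proof.
move=> [I [c [e [fE gE]]]]; exists I, c, (fun i j x => cis x ^ e i j).
by split => // i j; exact: ccont_cis_expz.
Qed.

(** Integration by parts on the torus: a character with a nonzero exponent has integral zero, and
    the trivial character is annihilated by the operator. *)
Lemma eulerd_cubeC a f g : eulerd a f g -> cubeC g = 0.
Proof.
move=> [I [c [e [fE gE]]]]; rewrite (eq_cubeC gE).
rewrite (cubeC_finrank (fun i => c i * (\sum_j a j * e i j)%:~R)
  (H := fun i j x => cis x ^ e i j)); last by move=> i j; exact: ccont_cis_expz.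
apply: big1 => i _; case: (pickP (fun j => e i j != 0)) => [j ej|e0].
  by rewrite [X in _ * X](bigD1 j) // cint_cis_expz (negPf ej) /= mul0r mulr0.
rewrite big1 ?mulr0 ?mul0r // => j _.
by have /negbFE/eqP -> := e0 j; rewrite mulr0.
Qed.

Lemma eq_eulerd a f f' g g' : f =1 f' -> g =1 g' -> eulerd a f g -> eulerd a f' g'.
Proof. by move=> /funext -> /funext ->. Qed.

Lemma eulerd_cst a (c : C) : eulerd a (fun=> c) (fun=> 0).
Proof.
exists unit, (fun=> c), (fun _ _ => 0); split => t; rewrite (big_pred1 tt) //=.
  by rewrite /character big1 ?mulr1 // => j _; rewrite expr0z.
by rewrite big1 ?mulr0 ?mul0r // => j _; rewrite mulr0.
Qed.

Lemma eulerd_coord a (j : 'I_N) (k : int) :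
  eulerd a (fun t => cis (tnth t j) ^ k)
    (fun t => (a j * k)%:~R * cis (tnth t j) ^ k).
Proof.
exists unit, (fun=> 1), (fun _ i => if i == j then k else 0).
have ch t : character (fun i => if i == j then k else 0) t = cis (tnth t j) ^ k.
  rewrite /character (bigD1 j) //= eqxx big1 ?mulr1 // => i /negPf ->.
  by rewrite expr0z.
split => t; rewrite (big_pred1 tt) //= ch mul1r //.
by rewrite (bigD1 j) //= eqxx big1 ?addr0 // => i /negPf ->; rewrite mulr0.
Qed.

Lemma eulerdD a f f' g g' : eulerd a f f' -> eulerd a g g' ->
  eulerd a (fun t => f t + g t) (fun t => f' t + g' t).
Proof.
move=> [I [c [e [fE f'E]]]] [J [d [h [gE g'E]]]].
exists (I + J)%type, (fun i => match i with inl i => c i | inr j => d j end),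
  (fun i => match i with inl i => e i | inr j => h j end).
by split => t; rewrite big_sumType ?fE ?gE ?f'E ?g'E.
Qed.

Lemma eulerdM a f f' g g' : eulerd a f f' -> eulerd a g g' ->
  eulerd a (fun t => f t * g t) (fun t => f' t * g t + f t * g' t).
Proof.
move=> [I [c [e [fE f'E]]]] [J [d [h [gE g'E]]]].
exists (I * J)%type, (fun i => c i.1 * d i.2), (fun i j => e i.1 j + h i.2 j).
have chD (u v : 'I_N -> int) t :
    character (fun j => u j + v j) t = character u t * character v t.
  by rewrite /character -big_split /=; apply: eq_bigr => j _; rewrite expfzDr // cis_neq0.
split => t.
  rewrite fE gE mulr_suml -(pair_bigA _ (fun i j => c i * d j *
    character (fun k => e i k + h j k) t)) /=.
  apply: eq_bigr => i _; rewrite mulr_sumr; apply: eq_bigr => j _.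
  by rewrite chD mulrACA.
rewrite fE gE f'E g'E.
rewrite -(pair_bigA _ (fun i j => c i * d j * (\sum_k a k * (e i k + h j k))%:~R *
    character (fun k => e i k + h j k) t)) /=.
rewrite !mulr_suml -big_split /=; apply: eq_bigr => i _.
rewrite !mulr_sumr -big_split /=; apply: eq_bigr => j _.
have -> : \sum_k a k * (e i k + h j k) = \sum_k a k * e i k + \sum_k a k * h j k.
  by rewrite -big_split /=; apply: eq_bigr => k _; rewrite mulrDr.
by rewrite chD rmorphD /=; ring.
Qed.

Lemma eulerdZ a (c : C) f g : eulerd a f g ->
  eulerd a (fun t => c * f t) (fun t => c * g t).
Proof.
move=> fg; apply: eq_eulerd (eulerdM (eulerd_cst a c) fg) => // t.
by rewrite mul0r add0r.
Qed.

Lemma eulerdX a f g (k : nat) : eulerd a f g ->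
  eulerd a (fun t => f t ^+ k) (fun t => k%:R * f t ^+ k.-1 * g t).
Proof.
move=> fg; elim: k => [|k IH].
  by apply: eq_eulerd (eulerd_cst a 1) => // t; rewrite !mul0r.
apply: eq_eulerd (eulerdM fg IH) => t; first by rewrite exprS.
by case: k {IH} => [|k] /=; rewrite ?expr0 ?exprS -?natr1; ring.
Qed.

Lemma eulerd_sum a (I : Type) (s : seq I) (P : pred I) (F G : I -> N.-tuple R -> C) :
  (forall i, P i -> eulerd a (F i) (G i)) ->
  eulerd a (fun t => \sum_(i <- s | P i) F i t) (fun t => \sum_(i <- s | P i) G i t).
Proof.
move=> FG; elim: s => [|i s IH].
  by apply: eq_eulerd (eulerd_cst a 0) => t; rewrite big_nil.
case Pi: (P i); last by apply: eq_eulerd IH => t; rewrite big_cons Pi.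
by apply: eq_eulerd (eulerdD (FG i Pi) IH) => t; rewrite big_cons Pi.
Qed.

Lemma eulerd_prod a (I : finType) (P : pred I) (F G : I -> N.-tuple R -> C) :
  (forall i, P i -> eulerd a (F i) (G i)) ->
  eulerd a (fun t => \prod_(i | P i) F i t)
    (fun t => \sum_(i | P i) G i t * \prod_(k | P k && (k != i)) F k t).
Proof.
move=> FG; elim: (index_enum I) (index_enum_uniq I) => [_|i s IH /= /andP[is_ us]].
  by apply: eq_eulerd (eulerd_cst a 1) => t; rewrite big_nil.
(* [i] does not occur in [s], so excluding it from a product over [s] changes nothing. *)
have sE (Q : pred I) (K : I -> C) :
    \prod_(l <- s | Q l && (l != i)) K l = \prod_(l <- s | Q l) K l.
  rewrite big_seq_cond [RHS]big_seq_cond; apply: eq_bigl => l.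
  case ls: (l \in s) => //=; case: (Q l) => //=.
  by apply: contraNneq is_ => <-.
case Pi: (P i); last first.
  apply: eq_eulerd (IH us) => t; rewrite big_cons Pi //.
  apply: eq_bigr => k Pk; congr (_ * _).
  by rewrite big_cons Pi.
apply: eq_eulerd (eulerdM (FG i Pi) (IH us)) => t; first by rewrite big_cons Pi.
rewrite big_cons Pi [in RHS]big_cons eqxx andbF sE mulr_sumr; congr (_ + _).
rewrite big_seq_cond [RHS]big_seq_cond; apply: eq_bigr => k /andP[ks Pk].
rewrite [in RHS]big_cons Pi (_ : i != k) /= 1?mulrCA //.
by apply: contraNneq is_ => ->.
Qed.

Lemma eulerd_conj a f g : eulerd a f g ->
  eulerd a (fun t => ((f t)^*)%C) (fun t => - ((g t)^*)%C).
Proof.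
move=> [I [c [e [fE gE]]]].
exists I, (fun i => ((c i)^*)%C), (fun i j => - e i j).
have chN u t : ((character u t)^*)%C = character (fun j => - u j) t.
  rewrite /character rmorph_prod; apply: eq_bigr => j _.
  by rewrite /= !cis_expz conj_cis -cisN mulrNz mulNr.
split => t.
  by rewrite fE rmorph_sum; apply: eq_bigr => i _; rewrite rmorphM /= chN.
rewrite gE rmorph_sum -sumrN; apply: eq_bigr => i _.
rewrite !rmorphM /= chN (_ : \sum_j a j * - e i j = - \sum_j a j * e i j); last first.
  by rewrite -sumrN; apply: eq_bigr => j _; rewrite mulrN.
by rewrite mulrNz mulrN mulNr rmorph_int.
Qed.

(** Euler's identity taken as a definition: with all weights equal to 1 the operator multiplies by
    the total degree, possibly negative. The zero function has every degree. *)
Definition homog f (k : int) := eulerd (fun=> 1) f (fun t => k%:~R * f t).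

Lemma eq_homog f g (k : int) : f =1 g -> homog f k -> homog g k.
Proof. by move=> /funext ->. Qed.

Lemma homog_cubeC f (k : int) : homog f k -> k != 0 -> cubeC f = 0.
Proof.
move=> hf k0; have := eulerd_cubeC hf.
rewrite cubeCZ; last exact: eulerd_finrankl hf.
by move/eqP; rewrite mulf_eq0 intr_eq0 (negPf k0) => /eqP.
Qed.

Lemma homogM f g (k l : int) : homog f k -> homog g l ->
  homog (fun t => f t * g t) (k + l).
Proof.
move=> hf hg; apply: eq_eulerd (eulerdM hf hg) => // t.
by rewrite intrD; ring.
Qed.

Lemma homog_cst (c : C) : homog (fun=> c) 0.
Proof. by apply: eq_eulerd (eulerd_cst _ c) => // t; rewrite mul0r. Qed.

Lemma homog_coord (j : 'I_N) (k : int) : homog (fun t => cis (tnth t j) ^ k) k.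
Proof. by apply: eq_eulerd (eulerd_coord _ j k) => // t; rewrite mul1r. Qed.

Lemma homogD f g (k : int) : homog f k -> homog g k ->
  homog (fun t => f t + g t) k.
Proof.
by move=> hf hg; apply: eq_eulerd (eulerdD hf hg) => // t; rewrite mulrDr.
Qed.

Lemma homog_sum (I : Type) (s : seq I) (P : pred I) (F : I -> N.-tuple R -> C) (k : int) :
  (forall i, P i -> homog (F i) k) -> homog (fun t => \sum_(i <- s | P i) F i t) k.
Proof.
by move=> FG; apply: eq_eulerd (eulerd_sum s FG) => // t; rewrite mulr_sumr.
Qed.

Lemma homog_prod0 (I : Type) (s : seq I) (P : pred I) (F : I -> N.-tuple R -> C) :
  (forall i, P i -> homog (F i) 0) -> homog (fun t => \prod_(i <- s | P i) F i t) 0.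
Proof.
move=> FG; elim: s => [|i s IH].
  by apply: eq_eulerd (homog_cst 1) => // t; rewrite big_nil.
case Pi: (P i); last by apply: eq_eulerd IH => // t; rewrite big_cons Pi.
by apply: eq_eulerd (homogM (FG i Pi) IH) => // t; rewrite ?big_cons Pi.
Qed.

Lemma homog_conj f (k : int) : homog f k -> homog (fun t => ((f t)^*)%C) (- k).
Proof.
move=> hf; apply: eq_eulerd (eulerd_conj hf) => // t.
by rewrite rmorphM /= rmorph_int mulrNz mulNr.
Qed.

End EulerOperator.

(** * Aomoto's recursion *)

Section AomotoRecursion.
Context {R : realType}.
Local Notation C := R[i]%C.
Variable N : nat.
Implicit Types (t : N.-tuple R) (i : 'I_N * 'I_N) (p k j : 'I_N).

Definition crd j t : C := cis (tnth t j).

Lemma crd_neq0 j t : crd j t != 0. Proof. exact: cis_neq0. Qed.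

Lemma crd_permt (s : {perm 'I_N}) j t : crd j (permt s t) = crd (s j) t.
Proof. by rewrite /crd tnth_mktuple. Qed.

Lemma eulerd_crd (a : 'I_N -> int) j :
  eulerd a (crd j) (fun t => (a j)%:~R * crd j t).
Proof.
by apply: eq_eulerd (eulerd_coord a j 1) => t; rewrite ?mulr1 expr1z.
Qed.

Lemma eulerd_crdV (a : 'I_N -> int) j :
  eulerd a (fun t => (crd j t)^-1) (fun t => - (a j)%:~R * (crd j t)^-1).
Proof.
by apply: eq_eulerd (eulerd_coord a j (-1)) => t; rewrite ?mulrN1 ?mulrNz exprN1.
Qed.

Lemma finrank_crd j : finrank (crd j).
Proof. exact: eulerd_finrankl (eulerd_crd (fun=> 0) j). Qed.

Lemma finrank_crdV j : finrank (fun t => (crd j t)^-1).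
Proof. exact: eulerd_finrankl (eulerd_crdV (fun=> 0) j). Qed.

Lemma finrankN (f : N.-tuple R -> C) : finrank f -> finrank (fun t => - f t).
Proof. by move/(finrankZ (-1)); apply: eq_finrank => t; rewrite mulN1r. Qed.

(** The two orders of a pair multiply to [|z_j - z_k|^2]. Over ordered pairs, as in Dyson's constant
    term identity, the circular weight thus becomes a Laurent polynomial. *)
Definition dysonf i t : C := 1 - crd i.1 t / crd i.2 t.

Lemma eulerd_dysonf (a : 'I_N -> int) i :
  eulerd a (dysonf i) (fun t => (a i.2 - a i.1)%:~R * (crd i.1 t / crd i.2 t)).
Proof.
apply: eq_eulerd (eulerdD (eulerd_cst a 1) (eulerdZ (-1)
  (eulerdM (eulerd_crd a i.1) (eulerd_crdV a i.2)))) => t.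
  by rewrite mulN1r.
by rewrite intrB; ring.
Qed.

Lemma finrank_dysonf i : finrank (dysonf i).
Proof. exact: eulerd_finrankl (eulerd_dysonf (fun=> 0) i). Qed.

Definition dyson (n : nat) t : C := \prod_(i | i.1 != i.2) dysonf i t ^+ n.

Definition dyson_rest (n : nat) p k t : C :=
  \prod_(i | [&& i.1 != i.2, i != (p, k) & i != (k, p)]) dysonf i t ^+ n.

Lemma finrank_dyson n : finrank (dyson n).
Proof. by apply: finrank_prod => i _; apply: finrankX; exact: finrank_dysonf. Qed.

Lemma finrank_dyson_rest n p k : finrank (dyson_rest n p k).
Proof. by apply: finrank_prod => i _; apply: finrankX; exact: finrank_dysonf. Qed.

Lemma dyson_split n p k t : p != k ->
  dyson n t = (dysonf (p, k) t * dysonf (k, p) t) ^+ n * dyson_rest n p k t.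
Proof.
move=> pk; rewrite /dyson (bigD1 (p, k)) //= (bigD1 (k, p)) /=; last first.
  by rewrite eq_sym pk /= xpair_eqE negb_and eq_sym pk.
rewrite mulrA -exprMn; congr (_ * _); apply: eq_bigl => i.
by rewrite andbA.
Qed.

Lemma dysonf_permt (s : {perm 'I_N}) i t :
  dysonf i (permt s t) = dysonf (s i.1, s i.2) t.
Proof. by rewrite /dysonf !crd_permt. Qed.

Lemma pair_perm_inj (s : {perm 'I_N}) : injective (fun i => (s i.1, s i.2)).
Proof. by move=> [a b] [c d] /= [/perm_inj -> /perm_inj ->]. Qed.

Lemma dyson_permt n (s : {perm 'I_N}) t : dyson n (permt s t) = dyson n t.
Proof.
rewrite /dyson [RHS](reindex_inj (@pair_perm_inj s)) /=.
by apply: eq_big => [i|i _]; rewrite ?(inj_eq perm_inj) ?dysonf_permt.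
Qed.

Lemma dyson_rest_tperm n p k t :
  dyson_rest n p k (permt (tperm p k) t) = dyson_rest n p k t.
Proof.
rewrite /dyson_rest [RHS](reindex_inj (@pair_perm_inj (tperm p k))) /=.
apply: eq_big => [[a b] /=|i _]; last by rewrite dysonf_permt.
have pE a' : (tperm p k a' == p) = (a' == k).
  by rewrite -{2}(tpermR p k) (inj_eq perm_inj).
have kE a' : (tperm p k a' == k) = (a' == p).
  by rewrite -{2}(tpermL p k) (inj_eq perm_inj).
rewrite (inj_eq perm_inj) !xpair_eqE !pE !kE.
by congr (_ && _); rewrite andbC.
Qed.

(* The logarithmic derivative in z_p of the pair {p, k} is
   n (z_p + z_k) / (z_p - z_k); one factor (1 - z_p/z_k) (1 - z_k/z_p) absorbs
   its pole, whence the exponent n.-1. *)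
Lemma eulerd_dyson n p :
  eulerd (fun j => (j == p)%:Z) (dyson n)
    (fun t => \sum_(k | k != p) n%:R * (dysonf (p, k) t * dysonf (k, p) t) ^+ n.-1 *
       (crd k t / crd p t - crd p t / crd k t) * dyson_rest n p k t).
Proof.
apply: eq_eulerd (eulerd_prod (P := fun i => i.1 != i.2)
  (fun i _ => eulerdX n (eulerd_dysonf (fun j => (j == p)%:Z) i))) => // t.
pose S j k := n%:R * dysonf (j, k) t ^+ n.-1 * (crd j t / crd k t) *
  \prod_(i | (i.1 != i.2) && (i != (j, k))) dysonf i t ^+ n.
(* The operator weights the factor of the ordered pair (j, k) by [[k = p] - [j = p]], so only pairs
   containing [p] survive, each in both orders. *)
transitivity (\sum_j \sum_(k | j != k) (((k == p)%:R - (j == p)%:R) * S j k)).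
  rewrite pair_big_dep /=; apply: eq_bigr => -[j k] /= _.
  by rewrite /S intrB /= -!pmulrn; ring.
transitivity (\sum_(k | k != p) (S k p - S p k)).
  transitivity (\sum_j \sum_(k | j != k) (k == p)%:R * S j k -
                \sum_j \sum_(k | j != k) (j == p)%:R * S j k).
    rewrite -sumrB; apply: eq_bigr => j _; rewrite -sumrB; apply: eq_bigr => k _.
    by rewrite mulrBl.
  rewrite sumrB; congr (_ - _).
    rewrite (exchange_big_dep xpredT) //= (bigD1 p) //= [X in _ + X]big1 ?addr0; last first.
      by move=> k /negPf kp; apply: big1 => j _; rewrite kp mul0r.
    by apply: eq_bigr => j _; rewrite eqxx mul1r.
  rewrite (bigD1 p) //= [X in _ + X]big1 ?addr0; last first.
    by move=> k /negPf kp; apply: big1 => j _; rewrite kp mul0r.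
  by apply: eq_big => [j|j _]; rewrite ?eqxx ?mul1r // eq_sym.
apply: eq_bigr => k kp.
have pk : p != k by rewrite eq_sym.
have E1 : \prod_(i | (i.1 != i.2) && (i != (p, k))) dysonf i t ^+ n =
    dysonf (k, p) t ^+ n * dyson_rest n p k t.
  rewrite (bigD1 (k, p)) /=; last by rewrite kp xpair_eqE negb_and kp.
  by congr (_ * _); apply: eq_bigl => i; rewrite andbA.
have E2 : \prod_(i | (i.1 != i.2) && (i != (k, p))) dysonf i t ^+ n =
    dysonf (p, k) t ^+ n * dyson_rest n p k t.
  rewrite (bigD1 (p, k)) /=; last by rewrite pk xpair_eqE negb_and pk.
  by congr (_ * _); apply: eq_bigl => i; rewrite andbAC andbA.
(* For [n = 0] both sides carry the factor [n], so the value of [n.-1] is immaterial. *)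
rewrite /S E1 E2; case: n {S E1 E2} => [|n] /=; first by rewrite !mul0r subrr.
have zp := crd_neq0 p t; have zk := crd_neq0 k t.
rewrite /dysonf /= exprMn !exprS.
by field; rewrite zp zk.
Qed.

Definition jacobi (c b : nat) t : C :=
  \prod_j ((1 - crd j t) ^+ c * (crd j t)^-1 ^+ b).

Lemma jacobi_permt c b (s : {perm 'I_N}) t : jacobi c b (permt s t) = jacobi c b t.
Proof.
rewrite /jacobi [RHS](reindex_inj (@perm_inj _ s)).
by apply: eq_bigr => j _; rewrite crd_permt.
Qed.

Lemma finrank_jacobi c b : finrank (jacobi c b).
Proof.
apply: finrank_prod => j _; apply: finrankM; apply: finrankX.
  by apply: finrankD; [exact: finrank_cst | apply: finrankN; exact: finrank_crd].
exact: finrank_crdV.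
Qed.

(** By symmetry, its average for [p <= N] is that of the p-th elementary symmetric polynomial
    divided by its number of terms, the quantity in Aomoto's argument. Only indices below [p] enter,
    hence not [z_p]. *)
Definition crdprod (p : nat) t : C := \prod_(j < N | (j < p)%N) crd j t.

Lemma finrank_crdprod p : finrank (crdprod p).
Proof. by apply: finrank_prod => j _; exact: finrank_crd. Qed.

(* The averages linked by Aomoto's recursion in p; [jacobi c b] is the product
   of the (1 - z_j)^c z_j^(-b). *)
Definition aomoto (c b n p : nat) : C :=
  cubeC (fun t => crdprod p t * jacobi c b t * dyson n t).

(** Permuting the angles leaves the integral unchanged, so [f] may be averaged with its image. *)
Lemma cubeC_symm (s : {perm 'I_N}) (f g : N.-tuple R -> C) : finrank f -> finrank g ->
  (forall t, f t + f (permt s t) = g t) -> 2 * cubeC f = cubeC g.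
Proof.
move=> ff fg E; rewrite -(eq_cubeC E) cubeCD //.
  by rewrite cubeC_perm // mulr_natl mulr2n.
(* The image of [f] under the permutation has finite rank because it is [g - f]. *)
suff : finrank (fun t => g t + - f t) by apply: eq_finrank => t; rewrite -E addrAC subrr add0r.
by apply: finrankD => //; exact: finrankN.
Qed.

End AomotoRecursion.

Section AomotoStep.
Context {R : realType}.
Variables (N c b n : nat).
Hypothesis n_gt0 : (0 < n)%N.
Implicit Types (t : N.-tuple R) (p k j : 'I_N).

Let D (p : 'I_N) : 'I_N -> int := fun j => (j == p)%:Z.

Lemma crdprodS p t : crdprod p.+1 t = crd p t * crdprod p t.
Proof.
rewrite /crdprod (bigD1 p) ?ltnSn //=; congr (_ * _); apply: eq_bigl => j.
by rewrite ltnS ltn_neqAle andbC.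
Qed.

Lemma eulerd_crdprod p : eulerd (D p) (@crdprod R N p) (fun=> 0).
Proof.
apply: eq_eulerd (eulerd_prod (fun j _ => eulerd_crd (D p) j)) => // t.
apply: big1 => j jp; rewrite /D (_ : j == p = false) ?mul0r ?mul0r //.
by apply: contraTF jp => /eqP ->; rewrite ltnn.
Qed.

Lemma eulerd_one_sub_crd (a : 'I_N -> int) j :
  eulerd a (fun t : N.-tuple R => 1 - crd j t) (fun t => - ((a j)%:~R * crd j t)).
Proof.
apply: eq_eulerd (eulerdD (eulerd_cst a 1) (eulerdZ (-1) (eulerd_crd a j))) => t.
  by rewrite mulN1r.
by rewrite add0r mulN1r.
Qed.

(* [jacobi c b] with one more factor 1 - z_p, so that its logarithmic
   derivative in z_p has no pole. *)
Lemma eulerd_jacobi p :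
  eulerd (D p) (fun t : N.-tuple R => (1 - crd p t) * jacobi c b t)
    (fun t => - (c.+1%:R * crd p t + b%:R * (1 - crd p t)) * jacobi c b t).
Proof.
pose K t := \prod_(j | j != p) ((1 - crd j t) ^+ c * (crd j t)^-1 ^+ b).
have KE t : jacobi c b t = (1 - crd p t) ^+ c * (crd p t)^-1 ^+ b * K t.
  by rewrite /jacobi (bigD1 p).
have dK : eulerd (D p) K (fun=> 0).
  apply: eq_eulerd (eulerd_prod (P := fun j => j != p) (fun j _ =>
    eulerdM (eulerdX c (eulerd_one_sub_crd (D p) j))
            (eulerdX b (eulerd_crdV (D p) j)))) => // t.
  apply: big1 => j /negPf jp; rewrite /D jp.
  by rewrite !(mul0r, oppr0, mulr0, addr0, add0r).
apply: eq_eulerd (eulerdM (eulerdM (eulerdX c.+1 (eulerd_one_sub_crd (D p) p))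
   (eulerdX b (eulerd_crdV (D p) p))) dK) => t; rewrite KE.
  by rewrite exprS; ring.
rewrite /D eqxx mul1r mulr0 addr0 /=.
have zp := crd_neq0 p t.
case: b => [|b'] /=; first by rewrite !expr0 exprS; ring.
by rewrite !exprS; field.
Qed.

(** The contribution of [k] to the Euler derivative in [z_p] of [crdprod p], times [1 - z_p],
    [jacobi c b] and [dyson n]. *)
Let F p k t := crdprod p t * ((1 - crd p t) * jacobi c b t) *
  (n%:R * (dysonf (p, k) t * dysonf (k, p) t) ^+ n.-1 *
       (crd k t / crd p t - crd p t / crd k t) * dyson_rest n p k t).

Ltac fr := repeat first [ exact: finrank_crd | exact: finrank_crdV
  | exact: finrank_crdprod | exact: finrank_jacobi | exact: finrank_dyson
  | exact: finrank_dyson_rest | exact: finrank_dysonf | apply: finrank_cst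
  | apply: finrankX | apply: finrankM | apply: finrankD | apply: finrankN
  | apply: finrank_prod => * ].

Lemma finrank_aomotoF p k : finrank (F p k).
Proof. by rewrite /F; fr. Qed.

(* Exchanging z_p and z_k and averaging turns the simple pole into the
   symmetric factor z_p + z_k. *)
Lemma pair_cancel p k t :
  (dysonf (p, k) t * dysonf (k, p) t) ^+ n.-1 *
    (crd k t / crd p t - crd p t / crd k t) * (crd k t - crd p t) =
  - ((dysonf (p, k) t * dysonf (k, p) t) ^+ n * (crd p t + crd k t)).
Proof.
have zp := crd_neq0 p t; have zk := crd_neq0 k t.
case: n n_gt0 => // m _; rewrite [in RHS]exprS /= /dysonf /=.
by field; rewrite zp zk.
Qed.

Lemma cubeC_aomoto_swap p k : (p < k)%N ->
  cubeC (fun t => crd k t * crdprod p t * jacobi c b t * dyson n t) = @aomoto R N c b n p.+1.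
Proof.
move=> pk; rewrite -(cubeC_perm (tperm p k)); last by fr.
apply: eq_cubeC => t; rewrite crdprodS crd_permt tpermR jacobi_permt dyson_permt.
congr (_ * _ * _ * _); apply: eq_bigr => j jp; rewrite crd_permt tpermD //.
  by apply: contraTneq jp => <-; rewrite ltnn.
by apply: contraTneq jp => <-; rewrite -leqNgt ltnW.
Qed.

(** For [k] above [p] the monomial contains neither variable. The exchange reverses the
    antisymmetric factor, so symmetrizing [1 - z_p] leaves [z_k - z_p], which cancels the pole; the
    monomial times [z_p] or [z_k] then has the same average. *)
Lemma cubeC_aomotoF_gt p k : (p < k)%N ->
  cubeC (F p k) = - (n%:R * (@aomoto R N c b n p.+1)).
Proof.
move=> pk; have npk : p != k by apply: contraTneq pk => ->; rewrite ltnn.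
apply: (@mulfI _ 2); first by rewrite pnatr_eq0.
rewrite (cubeC_symm (s := tperm p k)
  (g := fun t => (- n%:R) * (crd p t * crdprod p t * jacobi c b t * dyson n t
    + crd k t * crdprod p t * jacobi c b t * dyson n t))); last 3 first.
- exact: finrank_aomotoF.
- by fr.
- move=> t; rewrite /F dyson_rest_tperm !dysonf_permt !crd_permt jacobi_permt /=.
  rewrite tpermL tpermR (dyson_split n t npk).
  have -> : crdprod p (permt (tperm p k) t) = crdprod p t.
    apply: eq_bigr => j jp; rewrite crd_permt tpermD //.
      by apply: contraTneq jp => <-; rewrite ltnn.
    by apply: contraTneq jp => <-; rewrite -leqNgt ltnW.
  have E := pair_cancel p k t.
  set u := dysonf (p, k) t in E *; set v := dysonf (k, p) t in E *.
  rewrite (mulrC v u); set w := (u * v) ^+ n.-1 in E *; set y := (u * v) ^+ n in E *.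
  set x := crd k t / crd p t in E *; set x' := crd p t / crd k t in E *.
  transitivity (n%:R * crdprod p t * jacobi c b t * dyson_rest n p k t *
     (w * (x - x') * (crd k t - crd p t))); first by ring.
  by rewrite E; ring.
rewrite cubeCZ; last by fr.
rewrite cubeCD; [|by fr..].
rewrite (cubeC_aomoto_swap pk).
have -> : cubeC (fun t => crd p t * crdprod p t * jacobi c b t * dyson n t) = @aomoto R N c b n p.+1.
  by apply: eq_cubeC => t; rewrite crdprodS.
by ring.
Qed.

(** For [k] below [p] the monomial is [z_k Q], and symmetrizing gives [z_k (1 - z_p) - z_p (1 - z_k)
    = z_k - z_p]: the same cancellation, but the monomials that remain, [z_p Q] and [z_k Q], still
    have degree [p]. *)
Lemma cubeC_aomotoF_lt p k : (k < p)%N ->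
  cubeC (F p k) = - (n%:R * (@aomoto R N c b n p)).
Proof.
move=> kp; have npk : p != k by apply: contraTneq kp => ->; rewrite ltnn.
pose Q t := \prod_(j < N | (j < p)%N && (j != k)) crd j t.
have QE t : crdprod p t = crd k t * Q t by rewrite /crdprod (bigD1 k).
have Qs t : Q (permt (tperm p k) t) = Q t.
  apply: eq_bigr => j /andP[jp jk]; rewrite crd_permt tpermD //.
    by apply: contraTneq jp => <-; rewrite ltnn.
  by rewrite eq_sym.
have fQ : finrank Q by rewrite /Q; fr.
apply: (@mulfI _ 2); first by rewrite pnatr_eq0.
rewrite (cubeC_symm (s := tperm p k)
  (g := fun t => (- n%:R) * (crd p t * Q t * jacobi c b t * dyson n t
    + crdprod p t * jacobi c b t * dyson n t))); last 3 first.
- exact: finrank_aomotoF.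
- by fr.
- move=> t; rewrite /F dyson_rest_tperm !dysonf_permt !crd_permt jacobi_permt /=.
  rewrite !QE Qs crd_permt tpermL tpermR (dyson_split n t npk).
  have E := pair_cancel p k t.
  set u := dysonf (p, k) t in E *; set v := dysonf (k, p) t in E *.
  rewrite (mulrC v u); set w := (u * v) ^+ n.-1 in E *; set y := (u * v) ^+ n in E *.
  set x := crd k t / crd p t in E *; set x' := crd p t / crd k t in E *.
  transitivity (n%:R * Q t * jacobi c b t * dyson_rest n p k t *
     (w * (x - x') * (crd k t - crd p t))); first by ring.
  by rewrite E; ring.
rewrite cubeCZ; last by fr.
rewrite cubeCD; [|by fr..].
have -> : cubeC (fun t => crd p t * Q t * jacobi c b t * dyson n t) = @aomoto R N c b n p.
  rewrite -(cubeC_perm (tperm p k)); last by fr.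
  apply: eq_cubeC => t.
  by rewrite crd_permt tpermL jacobi_permt dyson_permt Qs QE.
by rewrite /aomoto; ring.
Qed.

(** The Euler derivative in [z_p] has integral zero. Indices start at 0: the [N - p.+1] above [p]
    contribute in degree [p.+1], the [p] below in degree [p]. *)
Lemma aomoto_step p :
  (c.+1%:R - b%:R + (n * (N - p.+1))%:R) * (@aomoto R N c b n p.+1) +
  (b + n * p)%:R * (@aomoto R N c b n p) = 0.
Proof.
have := eulerd_cubeC (eulerdM (eulerdM (eulerd_crdprod p) (eulerd_jacobi p)) (eulerd_dyson n p)).
rewrite (eq_cubeC (g := fun t => ((b%:R - c.+1%:R) * (crdprod p.+1 t * jacobi c b t * dyson n t)
  + (- b%:R) * (crdprod p t * jacobi c b t * dyson n t)) + \sum_(k | k != p) F p k t)); last first.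
  by move=> t; rewrite crdprodS /F -mulr_sumr; ring.
rewrite cubeCD; last 2 first.
- by fr.
- by apply: finrank_sum => k _; exact: finrank_aomotoF.
rewrite cubeCD; [|by fr..].
rewrite !cubeCZ; [|by fr..].
rewrite cubeC_sum; last by move=> k _; exact: finrank_aomotoF.
rewrite (bigID (fun k => (p < k)%N)) /=.
rewrite (eq_bigr (fun=> - (n%:R * (@aomoto R N c b n p.+1)))); last first.
  by move=> k /andP[_ pk]; exact: cubeC_aomotoF_gt.
rewrite [X in _ + (_ + X)](eq_bigr (fun=> - (n%:R * (@aomoto R N c b n p)))); last first.
  by move=> k /andP[kp pk]; apply: cubeC_aomotoF_lt; rewrite ltn_neqAle kp leqNgt.
rewrite !sumr_const.
have -> : #|[pred k | k != p & (p < k)%N]| = (N - p.+1)%N.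
  rewrite (eq_card (B := [pred k : 'I_N | p.+1 <= k]%N)); last first.
    move=> k; rewrite !inE /= andb_idl //.
    by apply: contraTneq => ->; rewrite ltnn.
  by rewrite -sum1_card -(big_geq_mkord p.+1 N xpredT (fun=> 1%N)) sum_nat_const_nat muln1.
have -> : #|[pred k | k != p & ~~ (p < k)%N]| = p.
  rewrite (eq_card (B := [pred k : 'I_N | k < p]%N)); last first.
    by move=> k; rewrite !inE /= -leqNgt [RHS]ltn_neqAle.
  by rewrite -sum1_card -(big_ord_widen N (fun=> 1%N) (ltnW (ltn_ord p))) sum1_card card_ord.
rewrite -/(@aomoto R N c b n p.+1) -/(@aomoto R N c b n p).
set x := (@aomoto R N c b n p.+1); set y := @aomoto R N c b n p.
move=> E; rewrite -[RHS]oppr0 -[in RHS]E natrD !natrM; ring.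
Qed.

End AomotoStep.

(** * Morris integrals *)

Section Morris.
Context {R : realType}.
Local Notation C := R[i]%C.
Variables (N n : nat).
Hypothesis n_gt0 : (0 < n)%N.
Implicit Types (t : N.-tuple R).

Definition morris (c b : nat) : C := cubeC (fun t : N.-tuple R => jacobi c b t * dyson n t).

Lemma aomoto0 c b : @aomoto R N c b n 0 = morris c b.
Proof.
by apply: eq_cubeC => t; rewrite /crdprod big_pred0 ?mul1r // => j; rewrite ltn0.
Qed.

(** The product of all coordinates lowers the exponent [b] by one, so the recursion from 0 to [N]
    links Morris integrals with consecutive [b]. *)
Lemma aomotoN c b : @aomoto R N c b.+1 n N = morris c b.
Proof.
apply: eq_cubeC => t; congr (_ * _); rewrite /crdprod /jacobi.
rewrite [X in X * _](eq_bigl xpredT); last by move=> j; exact: ltn_ord.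
rewrite -big_split /=; apply: eq_bigr => j _.
by rewrite mulrCA exprS mulVKf // crd_neq0.
Qed.

Lemma aomoto_prod c b p : (b < c)%N -> (p <= N)%N ->
  @aomoto R N c b.+1 n p * \prod_(i < p) (c - b + n * (N - i.+1))%:R =
  (-1) ^+ p * (\prod_(i < p) (b.+1 + n * i)%:R) * morris c b.+1.
Proof.
move=> bc; elim: p => [|p IH] pN; first by rewrite !big_ord0 aomoto0 !mul1r mulr1.
have := aomoto_step (R := R) c b.+1 n_gt0 (Ordinal pN); rewrite /=.
have -> : c.+1%:R - b.+1%:R + (n * (N - p.+1))%:R = (c - b + n * (N - p.+1))%:R :> C.
  by rewrite natrD natrB 1?ltnW // -!natr1; ring.
move=> E.
have {E} E : (c - b + n * (N - p.+1))%:R * @aomoto R N c b.+1 n p.+1 =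
    - ((b.+1 + n * p)%:R * @aomoto R N c b.+1 n p).
  by apply/eqP; rewrite -addr_eq0 E.
rewrite !big_ord_recr /= mulrCA [X in _ * X]mulrC E.
rewrite mulrN mulrCA mulrC [_ * aomoto _ _ _ _ _]mulrC -[in LHS]mulrA.
rewrite (mulrC (\prod_(i < p) _)).
by move: (IH (ltnW pN)); rewrite exprS => E'; ring: E'.
Qed.

Lemma morrisS c b : (b < c)%N ->
  morris c b.+1 * \prod_(p < N) (b.+1 + n * p)%:R =
  (-1) ^+ N * \prod_(p < N) (c - b + n * p)%:R * morris c b.
Proof.
move=> bc; have := aomoto_prod bc (leqnn N); rewrite aomotoN => E.
rewrite [X in _ = _ * X * _](reindex_inj rev_ord_inj) /=.
rewrite -mulrA [X in _ = _ * X]mulrC E !mulrA -exprD addnn.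
by rewrite -signr_odd odd_double expr0 mul1r mulrC.
Qed.

(** [morrisS] iterated down to [b = 0], denominators cleared. The base [morris c 0] stays
    unevaluated: by [morris0] it is the integral of [dyson n] whatever [c], and only ratios to it
    matter. *)
Lemma morrisE c b : (b <= c)%N ->
  morris c b * \prod_(p < N) ((b + n * p)`! * (c - b + n * p)`!)%:R =
  (-1) ^+ (b * N) * \prod_(p < N) ((c + n * p)`! * (n * p)`!)%:R * morris c 0.
Proof.
elim: b => [|b IH] bc.
  rewrite mul0n mul1r mulrC; congr (_ * _); apply: eq_bigr => p _.
  by rewrite subn0 add0n mulnC.
transitivity ((-1) ^+ N * (morris c b * \prod_(p < N) ((b + n * p)`! * (c - b + n * p)`!)%:R)).
  have -> : \prod_(p < N) ((b.+1 + n * p)`! * (c - b.+1 + n * p)`!)%:R =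
     \prod_(p < N) (b.+1 + n * p)%:R *
     \prod_(p < N) ((b + n * p)`! * (c - b.+1 + n * p)`!)%:R :> C.
    rewrite -big_split /=; apply: eq_bigr => p _.
    by rewrite addSn factS -mulnA natrM.
  have -> : \prod_(p < N) ((b + n * p)`! * (c - b + n * p)`!)%:R =
     \prod_(p < N) (c - b + n * p)%:R *
     \prod_(p < N) ((b + n * p)`! * (c - b.+1 + n * p)`!)%:R :> C.
    rewrite -big_split /=; apply: eq_bigr => p _.
    have -> : (c - b = (c - b.+1).+1)%N by lia.
    by rewrite addSn factS mulnCA natrM.
  by rewrite mulrA morrisS //; ring.
by rewrite IH 1?ltnW // mulSn exprD; ring.
Qed.

Definition charpol (c : nat) t : {poly C} := \prod_j (1 - (crd j t) *: 'X) ^+ c.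

Lemma horner_charpol c t s : (charpol c t).[s] = \prod_j (1 - crd j t * s) ^+ c.
Proof.
rewrite /charpol horner_prod; apply: eq_bigr => j _.
by rewrite horner_exp !hornerE.
Qed.

(** Holds for [charpol] because each [z_j] enters only through its product with the polynomial
    variable. *)
Definition homog_coefs (F : N.-tuple R -> {poly C}) :=
  forall k : nat, homog (fun t => (F t)`_k) k%:Z.

Lemma homog_coefs1 : homog_coefs (fun=> 1).
Proof.
move=> k; apply: (eq_eulerd _ _ (eulerd_cst _ (1%:P : {poly C})`_k)) => t //.
by rewrite coefC; case: k => [|k] /=; rewrite ?mul0r ?mulr0.
Qed.

Lemma homog_coefsM F G : homog_coefs F -> homog_coefs G ->
  homog_coefs (fun t => F t * G t).
Proof.
move=> hF hG k; have : homog (fun t => \sum_(i < k.+1) (F t)`_i * (G t)`_(k - i)) k.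
  apply: homog_sum => i _; have := homogM (hF i) (hG (k - i)%N).
  by rewrite -PoszD subnKC // -ltnS.
by move=> h; apply: eq_homog h => t; rewrite coefM.
Qed.

Lemma homog_coefs_charpol c : homog_coefs (charpol c).
Proof.
rewrite /homog_coefs /charpol; elim: (index_enum _) => [|j s IH] k.
  by apply: eq_homog (homog_coefs1 k) => t; rewrite big_nil.
have hj : homog_coefs (fun t => (1 - crd j t *: 'X) ^+ c).
  elim: c {IH} => [|c IH]; first exact: homog_coefs1.
  have h1 : homog_coefs (fun t => 1 - crd j t *: 'X).
    move=> [|[|l]].
    - by apply: eq_homog (homog_cst N 1) => t; rewrite coefB coef1 coefZ coefX /= ?mulr0 ?subr0.
    - have := homogM (homog_cst N (-1 : C)) (homog_coord j 1); rewrite add0r.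
      by apply: eq_homog => t; rewrite coefB coef1 coefZ coefX /= expr1z mulr1 sub0r mulN1r.
    - have : homog (fun _ : N.-tuple R => 0 : C) l.+2%:Z.
        by apply: (eq_eulerd _ _ (eulerd_cst _ 0)) => t //; rewrite mulr0.
      by apply: eq_homog => t; rewrite coefB coef1 coefZ coefX /= mulr0 subr0.
  by move=> l; apply: eq_homog (homog_coefsM h1 IH l) => t; rewrite exprS.
by apply: eq_homog (homog_coefsM hj IH k) => t; rewrite big_cons.
Qed.

Lemma size_charpol c t : (size (charpol c t) <= (c * N).+1)%N.
Proof.
rewrite /charpol; apply: leq_trans (size_prod_leq _ _) _.
rewrite card_ord; set S := (\sum_(j < N) _)%N.
suff : (S <= N * c.+1)%N by rewrite mulnS mulnC; lia.
rewrite /S -[X in (_ <= X * _)%N]card_ord -sum_nat_const; apply: leq_sum => j _.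
apply: leq_trans (size_exp_leq _ _) _; rewrite ltnS.
have : (size (1 - crd j t *: 'X : {poly C})%R <= 2)%N.
  apply: leq_trans (size_polyD _ _) _; rewrite geq_max size_poly1 /= size_polyN.
  by apply: leq_trans (size_scale_leq _ _) _; rewrite size_polyX.
by case: (size _) => [|[|[|]]] //=; rewrite ?mul0n ?mul1n.
Qed.

Lemma homog_dyson : homog (@dyson R N n) 0.
Proof.
apply: homog_prod0 => i _; elim: n => [|m IH]; first exact: homog_cst.
have hf : homog (@dysonf R N i) 0.
  have h := homogM (homog_cst N (-1 : C)) (homogM (homog_coord i.1 1) (homog_coord i.2 (-1))).
  rewrite add0r subrr in h.
  have h2 := homogD (homog_cst N 1) h.
  apply: (eq_homog _ h2) => t;
    by rewrite /dysonf expr1z exprN1 mulN1r.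
by apply: eq_homog (homogM hf IH) => t; rewrite exprS.
Qed.

Definition crdVprod (b : nat) t : C := \prod_j (crd j t)^-1 ^+ b.

Lemma homog_crdVprod b : homog (crdVprod b) (- (b * N)%:Z).
Proof.
have -> : - (b * N)%:Z = \sum_(j < N) (- b%:Z).
  by rewrite sumr_const card_ord mulNrn -mulr_natr natz PoszM.
rewrite /crdVprod.
elim: (index_enum _) => [|j s IH].
  rewrite [X in homog _ X]big_nil.
  by apply: (eq_homog _ (homog_cst N 1)) => t; rewrite big_nil.
rewrite [X in homog _ X]big_cons; apply: (eq_homog _ (homogM (homog_coord j (- b%:Z)) IH)) => t;
  by rewrite big_cons exprVn exprnN.
Qed.

(* Only the coefficient of degree b N contributes: the others are homogeneous
   of nonzero degree. *)
Lemma charpol_rotation c b (s : C) :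
  cubeC (fun t : N.-tuple R => (charpol c t).[s] * crdVprod b t * dyson n t) =
  s ^+ (b * N) * morris c b.
Proof.
have H (s' : C) : cubeC (fun t : N.-tuple R => (charpol c t).[s'] * crdVprod b t * dyson n t) =
    \sum_(k < (c * N).+1) s' ^+ k *
      cubeC (fun t : N.-tuple R => (charpol c t)`_k * crdVprod b t * dyson n t).
  have fk k : finrank (fun t : N.-tuple R => (charpol c t)`_k * crdVprod b t * dyson n t).
    exact: eulerd_finrankl (homogM (homogM (homog_coefs_charpol c k) (homog_crdVprod b)) homog_dyson).
  transitivity (\sum_(k < (c * N).+1) cubeC (fun t : N.-tuple R => s' ^+ k *
      ((charpol c t)`_k * crdVprod b t * dyson n t))); last first.
    by apply: eq_bigr => k _; rewrite cubeCZ //; exact: fk.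
  rewrite -cubeC_sum; last first.
    by move=> k _; apply: finrankZ; exact: fk.
  apply: eq_cubeC => t; rewrite (horner_coef_wide _ (size_charpol c t)) !mulr_suml.
  by apply: eq_bigr => k _; ring.
rewrite H.
(* The Morris integral is the value at [s = 1], so both sides expand in the same way and are
   compared term by term. *)
have -> : morris c b = cubeC (fun t : N.-tuple R => (charpol c t).[1] * crdVprod b t * dyson n t).
  apply: eq_cubeC => t; rewrite (_ : jacobi c b t = (charpol c t).[1] * crdVprod b t) //.
  rewrite horner_charpol /jacobi /crdVprod -big_split.
  by apply: eq_bigr => j _ /=; rewrite mulr1.
rewrite H mulr_sumr; apply: eq_bigr => k _; rewrite expr1n mul1r.
have [->//|kb] := eqVneq (k : nat) (b * N)%N.
rewrite (homog_cubeC (homogM (homogM (homog_coefs_charpol c k) (homog_crdVprod b))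
  homog_dyson)) ?mulr0 //.
by rewrite addr0 subr_eq0 eqz_nat.
Qed.

(** The rotation formula at [s = 0]: since [b = 0] the power of [s] is [0 ^+ 0 = 1], while [charpol]
    evaluates to 1. *)
Lemma morris0 c : morris c 0 = cubeC (@dyson R N n).
Proof.
have := charpol_rotation c 0 0; rewrite mul0n expr0 mul1r => <-.
apply: eq_cubeC => t; rewrite horner_charpol /crdVprod !big1 ?mul1r // => j _.
by rewrite mulr0 subr0 expr1n.
Qed.

End Morris.

(** * The circular weight *)

Section Trigonometry.
Context {R : realType}.
Implicit Types x y u : R.

Lemma nondecreasing_from0 (f f' : R -> R) : (forall x : R, is_derive x 1 f (f' x)) ->
  (forall x, 0 <= x -> 0 <= f' x) -> forall x, 0 <= x -> f 0 <= f x.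
Proof.
move=> df f'0 x; rewrite le_eqVlt => /orP[/eqP <- //|x0].
have [|c cx E] := MVT x0 (fun y _ => df y).
  apply: continuous_subspaceT => y; apply: differentiable_continuous.
  by apply/derivable1_diffP; have [] := df y.
rewrite -subr_ge0 E mulr_ge0 ?subr0 ?(ltW x0) //; apply: f'0.
by move: cx; rewrite in_itv /= => /andP[/ltW].
Qed.

Lemma sin_le_id u : 0 <= u -> sin u <= u.
Proof.
move=> u0.
have df : forall x : R, is_derive x 1 (fun y => y - sin y) (1 - cos x).
  by move=> x; apply: is_derive_eq.
have := nondecreasing_from0 df _ u0.
rewrite sin0 subr0 => h; rewrite -subr_ge0; apply: h => x _.
by rewrite subr_ge0 cos_le1.
Qed.

Lemma cos_ge_parabola_pos u : 0 <= u -> 1 - u ^+ 2 / 2 <= cos u.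
Proof.
move=> u0.
have df : forall x : R, is_derive x 1 (fun y => cos y + y ^+ 2 / 2) (x - sin x).
  by move=> x; apply: is_derive_eq; rewrite /GRing.scale /=; field.
have h := nondecreasing_from0 df _ u0.
rewrite lerBlDr; move: h; rewrite cos0 expr0n mul0r addr0; apply => x x0.
by rewrite subr_ge0 sin_le_id.
Qed.

Lemma cos_ge_parabola u : 1 - u ^+ 2 / 2 <= cos u.
Proof.
have [u0|/ltW u0] := leP 0 u; first exact: cos_ge_parabola_pos.
by rewrite -cosN -sqrrN; apply: cos_ge_parabola_pos; rewrite oppr_ge0.
Qed.

Lemma sin_ge_cubic u : 0 <= u -> u - u ^+ 3 / 6 <= sin u.
Proof.
move=> u0.
have df : forall x : R, is_derive x 1 (fun y => sin y - y + y ^+ 3 / 6) (cos x - (1 - x ^+ 2 / 2)).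
  by move=> x; apply: is_derive_eq; rewrite /GRing.scale /=; field.
have := nondecreasing_from0 df _ u0.
rewrite sin0 expr0n mul0r addr0 subr0 => h; have {}h : 0 <= sin u - u + u ^+ 3 / 6.
  by apply: h => x _; rewrite subr_ge0 cos_ge_parabola.
lra.
Qed.

Lemma cos_le_quartic_pos u : 0 <= u -> cos u <= 1 - u ^+ 2 / 2 + u ^+ 4 / 24.
Proof.
move=> u0.
have df : forall x : R, is_derive x 1 (fun y => y ^+ 4 / 24 - y ^+ 2 / 2 - cos y) (sin x - (x - x ^+ 3 / 6)).
  by move=> x; apply: is_derive_eq; rewrite /GRing.scale /=; field.
have := nondecreasing_from0 df _ u0.
rewrite cos0 !expr0n !mul0r subr0 sub0r => h.
have {}h : - 1 <= u ^+ 4 / 24 - u ^+ 2 / 2 - cos u.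
  by apply: h => x x0; rewrite subr_ge0 sin_ge_cubic.
lra.
Qed.

Lemma cos_le_quartic u : cos u <= 1 - u ^+ 2 / 2 + u ^+ 4 / 24.
Proof.
have [u0|/ltW u0] := leP 0 u; first exact: cos_le_quartic_pos.
have := @cos_le_quartic_pos (- u); rewrite oppr_ge0 cosN => /(_ u0).
have -> : (- u) ^+ 2 = u ^+ 2 by ring.
by have -> : (- u) ^+ 4 = u ^+ 4 by ring.
Qed.

(* [|e^{ix} - e^{iy}|^2]. *)
Definition chord2 x y : R := ComplexField.Normc.normc (cis x - cis y) ^+ 2.

Lemma chord2E x y : chord2 x y = 2 - 2 * cos (x - y).
Proof.
rewrite /chord2 /cis /= sqr_sqrtr ?addr_ge0 ?sqr_ge0 // cosB.
have := cos2Dsin2 x; have := cos2Dsin2 y; nra.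
Qed.

Lemma chord2_ge0 x y : 0 <= chord2 x y. Proof. exact: sqr_ge0. Qed.

Lemma chord2_le x y : chord2 x y <= (x - y) ^+ 2.
Proof. by rewrite chord2E; have := cos_ge_parabola (x - y); lra. Qed.

Lemma chord2_ge x y : (x - y) ^+ 2 - (x - y) ^+ 4 / 12 <= chord2 x y.
Proof. by rewrite chord2E; have := cos_le_quartic (x - y); lra. Qed.

Lemma chord2_eq0 x y : x = y -> chord2 x y = 0.
Proof. by move=> ->; rewrite chord2E subrr cos0; lra. Qed.

Lemma chord2_cis x y :
  ((chord2 x y)%:C)%C = (1 - cis x / cis y) * (1 - cis y / cis x).
Proof.
rewrite -!cisN -!cisD -[y - x]opprB chord2E /cis cosN sinN.
set c := cos _; set s := sin _.
have : c ^+ 2 + s ^+ 2 = 1 by exact: cos2Dsin2.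
move=> E; apply/eqP; rewrite eq_complex /=; apply/andP; split; apply/eqP; last by ring.
have -> : (1 - c) * (1 - c) - (0 - s) * (0 - - s) = 1 - 2 * c + (c ^+ 2 + s ^+ 2) by ring.
by rewrite E; ring.
Qed.

End Trigonometry.

Section CircularWeight.
Context {R : realType}.
Local Notation mu := (@lebesgue_measure R).
Local Notation circ := [set` `[(- pi)%R, (pi : R)[].
Local Notation C := R[i]%C.
Variable n : nat.
Hypothesis n_gt0 : (0 < n)%N.

Definition cweight (N : nat) (t : N.-tuple R) : R :=
  \prod_(j < N) \prod_(k < N | (j < k)%N) chord2 (tnth t j) (tnth t k) ^+ n.

Lemma circular_weightE (N : nat) : @circular_weight R (2 * n)%:R N =1 @cweight N.
Proof.
move=> t; apply: eq_bigr => j _; apply: eq_bigr => k _.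
rewrite powR_mulrn; last first.
  by case: (_ - _) => a b; exact: sqrtr_ge0.
by rewrite exprM.
Qed.

(* [\prod_k |e^{ix} - z_k|^{2n}]. *)
Definition ker (N : nat) (x : R) (t : N.-tuple R) : R :=
  \prod_(k < N) chord2 x (tnth t k) ^+ n.

Lemma ker_ge0 N x (t : N.-tuple R) : 0 <= ker x t.
Proof. by apply: prodr_ge0 => k _; rewrite exprn_ge0 // chord2_ge0. Qed.

Lemma cweight_ge0 N (t : N.-tuple R) : 0 <= cweight t.
Proof.
by apply: prodr_ge0 => j _; apply: prodr_ge0 => k _; rewrite exprn_ge0 // chord2_ge0.
Qed.

Lemma cweight_cons N x (t : N.-tuple R) :
  cweight [tuple of x :: t] = ker x t * cweight t.
Proof.
rewrite /cweight big_ord_recl; congr (_ * _).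
  rewrite big_mkcond big_ord_recl /= mul1r; apply: eq_bigr => k _.
  by rewrite tnth0 tnthS.
apply: eq_bigr => j _; rewrite big_mkcond big_ord_recl /= mul1r [RHS]big_mkcond /=.
by apply: eq_bigr => k _; rewrite !tnthS.
Qed.

Lemma ker_cons N x y (t : N.-tuple R) :
  ker x [tuple of y :: t] = chord2 x y ^+ n * ker x t.
Proof.
rewrite /ker big_ord_recl tnth0; congr (_ * _).
by apply: eq_bigr => k _; rewrite tnthS.
Qed.

Lemma cweight_eq0 N (t : N.-tuple R) (j k : 'I_N) :
  j != k -> tnth t j = tnth t k -> cweight t = 0.
Proof.
wlog jk : j k / (j < k)%N.
  move=> H jk E; have [lt|lt|eq] := ltngtP j k.
  - exact: H E.
  - by apply: H lt _ (esym E); rewrite eq_sym.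
  - by move: jk; rewrite (val_inj eq) eqxx.
move=> _ E; rewrite /cweight (bigD1 j) //= (bigD1 k) //= chord2_eq0 //.
by rewrite expr0n eqn0Ngt n_gt0 !mul0r.
Qed.

Lemma cweightC N (t : N.-tuple R) : ((cweight t)%:C)%C = dyson n t.
Proof.
rewrite /dyson -(pair_big_dep xpredT (fun j k => j != k) (fun j k => dysonf (j, k) t ^+ n)) /=.
transitivity ((\prod_(j < N) \prod_(k < N | (j < k)%N) dysonf (j, k) t ^+ n) *
  (\prod_(j < N) \prod_(k < N | (k < j)%N) dysonf (j, k) t ^+ n)).
  rewrite [X in _ = _ * X](exchange_big_dep xpredT) //= -big_split rmorph_prod.
  apply: eq_bigr => j _; rewrite rmorph_prod -big_split; apply: eq_bigr => k _.
  by rewrite /= rmorphXn /= chord2_cis -exprMn.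
rewrite -big_split; apply: eq_bigr => j _ /=.
rewrite [RHS](bigID (fun k : 'I_N => (j < k)%N)) /=; congr (_ * _); apply: eq_bigl => k.
  by rewrite andb_idl //; apply: contraTneq => ->; rewrite ltnn.
by rewrite -leqNgt [LHS]ltn_neqAle eq_sym.
Qed.

Lemma rfinrank_cweight N : rfinrank (@cweight N).
Proof.
by apply: (eq_finrank _ (finrank_dyson N n)) => t; rewrite cweightC.
Qed.

Definition partition_fun (N : nat) : R := cube_integral (@cweight N).
Local Notation D := partition_fun.

Lemma partition_funC N : (((D N)%:C)%C : C) = cubeC (@dyson R N n).
Proof. by rewrite -cubeC_real; apply: eq_cubeC => t; rewrite cweightC. Qed.

(** With [w = cis x], each factor is [(1 - w / z) (1 - z / w) = - (w / z) (1 - z / w)^2], which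
    turns the modulus into the value of [charpol] at [1 / w]. *)
Lemma kerC N x (t : N.-tuple R) :
  ((ker x t)%:C)%C = (-1) ^+ (n * N) * (cis x) ^+ (n * N) *
    ((charpol (2 * n) t).[(cis x)^-1] * crdVprod n t) :> C.
Proof.
rewrite horner_charpol /crdVprod -big_split /= -exprMn exprM.
rewrite -[N in _ ^+ N]card_ord -prodr_const -big_split.
rewrite rmorph_prod; apply: eq_bigr => k _ /=.
rewrite rmorphXn /= chord2_cis [in RHS]exprM -!exprMn; congr (_ ^+ n).
rewrite /crd; have zx := cis_neq0 x; have zk := cis_neq0 (tnth t k).
by field; rewrite zx zk.
Qed.

Lemma rfinrank_ker N x : rfinrank (@ker N x).
Proof.
have h (t : N.-tuple R) : ((ker x t)%:C)%C =
    \prod_k ((1 - cis x * (crd k t)^-1) * (1 - crd k t * (cis x)^-1)) ^+ n.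
  by rewrite rmorph_prod; apply: eq_bigr => k _; rewrite rmorphXn /= chord2_cis.
apply: (eq_finrank (fun t => esym (h t))).
apply: finrank_prod => k _; apply: finrankX; apply: finrankM;
  apply: finrankD; try exact: finrank_cst; apply: finrankN; apply: finrankM;
  try exact: finrank_cst.
  exact: finrank_crdV.
exact: finrank_crd.
Qed.

(** The power of [cis x] produced by [charpol_rotation] cancels the prefactor in [kerC], so the
    angle disappears. *)
Lemma cube_ker N x : (((cube_integral (fun t : N.-tuple R => ker x t * cweight t))%:C)%C : C) =
  (-1) ^+ (n * N) * @morris R N n (2 * n) n.
Proof.
rewrite -cubeC_real.
have fP s : finrank (fun t : N.-tuple R => (charpol (2 * n) t).[s] * crdVprod n t * dyson n t).
  have h (t : N.-tuple R) : (charpol (2 * n) t).[s] * crdVprod n t * dyson n t =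
      (\prod_j ((1 - crd j t * s) ^+ (2 * n) * (crd j t)^-1 ^+ n)) * dyson n t.
    by rewrite horner_charpol /crdVprod -big_split.
  apply: (eq_finrank (fun t => esym (h t))); apply: finrankM; last exact: finrank_dyson.
  apply: finrank_prod => k _; apply: finrankM; apply: finrankX; last exact: finrank_crdV.
  apply: finrankD; first exact: finrank_cst.
  by apply: finrankN; apply: finrankM; [exact: finrank_crd | exact: finrank_cst].
rewrite (eq_cubeC (g := fun t => ((-1) ^+ (n * N) * (cis x) ^+ (n * N)) *
   ((charpol (2 * n) t).[(cis x)^-1] * crdVprod n t * dyson n t))); last first.
  by move=> t; rewrite rmorphM /= kerC cweightC -!mulrA.
rewrite cubeCZ; last exact: fP.
rewrite charpol_rotation // mulrA -(mulrA (_ ^+ _)) -exprMn mulfV ?cis_neq0 //.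
by rewrite expr1n mulr1.
Qed.

(** With [a_p = (n p)!] the quotient at index [p] is [(a_(p+2) / a_(p+1)) / (a_(p+1) / a_p)], which
    telescopes. *)
Lemma telescope2 N :
  (\prod_(p < N) ((2 * n + n * p)`! * (n * p)`!) * ((n * N)`! * n`!) =
   \prod_(p < N) ((n + n * p)`! * (n + n * p)`!) * (n * N.+1)`!)%N.
Proof.
elim: N => [|N IH]; first by rewrite !big_ord0 muln0 muln1 fact0 mul1n.
rewrite !big_ord_recr /=.
have -> : (n + n * N = n * N.+1)%N by rewrite mulnS.
have -> : (2 * n + n * N = n * N.+2)%N by rewrite !mulnS; lia.
set A := (\prod_(i < N) _)%N in IH *; set B := (\prod_(i < N) _)%N in IH *.
transitivity (A * ((n * N)`! * n`!) * ((n * N.+2)`! * (n * N.+1)`!))%N; first by ring.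
by rewrite IH; ring.
Qed.

(** The quotient is now [(a_(p+4) / a_(p+2)) / (a_(p+2) / a_p)], with [a_p = (n p)!], and telescopes
    in steps of two. Its lower boundary terms are the source of [(2n)!], [(3n)!] and one [n!] in the
    final constant. *)
Lemma telescope4 N :
  (\prod_(p < N) ((4 * n + n * p)`! * (n * p)`!) *
     ((n * N)`! * (n * N.+1)`! * ((2 * n)`! * (3 * n)`!)) =
   \prod_(p < N) ((2 * n + n * p)`! * (2 * n + n * p)`!) *
     ((n * N.+2)`! * (n * N.+3)`! * n`!))%N.
Proof.
elim: N => [|N IH].
  rewrite !big_ord0 muln0 muln1 fact0 !mul1n (mulnC 2) (mulnC 3); ring.
rewrite !big_ord_recr /=.
have -> : (4 * n + n * N = n * N.+4)%N by rewrite !mulnS; lia.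
have -> : (2 * n + n * N = n * N.+2)%N by rewrite !mulnS; lia.
set A := (\prod_(i < N) _)%N in IH *; set B := (\prod_(i < N) _)%N in IH *.
set K := ((2 * n)`! * _)%N in IH *.
transitivity (A * ((n * N)`! * (n * N.+1)`! * K) * ((n * N.+4)`! * (n * N.+2)`!))%N; first by ring.
by rewrite IH; ring.
Qed.

Lemma natr_prod_fact_neq0 (I : finType) (F G : I -> nat) :
  (\prod_(i : I) ((F i)`! * (G i)`!)%N)%:R != 0 :> C.
Proof.
rewrite pnatr_eq0 -lt0n; apply: prodn_gt0 => i.
by rewrite muln_gt0 !fact_gt0.
Qed.

Lemma signC_sq (k : nat) : (-1) ^+ k * (-1) ^+ k = 1 :> C.
Proof. by rewrite -exprMn mulrNN mulr1 expr1n. Qed.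

Lemma cube_ker_partition N x :
  cube_integral (fun t : N.-tuple R => ker x t * cweight t) * ((n * N)`! * n`!)%:R =
  (n * N.+1)`!%:R * D N.
Proof.
have := @morrisE R N n n_gt0 (2 * n) n; rewrite leq_pmull // => /(_ isT).
rewrite morris0 // -partition_funC -!natr_prod.
have -> : (2 * n - n = n)%N by lia.
move=> E; apply/(@complexI R).
rewrite !rmorphM /= !rmorph_nat cube_ker.
apply: (mulfI (natr_prod_fact_neq0 (fun p : 'I_N => n + n * p)%N (fun p : 'I_N => n + n * p)%N)).
set A := (\prod_i _)%N; set M := morris _ _ _ _.
rewrite [LHS](_ : _ = (-1) ^+ (n * N) * (M * A%:R) * ((n * N)`!%:R * n`!%:R)); last by ring.
rewrite E; set B := (\prod_i _)%N.
rewrite [LHS](_ : _ = (-1) ^+ (n * N) * (-1) ^+ (n * N) * (B%:R * ((n * N)`!%:R * n`!%:R)) * ((D N)%:C)%C); last by ring.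
by rewrite signC_sq mul1r -!natrM telescope2 natrM mulrA.
Qed.

Lemma circ_length : fine (mu circ) = 2 * pi :> R.
Proof.
rewrite [mu _]lebesgue_measure_itv /= lte_fin.
have -> : (- pi < pi :> R) by have := pi_gt0 R; lra.
by rewrite /= opprK mulr_natl mulr2n.
Qed.

(** By [cube_ker_partition] the inner integral does not depend on the first angle, whence the factor
    [2 pi]. *)
Lemma partition_funS N :
  D N.+1 * ((n * N)`! * n`!)%:R = 2 * pi * (n * N.+1)`!%:R * D N.
Proof.
rewrite /partition_fun /=.
have H x : cube_integral (fun t : N.-tuple R => cweight [tuple of x :: t]) =
    (n * N.+1)`!%:R * D N / ((n * N)`! * n`!)%:R.
  rewrite -(cube_ker_partition N x) mulfK; last first.
    by rewrite pnatr_eq0 -lt0n muln_gt0 !fact_gt0.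
  by apply: eq_cube_integral => t; rewrite cweight_cons.
under eq_Rintegral do rewrite H.
rewrite Rintegral_cst //= circ_length.
have f0 : (((n * N)`! * n`!)%:R : R) != 0 by rewrite pnatr_eq0 -lt0n muln_gt0 !fact_gt0.
by rewrite [LHS]mulrAC mulfVK // -/(D N); ring.
Qed.

Lemma partition_fun_gt0 N : 0 < D N.
Proof.
elim: N => [|N IH].
  by rewrite /partition_fun /= /cweight big_ord0.
have f0 k : 0 < k`!%:R :> R by rewrite ltr0n fact_gt0.
rewrite -(pmulr_lgt0 (x := ((n * N)`! * n`!)%:R)); last by rewrite natrM mulr_gt0.
by rewrite partition_funS !mulr_gt0 // pi_gt0.
Qed.

End CircularWeight.

(** * The kernel of a pair of points *)

Section PairKernel.
Context {R : realType}.
Local Notation re := complex.Re.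
Local Notation im := complex.Im.
Local Notation C := R[i]%C.
Variable n : nat.
Hypothesis n_gt0 : (0 < n)%N.
Variable N : nat.
Implicit Types (t : N.-tuple R).

Definition pairker (x y : R) : R :=
  cube_integral (fun t : N.-tuple R => ker n x t * ker n y t * cweight n t).

Definition charpol_coef_norm (k : nat) t : R :=
  re (charpol (2 * n) t)`_k ^+ 2 + im (charpol (2 * n) t)`_k ^+ 2.

(** The integral of the squared modulus of a coefficient of [charpol], hence nonnegative; it becomes
    the weight of the frequency [n N - k] in J. *)
Definition pairker_coef (k : nat) : R :=
  cube_integral (fun t : N.-tuple R => charpol_coef_norm k t * cweight n t).

Lemma pairker_coef_ge0 k : 0 <= pairker_coef k.
Proof.
apply: cube_integral_ge0 => t; apply: mulr_ge0; last exact: cweight_ge0.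
by rewrite addr_ge0 // sqr_ge0.
Qed.

Lemma homog_charpol_coefs k l :
  homog (fun t : N.-tuple R => (charpol (2 * n) t)`_k * (((charpol (2 * n) t)`_l)^*)%C * dyson n t)
    (k%:Z - l%:Z).
Proof.
have h := homogM (homogM (homog_coefs_charpol N (2 * n) k)
   (homog_conj (homog_coefs_charpol N (2 * n) l))) (homog_dyson N n).
by rewrite addr0 in h; exact: h.
Qed.

Lemma cubeC_charpol_coefs k l :
  cubeC (fun t : N.-tuple R => (charpol (2 * n) t)`_k * (((charpol (2 * n) t)`_l)^*)%C * dyson n t)
   = if k == l then ((pairker_coef k)%:C)%C else 0.
Proof.
have [<-|kl] := eqVneq k l.
  rewrite -cubeC_real; apply: eq_cubeC => t; rewrite rmorphM /= cweightC.
  congr (_ * dyson n t); rewrite /charpol_coef_norm; case: (_`_k) => a b.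
  by apply/eqP; rewrite eq_complex /=; apply/andP; split; apply/eqP; ring.
apply: (homog_cubeC (homog_charpol_coefs k l)).
by rewrite subr_eq0 eqz_nat.
Qed.

Lemma crdVprod_conj b t : crdVprod b t * ((crdVprod b t)^*)%C = 1.
Proof.
rewrite /crdVprod rmorph_prod -big_split big1 //= => j _.
have h : ((crd j t)^-1)^*%C = crd j t by rewrite /crd -cisN conj_cis -cisN opprK.
by rewrite rmorphXn -exprMn [X in _ * X]h mulVf ?crd_neq0 // expr1n.
Qed.

(* In [ker x * conj (ker y)] both factors are trigonometric polynomials in the
   z_k whose coefficients of different degrees are orthogonal. *)
Lemma pairkerE x y : pairker x y =
  \sum_(k < (2 * n * N).+1) pairker_coef k * cos (((n * N)%:R - k%:R) * (x - y)).
Proof.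
pose P (t : N.-tuple R) := charpol (2 * n) t.
pose A k l := fun t : N.-tuple R => (P t)`_k * (((P t)`_l)^*)%C * dyson n t.
have fA k l : finrank (A k l) by exact: eulerd_finrankl (homog_charpol_coefs k l).
pose q := (2 * n * N).+1.
pose u : C := (cis x / cis y) ^+ (n * N).
have E t : ((ker n x t * ker n y t * cweight n t)%:C)%C =
    \sum_(k < q) \sum_(l < q) (u * (cis x)^-1 ^+ k * (cis y) ^+ l) * A k l t.
  (* The kernel in [y] is real and equals its conjugate. The product of the kernels thus pairs the
     coefficient of degree [k] with the conjugate of that of degree [l], a term of degree
     [k - l]. *)
  have yE : ((ker n y t)%:C)%C = (((ker n y t)%:C)^*)%C :> C by rewrite /= oppr0.
  rewrite !rmorphM /= yE !kerC !rmorphM /= cweightC.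
  have conjX (z : C) m : ((z ^+ m)^*)%C = ((z^*)%C) ^+ m by rewrite rmorphXn.
  have conjM (z w : C) : ((z * w)^*)%C = (z^*)%C * (w^*)%C by rewrite rmorphM.
  have conjN1 : ((-1 : C)^*)%C = -1 by rewrite rmorphN1.
  rewrite !conjX conj_cis conjN1.
  have hP s : (charpol (2 * n) t).[s] = \sum_(k < q) (P t)`_k * s ^+ k.
    by rewrite (horner_coef_wide _ (size_charpol n_gt0 (2 * n) t)).
  rewrite !hP [X in _ * (_ * (X * _))]rmorph_sum.
  transitivity (((-1) ^+ (n * N) * (-1) ^+ (n * N)) * u *
     (crdVprod n t * ((crdVprod n t)^*)%C) *
     ((\sum_(k < q) (P t)`_k * (cis x)^-1 ^+ k) *
      (\sum_(k < q) (((P t)`_k * (cis y)^-1 ^+ k)^*)%C)) * dyson n t).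
    by rewrite /u exprMn; ring.
  rewrite signC_sq crdVprod_conj !mul1r mulr1 !mulr_suml mulr_sumr mulr_suml.
  apply: eq_bigr => k _; rewrite mulr_sumr mulr_sumr mulr_suml; apply: eq_bigr => l _.
  rewrite conjM conjX /A.
  have -> : (((cis y)^-1)^*)%C = cis y by rewrite -cisN conj_cis -cisN opprK.
  by ring.
have rC (v : R) : re ((v%:C)%C) = v by [].
rewrite -[LHS]rC -cubeC_real (eq_cubeC E) cubeC_sum; last first.
  by move=> k _; apply: finrank_sum => l _; apply: finrankZ; exact: fA.
rewrite raddf_sum; apply: eq_bigr => k _.
rewrite cubeC_sum; last by move=> l _; apply: finrankZ; exact: fA.
rewrite (bigD1 k) //= big1 ?addr0; last first.
  move=> l lk; rewrite cubeCZ; last exact: fA.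
  by rewrite /A cubeC_charpol_coefs eq_sym (negPf lk : (l == k :> nat) = false) mulr0.
rewrite cubeCZ; last exact: fA.
rewrite /A cubeC_charpol_coefs eqxx.
have -> : u * (cis x)^-1 ^+ k * cis y ^+ k = cis (((n * N)%:R - k%:R) * (x - y)).
  rewrite /u -!cisN -cisD !cis_expn -!cisD; congr cis; ring.
by rewrite /cis /= mulr0 subr0 mulrC.
Qed.

Lemma pairker00 : pairker 0 0 = \sum_(k < (2 * n * N).+1) pairker_coef k.
Proof. by rewrite pairkerE; apply: eq_bigr => k _; rewrite subrr mulr0 cos0 mulr1. Qed.

Lemma pairker00_ge0 : 0 <= pairker 0 0.
Proof. by rewrite pairker00 sumr_ge0 // => k _; exact: pairker_coef_ge0. Qed.

Lemma pairker_le x y : pairker x y <= pairker 0 0.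
Proof.
rewrite pairker00 pairkerE; apply: ler_sum => k _.
by rewrite ler_piMr ?cos_le1 ?pairker_coef_ge0.
Qed.

Lemma pairker_ge x y :
  (1 - (n * N)%:R ^+ 2 * (x - y) ^+ 2 / 2) * pairker 0 0 <= pairker x y.
Proof.
rewrite pairker00 pairkerE mulr_sumr; apply: ler_sum => k _.
rewrite mulrC ler_wpM2l ?pairker_coef_ge0 //.
apply: le_trans (cos_ge_parabola _).
rewrite lerB // ler_pM2r ?invr_gt0 // exprMn ler_wpM2r ?sqr_ge0 //.
(* With [0 <= k <= 2 n N] the frequency [n N - k] is at most [n N] in modulus. *)
have kN : (k <= 2 * n * N)%N by rewrite -ltnS.
have : (k%:R : R) <= 2 * (n * N)%:R by rewrite -natrM ler_nat mulnA.
have : 0 <= (k%:R : R) by rewrite ler0n.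
nra.
Qed.

(** At [x = y = 0] the two kernels merge: their exponents add up to [4n] and [2n], and their signs
    cancel. *)
Lemma pairker00_morris :
  (((pairker 0 0)%:C)%C : C) = @morris R N n (4 * n) (2 * n).
Proof.
rewrite -cubeC_real; apply: eq_cubeC => t.
rewrite !rmorphM /= !kerC cweightC cis0 invr1 expr1n mulr1.
rewrite horner_charpol /crdVprod /jacobi -!big_split /=.
set Q := \prod_i _; have -> : \prod_j ((1 - crd j t) ^+ (4 * n) * (crd j t)^-1 ^+ (2 * n)) = Q * Q.
  rewrite /Q -big_split; apply: eq_bigr => j _ /=; rewrite mulr1 mulrACA -!exprD.
  by congr (_ ^+ _ * _ ^+ _); lia.
by congr (_ * dyson n t); rewrite mulrACA signC_sq mul1r.
Qed.

(** [telescope4] expresses J(0) through the partition function of [N] points; two steps of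
    [partition_funS] lead to [N + 2] points and bring in [4 pi^2] and two more factors [n!]. *)
Lemma pairker00_partition :
  pairker 0 0 * ((n * N.+1)`!%:R * ((2 * n)`!%:R * (3 * n)`!%:R)) * (4 * pi ^+ 2) =
  (n * N.+3)`!%:R * n`!%:R ^+ 3 * @partition_fun R n N.+2.
Proof.
have f0 k : k`!%:R != 0 :> R by rewrite pnatr_eq0 -lt0n fact_gt0.
have E : pairker 0 0 * ((n * N)`!%:R * (n * N.+1)`!%:R * ((2 * n)`!%:R * (3 * n)`!%:R)) =
  (n * N.+2)`!%:R * (n * N.+3)`!%:R * n`!%:R * @partition_fun R n N.
  have := @morrisE R N n n_gt0 (4 * n) (2 * n); rewrite leq_pmul2r // => /(_ isT).
  rewrite morris0 // -partition_funC -!natr_prod -pairker00_morris.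
  have -> : (4 * n - 2 * n = 2 * n)%N by lia.
  have -> : (-1) ^+ (2 * n * N) = 1 :> C by rewrite -signr_odd !oddM /= expr0.
  move=> E; apply/(@complexI R).
  apply: (mulfI (natr_prod_fact_neq0 (fun p : 'I_N => 2 * n + n * p)%N
    (fun p : 'I_N => 2 * n + n * p)%N)).
  have T : (\prod_(p < N) ((4 * n + n * p)`! * (n * p)`!))%N%:R *
     ((n * N)`!%:R * (n * N.+1)`!%:R * ((2 * n)`!%:R * (3 * n)`!%:R)) =
   (\prod_(p < N) ((2 * n + n * p)`! * (2 * n + n * p)`!))%N%:R *
     ((n * N.+2)`!%:R * (n * N.+3)`!%:R * n`!%:R) :> C.
    by rewrite -!natrM telescope4.
  rewrite !rmorphM /= !rmorph_nat.
  set J := (((pairker 0 0)%:C)%C) in E *; set A := (\prod_i _)%N in E T *.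
  set B := (\prod_i _)%N in E T *.
  pose a : C := (n * N)`!%:R * (n * N.+1)`!%:R * ((2 * n)`!%:R * (3 * n)`!%:R).
  pose b : C := (n * N.+2)`!%:R * (n * N.+3)`!%:R * n`!%:R.
  rewrite -/a -/b; rewrite -/a -/b in T.
  rewrite mulrCA mulrA E.
  by rewrite mul1r mulrAC T -mulrA.
have E1 := partition_funS n_gt0 (R := R) N.+1; have E2 := partition_funS n_gt0 (R := R) N.
rewrite !natrM in E1 E2.
apply: (mulIf (f0 (n * N)%N)); apply: (mulIf (f0 (n * N.+1)%N)).
transitivity (pairker 0 0 * ((n * N)`!%:R * (n * N.+1)`!%:R * ((2 * n)`!%:R * (3 * n)`!%:R))
  * (n * N.+1)`!%:R * (4 * pi ^+ 2)); first by ring.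
rewrite E.
transitivity ((n * N.+3)`!%:R * n`!%:R ^+ 2 * (n * N)`!%:R *
   (@partition_fun R n N.+2 * ((n * N.+1)`!%:R * n`!%:R))); last by ring.
rewrite E1.
transitivity (2 * pi * (n * N.+3)`!%:R * n`!%:R * (n * N.+2)`!%:R *
   (@partition_fun R n N.+1 * ((n * N)`!%:R * n`!%:R))); last by ring.
rewrite E2; ring.
Qed.

End PairKernel.

(** * Pair statistics of the circular ensemble *)

Section PairSums.
Context {R : realType}.
Local Notation mu := (@lebesgue_measure R).
Local Notation circ := [set` `[(- pi)%R, (pi : R)[].
Variable n : nat.
Hypothesis n_gt0 : (0 < n)%N.
Implicit Types g : R -> R.

Definition pairsum (N : nat) g1 g2 (t : N.-tuple R) : R :=
  \sum_j \sum_(k | k != j) g1 (tnth t j) * g2 (tnth t k).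

Lemma rfinrank_coord N g (j : 'I_N) : continuous g ->
  rfinrank (fun t : N.-tuple R => g (tnth t j)).
Proof. by move=> cg; apply: (finrank_coord j (ccont_real cg)). Qed.

Lemma rfinrankM N (f g : N.-tuple R -> R) : rfinrank f -> rfinrank g ->
  rfinrank (fun t => f t * g t).
Proof.
move=> ff fg; apply: (eq_finrank _ (finrankM ff fg)) => t.
by rewrite rmorphM.
Qed.

Lemma rfinrankD N (f g : N.-tuple R -> R) : rfinrank f -> rfinrank g ->
  rfinrank (fun t => f t + g t).
Proof.
move=> ff fg; apply: (eq_finrank _ (finrankD ff fg)) => t.
by rewrite rmorphD.
Qed.

Lemma rfinrank_cst N (c : R) : rfinrank (fun _ : N.-tuple R => c).
Proof. exact: finrank_cst. Qed.

Lemma rfinrank_sum N (I : Type) (s : seq I) (P : pred I) (F : I -> N.-tuple R -> R) :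
  (forall i, P i -> rfinrank (F i)) -> rfinrank (fun t => \sum_(i <- s | P i) F i t).
Proof.
move=> fF; apply: (eq_finrank _ (finrank_sum s fF)) => t.
by rewrite rmorph_sum.
Qed.

Lemma cube_integralZ N (a : R) (f : N.-tuple R -> R) : rfinrank f ->
  cube_integral (fun t => a * f t) = a * cube_integral f.
Proof.
move=> ff; apply/(@complexI R); rewrite rmorphM /= -!cubeC_real -cubeCZ //.
by apply: eq_cubeC => t; rewrite rmorphM.
Qed.

Lemma cube_integralD N (f g : N.-tuple R -> R) : rfinrank f -> rfinrank g ->
  cube_integral (fun t => f t + g t) = cube_integral f + cube_integral g.
Proof.
move=> ff fg; apply/(@complexI R); rewrite rmorphD /= -!cubeC_real -cubeCD //.
by apply: eq_cubeC => t; rewrite rmorphD.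
Qed.

Lemma cube_integralB2 N (f g h : N.-tuple R -> R) : rfinrank f -> rfinrank g -> rfinrank h ->
  cube_integral f - cube_integral g - cube_integral h =
  cube_integral (fun t => (f t + -1 * g t) + -1 * h t).
Proof.
move=> ff fg fh; have fN k : rfinrank k -> rfinrank (fun t : N.-tuple R => -1 * k t).
  by apply: rfinrankM; exact: rfinrank_cst.
rewrite !cube_integralD ?cube_integralZ ?mulN1r //; do ?apply: rfinrankD => //; exact: fN.
Qed.

Lemma cube_integral_sum N (I : Type) (s : seq I) (P : pred I) (F : I -> N.-tuple R -> R) :
  (forall i, P i -> rfinrank (F i)) ->
  cube_integral (fun t => \sum_(i <- s | P i) F i t) =
  \sum_(i <- s | P i) cube_integral (F i).
Proof.
move=> fF; apply/(@complexI R); rewrite rmorph_sum /= -cubeC_real.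
under [RHS]eq_bigr do rewrite -cubeC_real.
by rewrite -cubeC_sum //; apply: eq_cubeC => t; rewrite rmorph_sum.
Qed.

Lemma cube_integral_perm N (s : {perm 'I_N}) (f : N.-tuple R -> R) : rfinrank f ->
  cube_integral (fun t => f (permt s t)) = cube_integral f.
Proof.
by move=> ff; apply/(@complexI R); rewrite -!cubeC_real (cubeC_perm s ff).
Qed.

Lemma cweight_permt N (s : {perm 'I_N}) (t : N.-tuple R) :
  cweight n (permt s t) = cweight n t.
Proof. by apply/(@complexI R); rewrite !cweightC dyson_permt. Qed.

Lemma perm_two (N : nat) (j k : 'I_N.+2) : j != k ->
  exists s : {perm 'I_N.+2}, s ord0 = j /\ s (lift ord0 ord0) = k.
Proof.
move=> jk; pose o1 : 'I_N.+2 := lift ord0 ord0; pose k' := tperm ord0 j k.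
have k'0 : k' != ord0.
  by rewrite -(tpermR ord0 j) (inj_eq perm_inj) eq_sym.
exists (tperm o1 k' * tperm ord0 j)%g; rewrite !permM; split.
  by rewrite (tpermD _ k'0) ?tpermL // /o1 -val_eqE.
by rewrite -[lift ord0 ord0]/o1 tpermL tpermK.
Qed.

Definition pair_integral (N : nat) g1 g2 : R :=
  \int[mu]_(x in circ) \int[mu]_(y in circ)
    (g1 x * g2 y * (chord2 x y ^+ n * pairker n N x y)).

Lemma rfinrank_pair N g1 g2 (j k : 'I_N) : continuous g1 -> continuous g2 ->
  rfinrank (fun t : N.-tuple R => g1 (tnth t j) * g2 (tnth t k) * cweight n t).
Proof.
move=> c1 c2; apply: rfinrankM; last exact: rfinrank_cweight.
by apply: rfinrankM; exact: rfinrank_coord.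
Qed.

Lemma cube_integral_pair N g1 g2 (j k : 'I_N.+2) : continuous g1 -> continuous g2 ->
  j != k ->
  cube_integral (fun t : N.+2.-tuple R => g1 (tnth t j) * g2 (tnth t k) * cweight n t) =
  pair_integral N g1 g2.
Proof.
move=> c1 c2 /perm_two[s [<- <-]].
rewrite -(cube_integral_perm (s^-1)%g (rfinrank_pair _ _ c1 c2)).
rewrite (eq_cube_integral (g := fun t : N.+2.-tuple R => g1 (tnth t ord0) *
  g2 (tnth t (lift ord0 ord0)) * cweight n t)); last first.
  by move=> t; rewrite cweight_permt !tnth_mktuple !permK.
rewrite /pair_integral /=; apply: eq_Rintegral => x _; apply: eq_Rintegral => y _.
have -> : pairker n N x y =
  cube_integral (fun t : N.-tuple R => ker n x t * ker n y t * cweight n t) by [].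
rewrite [RHS]mulrA -cube_integralZ; last first.
  by apply: rfinrankM; [apply: rfinrankM; exact: rfinrank_ker | exact: rfinrank_cweight].
apply: eq_cube_integral => t.
by rewrite tnthS !tnth0 !cweight_cons ker_cons; ring.
Qed.

Lemma rfinrank_pairsum N g1 g2 : continuous g1 -> continuous g2 ->
  rfinrank (fun t : N.-tuple R => pairsum g1 g2 t).
Proof.
move=> c1 c2; apply: rfinrank_sum => j _; apply: rfinrank_sum => k _.
by apply: rfinrankM; exact: rfinrank_coord.
Qed.

Lemma cube_integral_pairsum N g1 g2 : continuous g1 -> continuous g2 ->
  cube_integral (fun t : N.+2.-tuple R => pairsum g1 g2 t * cweight n t) =
  (N.+2 * N.+1)%:R * pair_integral N g1 g2.
Proof.
move=> c1 c2.
rewrite (eq_cube_integral (g := fun t : N.+2.-tuple R => \sum_j \sum_(k | k != j)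
  (g1 (tnth t j) * g2 (tnth t k) * cweight n t))); last first.
  by move=> t; rewrite mulr_suml; apply: eq_bigr => j _; rewrite mulr_suml.
rewrite cube_integral_sum; last first.
  by move=> j _; apply: rfinrank_sum => k _; exact: rfinrank_pair.
transitivity (\sum_(j < N.+2) \sum_(k | k != j) pair_integral N g1 g2).
  apply: eq_bigr => j _; rewrite cube_integral_sum; last by move=> k _; exact: rfinrank_pair.
  by apply: eq_bigr => k kj; rewrite cube_integral_pair // eq_sym.
transitivity (\sum_(j < N.+2) (N.+1)%:R * pair_integral N g1 g2).
  apply: eq_bigr => j _; rewrite sumr_const mulr_natl; congr (_ *+ _).
  by have := cardC1 j; rewrite card_ord.
by rewrite sumr_const card_ord natrM -mulrA [RHS]mulr_natl.
Qed.

Lemma chord2_le4 (x y : R) : chord2 x y <= 4.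
Proof. by rewrite chord2E; have := cos_geN1 (x - y); lra. Qed.

Lemma pairker_ge0 N (x y : R) : 0 <= pairker n N x y.
Proof.
apply: cube_integral_ge0 => t.
by rewrite !mulr_ge0 ?ker_ge0 ?cweight_ge0.
Qed.

Lemma continuousZ_R (a : R) g : continuous g -> continuous (fun x => a * g x).
Proof. by move=> cg x; apply: cvgM; [exact: cvg_cst | exact: cg]. Qed.

Lemma Rintegral_circZ (a : R) g : continuous g ->
  \int[mu]_(x in circ) (a * g x) = a * \int[mu]_(x in circ) g x.
Proof.
move=> cg; rewrite RintegralZl //; exact: continuous_circ_integrable.
Qed.

Lemma pair_integral_le N g1 g2 (B : R) :
  continuous g1 -> continuous g2 -> (forall x, 0 <= g1 x) -> (forall x, 0 <= g2 x) ->
  (forall x y, g1 x * g2 y != 0 -> `|x - y| <= B) ->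
  pair_integral N g1 g2 <= B ^+ (2 * n) * pairker n N 0 0 *
    ((\int[mu]_(x in circ) g1 x) * (\int[mu]_(x in circ) g2 x)).
Proof.
move=> c1 c2 p1 p2 H; set J := pairker n N 0 0; set I2 := \int[mu]_(x in circ) g2 x.
have J0 : 0 <= J by exact: pairker_ge0.
have B0 : 0 <= B ^+ (2 * n) by rewrite exprM exprn_ge0 // sqr_ge0.
have pw x y : g1 x * g2 y * (chord2 x y ^+ n * pairker n N x y) <=
    (g1 x * (B ^+ (2 * n) * J)) * g2 y.
  rewrite [leRHS]mulrAC.
  have [->|gn] := eqVneq (g1 x * g2 y) 0; first by rewrite !mul0r.
  have Bxy := H _ _ gn; rewrite ler_wpM2l ?mulr_ge0 //.
  apply: ler_pM; [by rewrite exprn_ge0 ?chord2_ge0 | exact: pairker_ge0 | | exact: pairker_le].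
  rewrite exprM; apply: lerXn2r; rewrite ?nnegrE ?chord2_ge0 ?sqr_ge0 //.
  apply: le_trans (chord2_le _ _) _; rewrite -real_normK ?num_real //.
  by apply: lerXn2r; rewrite ?nnegrE ?normr_ge0 // (le_trans _ Bxy).
have pos x y : 0 <= g1 x * g2 y * (chord2 x y ^+ n * pairker n N x y).
  exact: (mulr_ge0 (mulr_ge0 (p1 x) (p2 y))
    (mulr_ge0 (exprn_ge0 _ (chord2_ge0 _ _)) (pairker_ge0 _ _ _))).
apply: (@le_trans _ _ (\int[mu]_(x in circ) (B ^+ (2 * n) * J * I2 * g1 x))).
  apply: le_Rintegral_circ; first exact: continuousZ_R.
    move=> x; apply: Rintegral_ge0 => y _.
    exact: pos.
  move=> x; rewrite (_ : _ * g1 x = g1 x * (B ^+ (2 * n) * J) * I2); last by ring.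
  rewrite -Rintegral_circZ //; apply: le_Rintegral_circ; first exact: continuousZ_R.
    by move=> y; exact: pos.
  exact: pw.
by rewrite Rintegral_circZ // mulrAC mulrA.
Qed.

(** The smallness conditions on [B] keep the factors [1 - B^2 / 12] (from the chord) and
    [1 - (n N B)^2 / 2] (from the cosines) nonnegative, so that lower bounds may be multiplied. *)
Lemma pair_integral_ge N g1 g2 (A B : R) :
  continuous g1 -> continuous g2 -> (forall x, 0 <= g1 x <= 1) ->
  (forall x, 0 <= g2 x <= 1) -> 0 <= A -> B ^+ 2 <= 12 ->
  (n * N)%:R ^+ 2 * B ^+ 2 <= 2 ->
  (forall x y, g1 x * g2 y != 0 -> A <= `|x - y| <= B) ->
  (A ^+ 2 * (1 - B ^+ 2 / 12)) ^+ n * ((1 - (n * N)%:R ^+ 2 * B ^+ 2 / 2) * pairker n N 0 0) *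
    ((\int[mu]_(x in circ) g1 x) * (\int[mu]_(x in circ) g2 x)) <=
  pair_integral N g1 g2.
Proof.
move=> c1 c2 p1 p2 A0 B12 dB H; set J := pairker n N 0 0; set I2 := \int[mu]_(x in circ) g2 x.
have J0 : 0 <= J by exact: pairker_ge0.
set K := _ ^+ n * (_ * J).
have q1 x : 0 <= g1 x by case/andP: (p1 x).
have q2 x : 0 <= g2 x by case/andP: (p2 x).
have pw x y : (g1 x * K) * g2 y <=
    g1 x * g2 y * (chord2 x y ^+ n * pairker n N x y).
  rewrite [leLHS]mulrAC.
  have [->|gn] := eqVneq (g1 x * g2 y) 0; first by rewrite !mul0r.
  have /andP[Axy Bxy] := H _ _ gn; rewrite ler_wpM2l ?mulr_ge0 //.
  have B0 : 0 <= B by apply: le_trans Bxy.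
  have sB : (x - y) ^+ 2 <= B ^+ 2.
    rewrite -real_normK ?num_real //.
    by apply: lerXn2r; rewrite ?nnegrE ?normr_ge0.
  have sA : A ^+ 2 <= (x - y) ^+ 2.
    rewrite -[leRHS]real_normK ?num_real //.
    by apply: lerXn2r; rewrite ?nnegrE ?normr_ge0.
  have d0 : 0 <= ((n * N)%:R : R) ^+ 2 by exact: sqr_ge0.
  have A20 : 0 <= A ^+ 2 by exact: sqr_ge0.
  apply: ler_pM.
  - rewrite exprn_ge0 // mulr_ge0 ?sqr_ge0 //; lra.
  - rewrite mulr_ge0 //; lra.
  - apply: lerXn2r; rewrite ?nnegrE ?chord2_ge0 //.
      by rewrite mulr_ge0 ?sqr_ge0 //; lra.
    apply: le_trans (chord2_ge x y).
    have -> : (x - y) ^+ 4 = ((x - y) ^+ 2) ^+ 2 by rewrite -exprM.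
    by set u := (x - y) ^+ 2 in sA sB *; nra.
  - apply: le_trans (pairker_ge n_gt0 N x y); rewrite ler_wpM2r // lerB //.
    by rewrite ler_pM2r ?invr_gt0 // ler_wpM2l.
apply: (@le_trans _ _ (\int[mu]_(x in circ) (K * I2 * g1 x))).
  by rewrite Rintegral_circZ // [leRHS]mulrAC mulrA.
(* A crude bound, only to know that the integrals bounded from below are finite. *)
have bd x y : 0 <= g1 x * g2 y * (chord2 x y ^+ n * pairker n N x y) <= 4 ^+ n * J.
  rewrite (mulr_ge0 (mulr_ge0 (q1 x) (q2 y))
    (mulr_ge0 (exprn_ge0 _ (chord2_ge0 _ _)) (pairker_ge0 _ _ _))) /=.
  rewrite -[leRHS]mul1r; apply: ler_pM; first exact: mulr_ge0.
  - exact: mulr_ge0 (exprn_ge0 _ (chord2_ge0 _ _)) (pairker_ge0 _ _ _).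
  - by rewrite -[1]mulr1; apply: ler_pM => //; [case/andP: (p1 x) | case/andP: (p2 y)].
  apply: ler_pM; [by rewrite exprn_ge0 ?chord2_ge0 | exact: pairker_ge0 | | exact: pairker_le].
  by apply: lerXn2r; rewrite ?nnegrE ?chord2_ge0 ?chord2_le4.
apply: (@ge_Rintegral_circ _ _ _ (\int[mu]_(x in circ) (4 ^+ n * J))); first exact: continuousZ_R.
  move=> x; apply/andP; split; first by apply: Rintegral_ge0 => y _; case/andP: (bd x y).
  apply: le_Rintegral_circ; first exact: cst_continuous.
    by move=> y; case/andP: (bd x y).
  by move=> y; case/andP: (bd x y).
move=> x; rewrite (_ : _ * g1 x = g1 x * K * I2); last by ring.
rewrite -Rintegral_circZ //.
apply: (@ge_Rintegral_circ _ _ _ (4 ^+ n * J)); first exact: continuousZ_R.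
  exact: bd.
exact: pw.
Qed.

End PairSums.

(** * Scaling limit of the pair intensity *)

Section ScalingLimit.
Context {R : realType}.
Local Notation mu := (@lebesgue_measure R).
Local Notation circ := [set` `[(- pi)%R, (pi : R)[].
Variable n : nat.
Hypothesis n_gt0 : (0 < n)%N.

Definition kappa : R :=
  (n%:R ^+ (2 * n) * n`!%:R ^+ 3) / (4 * pi ^+ 2 * ((2 * n)`!%:R * (3 * n)`!%:R)).

(* With m = N + 2 points: the pair intensity at angles x / m and y / m is
   asymptotic to [kappaN N * |x - y|^(2n)] as x - y tends to 0. *)
Definition kappaN (N : nat) : R :=
  (N.+2 * N.+1)%:R / N.+2%:R ^+ 2 * pairker n N 0 0 /
  (N.+2%:R ^+ (2 * n) * @partition_fun R n N.+2).

Lemma fact_add_prod (a k : nat) : ((a + k)`! = a`! * \prod_(i < k) (a + i.+1))%N.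
Proof.
elim: k => [|k IH]; first by rewrite addn0 big_ord0 muln1.
by rewrite addnS factS IH big_ord_recr /= addnS; ring.
Qed.

(** The quotient of [(n (N + 3))!] by [(n (N + 1))!] is a product of [2n] factors; divided by
    [N + 2], each tends to [n]. This is the source of [n^(2n)]. *)
Lemma kappaNE (N : nat) : kappaN N =
  n`!%:R ^+ 3 / (4 * pi ^+ 2 * ((2 * n)`!%:R * (3 * n)`!%:R)) * (N.+1%:R / N.+2%:R) *
  \prod_(i < 2 * n) ((n * N.+1 + i.+1)%:R / N.+2%:R).
Proof.
have f0 k : k`!%:R != 0 :> R by rewrite pnatr_eq0 -lt0n fact_gt0.
have D0 : @partition_fun R n N.+2 != 0 by rewrite gt_eqF // partition_fun_gt0.
have p0 : pi != 0 :> R by rewrite gt_eqF // pi_gt0.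
have N0 : N.+2%:R != 0 :> R by rewrite pnatr_eq0.
have E := @pairker00_partition R n n_gt0 N.
rewrite /kappaN.
have -> : pairker n N 0 0 = (n * N.+3)`!%:R * n`!%:R ^+ 3 * @partition_fun R n N.+2 /
    ((n * N.+1)`!%:R * ((2 * n)`!%:R * (3 * n)`!%:R) * (4 * pi ^+ 2)).
  by rewrite -E -[X in X / _]mulrA mulfK // !mulf_neq0 // ?expf_neq0 // pnatr_eq0.
have -> : (n * N.+3 = n * N.+1 + 2 * n)%N by rewrite !mulnS; lia.
rewrite fact_add_prod !natrM natr_prod prodf_div prodr_const card_ord.
move: (pi : R) p0 (@partition_fun R n N.+2) D0 N.+2%:R N0 {E}
  ((n * N.+1)`!%:R) (f0 (n * N.+1)%N) ((2 * n)`!%:R) (f0 (2 * n)%N)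
  ((3 * n)`!%:R) (f0 (3 * n)%N) => q q0 D D0 s s0 a a0 b b0 c c0.
by field; rewrite expf_neq0 // s0 c0 b0 q0 D0 a0.
Qed.

Lemma cvg_inv_add2 : (N.+2%:R^-1 : R) @[N --> \oo] --> (0 : R).
Proof.
have := @cvg_harmonic R; rewrite -(cvg_shiftS _); exact.
Qed.

Lemma cvg_prod (k : nat) (u : nat -> nat -> R) (l : R) :
  (forall i, u i N @[N --> \oo] --> l) ->
  (\prod_(i < k) u i N) @[N --> \oo] --> l ^+ k.
Proof.
move=> H; elim: k => [|k IH].
  by under eq_cvg do rewrite big_ord0; rewrite expr0; exact: cvg_cst.
under eq_cvg do rewrite big_ord_recr.
by rewrite exprSr; apply: cvgM.
Qed.

Lemma kappaN_cvg : kappaN N @[N --> \oo] --> kappa.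
Proof.
under eq_cvg do rewrite kappaNE.
have -> : kappa = n`!%:R ^+ 3 / (4 * pi ^+ 2 * ((2 * n)`!%:R * (3 * n)`!%:R)) * 1 * n%:R ^+ (2 * n).
  by rewrite /kappa; ring.
have lin (a c : R) : (c + a * (N.+2%:R)^-1) @[N --> \oo] --> c.
  rewrite -[X in _ --> X]addr0 -[X in _ --> _ + X](mulr0 a).
  by apply: cvgD; [exact: cvg_cst | apply: cvgM; [exact: cvg_cst | exact: cvg_inv_add2]].
apply: cvgM.
  apply: cvgM; first exact: cvg_cst.
  have := lin (-1) 1; apply: cvg_trans; apply: near_eq_cvg; near=> N.
  have N0 : N.+2%:R != 0 :> R by rewrite pnatr_eq0.
  by rewrite -[N.+1%:R](addrK 1) natr1; field.
apply: (@cvg_prod (2 * n) (fun i N => (n * N.+1 + i.+1)%:R / N.+2%:R)) => i.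
have := lin (i.+1%:R - n%:R) n%:R; apply: cvg_trans; apply: near_eq_cvg; near=> N.
have N0 : N.+2%:R != 0 :> R by rewrite pnatr_eq0.
have -> : (n * N.+1 + i.+1)%:R = n%:R * N.+2%:R + (i.+1%:R - n%:R) :> R.
  by rewrite natrD natrM -[N.+2%:R]natr1; ring.
by field.
Unshelve. all: by end_near. Qed.

Section Indicators.
Variables (phi : R -> R) (c d m : R).
Hypotheses (cphi : continuous phi) (cd : c <= d) (m0 : 0 < m).
Hypothesis phi01 : forall x, 0 <= phi x <= 1.

Lemma continuous_scaled : continuous (fun x => phi (m * x)).
Proof.
move=> x; apply: continuous_comp; first exact: mulrl_continuous.
exact: cphi.
Qed.

Local Notation J := [set` `[c / m, d / m]].

Lemma measure_scaled_itv : (mu J = ((d - c) / m)%:E)%E.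
Proof.
rewrite [mu _]lebesgue_measure_itv /= lte_fin.
case: ltP => [_|h]; first by rewrite -EFinB mulrBl.
have e : c = d.
  by apply/eqP; rewrite eq_le cd /=; rewrite -(ler_pM2r (x := m^-1)) ?invr_gt0.
by rewrite e subrr mul0r.
Qed.

Lemma scaled_le : (forall x, phi x != 0 -> c <= x <= d) ->
  \int[mu]_(x in circ) phi (m * x) <= (d - c) / m.
Proof.
move=> supp; rewrite -lee_fin fineK ?(circ_fin_num continuous_scaled) //.
rewrite -measure_scaled_itv.
apply: (@le_trans _ _ (\int[mu]_(x in circ) (\1_J x)%:E)%E).
  apply: le_ge0_integral => x _; first by rewrite lee_fin; case/andP: (phi01 (m * x)).
  rewrite lee_fin indicE; have [->|nz] := eqVneq (phi (m * x)) 0; first by rewrite ler0n.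
  have /andP[h1 h2] := supp _ nz.
  rewrite mem_set; first by case/andP: (phi01 (m * x)).
  by rewrite /= in_itv /= ler_pdivrMr // ler_pdivlMr // (mulrC x) h1 h2.
rewrite integral_indic; try exact: measurable_itv.
apply: le_measure; rewrite ?inE; try exact: measurable_itv; try exact: subIsetl.
by apply: measurableI; exact: measurable_itv.
Qed.

Lemma scaled_ge : (forall x, c <= x <= d -> phi x = 1) -> - pi <= c / m -> d / m < pi ->
  (d - c) / m <= \int[mu]_(x in circ) phi (m * x).
Proof.
move=> one cpi dpi; rewrite -lee_fin fineK ?(circ_fin_num continuous_scaled) //.
rewrite -measure_scaled_itv.
apply: (@le_trans _ _ (\int[mu]_(x in circ) (\1_J x)%:E)%E); last first.
  apply: le_ge0_integral => x _; first by rewrite lee_fin indicE ler0n.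
  rewrite lee_fin indicE; case: (boolP (x \in J)) => [|_]; last by case/andP: (phi01 (m * x)).
  rewrite inE /= in_itv /= ler_pdivrMr // ler_pdivlMr // => /andP[h1 h2].
  by rewrite one // mulrC h1.
rewrite integral_indic; try exact: measurable_itv.
apply: le_measure; rewrite ?inE; try exact: measurable_itv.
  by apply: measurableI; exact: measurable_itv.
move=> x /=; rewrite !in_itv /= => /andP[h1 h2]; split; first by rewrite h1.
by rewrite (le_trans cpi h1) (le_lt_trans h2 dpi).
Qed.

End Indicators.

End ScalingLimit.

Section PairExpectation.
Context {R : realType}.
Local Notation mu := (@lebesgue_measure R).
Local Notation circ := [set` `[(- pi)%R, (pi : R)[].
Variable n : nat.
Hypothesis n_gt0 : (0 < n)%N.
Implicit Types phi : R -> R.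

Definition scaled_pairsum (N : nat) phi1 phi2 (t : N.+2.-tuple R) : R :=
  pairsum (fun x => phi1 (N.+2%:R * x)) (fun x => phi2 (N.+2%:R * x)) t.

Definition pair_expect (N : nat) phi1 phi2 : R :=
  cube_integral (fun t : N.+2.-tuple R => scaled_pairsum phi1 phi2 t * cweight n t)
  / partition_fun n N.+2.

Lemma pair_expectE N phi1 phi2 : continuous phi1 -> continuous phi2 ->
  pair_expect N phi1 phi2 = (N.+2 * N.+1)%:R *
    pair_integral n N (fun x => phi1 (N.+2%:R * x)) (fun x => phi2 (N.+2%:R * x)) /
    partition_fun n N.+2.
Proof.
move=> c1 c2; rewrite /pair_expect cube_integral_pairsum //; exact: continuous_scaled.
Qed.

Lemma scaled_abs_le (m x y B : R) : 0 < m -> (`|m * x - m * y| <= B) = (`|x - y| <= B / m).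
Proof.
by move=> m0; rewrite -mulrBr normrM (gtr0_norm m0) ler_pdivlMr // mulrC.
Qed.

Lemma scaled_abs_ge (m x y A : R) : 0 < m -> (A <= `|m * x - m * y|) = (A / m <= `|x - y|).
Proof.
by move=> m0; rewrite -mulrBr normrM (gtr0_norm m0) ler_pdivrMr // mulrC.
Qed.

(** Bookkeeping of the powers of [m], with [M] standing for [m^(2n)]: one from each rescaled
    integral and [2n] from the repulsion. *)
Lemma kappaN_scale (a m M D J X Y v w : R) : m != 0 -> M != 0 -> D != 0 ->
  a / m ^+ 2 * J / (M * D) * (X * Y * (v * w)) * D =
  a * (X / M * (Y * J) * ((v / m) * (w / m))).
Proof. by move=> m0 M0 D0; field; rewrite m0 M0 D0. Qed.

Lemma pair_expect_le N phi1 phi2 (c1 d1 c2 d2 B : R) :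
  continuous phi1 -> continuous phi2 ->
  (forall x, 0 <= phi1 x <= 1) -> (forall x, 0 <= phi2 x <= 1) ->
  c1 <= d1 -> c2 <= d2 ->
  (forall x, phi1 x != 0 -> c1 <= x <= d1) -> (forall x, phi2 x != 0 -> c2 <= x <= d2) ->
  (forall x y, phi1 x * phi2 y != 0 -> `|x - y| <= B) ->
  pair_expect N phi1 phi2 <= kappaN n N * (B ^+ (2 * n) * ((d1 - c1) * (d2 - c2))).
Proof.
move=> k1 k2 p1 p2 cd1 cd2 s1 s2 H; set m : R := N.+2%:R.
have m0 : 0 < m by rewrite ltr0n.
have D0 := @partition_fun_gt0 R n n_gt0 N.+2.
rewrite pair_expectE // ler_pdivrMr //.
have B0 : 0 <= (B / m) ^+ (2 * n) by rewrite exprM exprn_ge0 // sqr_ge0.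
have I1 := scaled_le k1 cd1 m0 p1 s1; have I2 := scaled_le k2 cd2 m0 p2 s2.
have P := @pair_integral_le R n n_gt0 N _ _ (B / m)
  (continuous_scaled (m := m) k1) (continuous_scaled (m := m) k2).
have {}P : pair_integral n N (fun x => phi1 (m * x)) (fun x => phi2 (m * x)) <=
    (B / m) ^+ (2 * n) * pairker n N 0 0 * (((d1 - c1) / m) * ((d2 - c2) / m)).
  apply: le_trans (P _ _ _) _.
  - by move=> x; case/andP: (p1 (m * x)).
  - by move=> x; case/andP: (p2 (m * x)).
  - by move=> x y /H; rewrite scaled_abs_le.
  - apply: ler_wpM2l; first by rewrite mulr_ge0 // pairker_ge0.
    by apply: ler_pM => //; apply: Rintegral_ge0 => x _;
      [case/andP: (p1 (m * x)) | case/andP: (p2 (m * x))].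
apply: le_trans (ler_wpM2l (ler0n _ _) P) _.
have mm : m ^+ (2 * n) != 0 by rewrite expf_neq0 // lt0r_neq0.
have := kappaN_scale (N.+2 * N.+1)%:R (pairker n N 0 0) (B ^+ (2 * n)) 1 (d1 - c1) (d2 - c2)
  (lt0r_neq0 m0) mm (lt0r_neq0 D0).
by rewrite mulr1 mul1r /kappaN expr_div_n => ->.
Qed.

Lemma pair_expect_ge N phi1 phi2 (c1 d1 c2 d2 A B : R) :
  continuous phi1 -> continuous phi2 ->
  (forall x, 0 <= phi1 x <= 1) -> (forall x, 0 <= phi2 x <= 1) ->
  c1 <= d1 -> c2 <= d2 -> 0 <= A -> 0 <= B ->
  (forall x, c1 <= x <= d1 -> phi1 x = 1) -> (forall x, c2 <= x <= d2 -> phi2 x = 1) ->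
  (forall x y, phi1 x * phi2 y != 0 -> A <= `|x - y| <= B) ->
  n%:R * B <= 1 -> [/\ `|c1| <= N.+2%:R, `|d1| <= N.+2%:R, `|c2| <= N.+2%:R,
    `|d2| <= N.+2%:R & B <= N.+2%:R] ->
  kappaN n N * ((A ^+ 2 * (1 - B ^+ 2 / N.+2%:R ^+ 2 / 12)) ^+ n *
     (1 - n%:R ^+ 2 * B ^+ 2 / 2) * ((d1 - c1) * (d2 - c2))) <=
  pair_expect N phi1 phi2.
Proof.
move=> k1 k2 p1 p2 cd1 cd2 A0 B0 s1 s2 H nB [nc1 nd1 nc2 nd2 BN].
set m : R := N.+2%:R in nc1 nd1 nc2 nd2 BN *.
have m0 : 0 < m by rewrite ltr0n.
have D0 := @partition_fun_gt0 R n n_gt0 N.+2.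
rewrite pair_expectE // ler_pdivlMr //.
(* Since [pi >= 2], a bound by [m] places the rescaled intervals inside the domain of
   integration. *)
have pi2 : 2 <= pi :> R by exact: pi_ge2.
have lo x : `|x| <= m -> - pi <= x / m.
  rewrite ler_norml => /andP[h _]; rewrite ler_pdivlMr //.
  have : 2 * m <= pi * m by rewrite ler_wpM2r // ltW.
  by rewrite mulNr; lra.
have hi x : `|x| <= m -> x / m < pi.
  rewrite ler_norml => /andP[_ h]; rewrite ltr_pdivrMr //.
  have : 2 * m <= pi * m by rewrite ler_wpM2r // ltW.
  lra.
have I1 := scaled_ge k1 cd1 m0 p1 s1 (lo _ nc1) (hi _ nd1).
have I2 := scaled_ge k2 cd2 m0 p2 s2 (lo _ nc2) (hi _ nd2).
have Bm1 : (B / m) ^+ 2 <= 1.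
  by rewrite exprn_ile1 // ?divr_ge0 ?(ltW m0) // ler_pdivrMr // mul1r.
(* [N <= m] makes the error uniform in the number of points: the frequency bound [n N] becomes at
   most [n] after rescaling. *)
have dB : (n * N)%:R ^+ 2 * (B / m) ^+ 2 <= n%:R ^+ 2 * B ^+ 2.
  rewrite natrM -!exprMn; apply: lerXn2r; rewrite ?nnegrE ?mulr_ge0 ?ler0n ?invr_ge0 //.
  rewrite -mulrA ler_wpM2l ?ler0n // mulrCA ler_piMr //.
  rewrite ler_pdivrMr // mul1r /m ler_nat.
  exact: leq_trans (leqnSn N) (leqnSn N.+1).
have nB2 : n%:R ^+ 2 * B ^+ 2 <= 1.
  by rewrite -exprMn exprn_ile1 // mulr_ge0 ?ler0n.
have P : ((A / m) ^+ 2 * (1 - (B / m) ^+ 2 / 12)) ^+ n *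
    ((1 - (n * N)%:R ^+ 2 * (B / m) ^+ 2 / 2) * pairker n N 0 0) *
    ((\int[mu]_(x in circ) phi1 (m * x)) * (\int[mu]_(x in circ) phi2 (m * x))) <=
    pair_integral n N (fun x => phi1 (m * x)) (fun x => phi2 (m * x)).
  apply: pair_integral_ge => //; try exact: continuous_scaled.
  - by rewrite divr_ge0 // ltW.
  - by apply: le_trans Bm1 _; rewrite ler1n.
  - by apply: le_trans dB _; apply: le_trans nB2 _; rewrite ler1n.
  - by move=> x y /H; rewrite scaled_abs_le // scaled_abs_ge.
apply: le_trans (ler_wpM2l (ler0n _ _) P).
pose X : R := (A ^+ 2 * (1 - B ^+ 2 / m ^+ 2 / 12)) ^+ n.
have -> : ((A / m) ^+ 2 * (1 - (B / m) ^+ 2 / 12)) ^+ n = X / m ^+ (2 * n).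
  by rewrite /X !expr_div_n mulrAC expr_div_n -exprM.
have X0 : 0 <= X.
  rewrite exprn_ge0 // mulr_ge0 ?sqr_ge0 // -expr_div_n.
  by move: Bm1; move: ((B / m) ^+ 2) => y; lra.
have Z : 0 <= 1 - n%:R ^+ 2 * B ^+ 2 / 2.
  by move: nB2; move: (n%:R ^+ 2 * B ^+ 2) => y; lra.
have J0 := @pairker00_ge0 R n n_gt0 N.
have mm : 0 < m ^+ (2 * n) by rewrite exprn_gt0.
apply: (@le_trans _ _ ((N.+2 * N.+1)%:R * (X / m ^+ (2 * n) *
  ((1 - n%:R ^+ 2 * B ^+ 2 / 2) * pairker n N 0 0) * (((d1 - c1) / m) * ((d2 - c2) / m))))).
  by rewrite /kappaN (kappaN_scale _ _ _ _ _ _ (lt0r_neq0 m0) (lt0r_neq0 mm) (lt0r_neq0 D0)).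
rewrite ler_wpM2l ?ler0n //; apply: ler_pM.
- by apply: mulr_ge0; [rewrite divr_ge0 // ltW | rewrite mulr_ge0].
- by rewrite mulr_ge0 // divr_ge0 ?subr_ge0 // ltW.
- rewrite ler_wpM2l ?divr_ge0 ?(ltW mm) // ler_wpM2r // lerB //.
  by rewrite ler_pM2r ?invr_gt0.
- by apply: ler_pM => //; rewrite divr_ge0 ?subr_ge0 // ltW.
Qed.

(** Asking for the comparison only where the weight is nonzero excludes colliding angles, which a
    configuration merges into one point. *)
Lemma circular_expectation_le (N : nat) (G : N.+2.-tuple R -> R) phi1 phi2 :
  continuous phi1 -> continuous phi2 -> (forall t, 0 <= G t) ->
  (forall t, cweight n t != 0 -> G t <= scaled_pairsum phi1 phi2 t) ->
  circular_expectation (2 * n)%:R G <= pair_expect N phi1 phi2.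
Proof.
move=> k1 k2 G0 H; rewrite /circular_expectation /pair_expect.
rewrite (eq_cube_integral (@circular_weightE R n N.+2)) -/(partition_fun n N.+2).
rewrite ler_pM2r ?invr_gt0 ?partition_fun_gt0 //.
rewrite (eq_cube_integral (g := fun t => G t * cweight n t)); last first.
  by move=> t; rewrite circular_weightE.
apply: le_cube_integral.
- apply: rfinrankM; last exact: rfinrank_cweight.
  by apply: rfinrank_pairsum; exact: continuous_scaled.
- by move=> t; rewrite mulr_ge0 ?cweight_ge0.
- move=> t; have [->|w0] := eqVneq (cweight n t) 0; first by rewrite !mulr0.
  by rewrite ler_wpM2r ?cweight_ge0 // H.
Qed.

Lemma cweight_bounded (N : nat) : exists M : R, forall t : N.-tuple R, cweight n t <= M.
Proof.
exists (\prod_(j < N) \prod_(k < N | (j < k)%N) 4 ^+ n) => t.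
apply: ler_prod => j _; rewrite prodr_ge0 /=; last by move=> k _; rewrite exprn_ge0 ?chord2_ge0.
apply: ler_prod => k _; rewrite exprn_ge0 ?chord2_ge0 //=.
by apply: lerXn2r; rewrite ?nnegrE ?chord2_ge0 ?chord2_le4.
Qed.

(** The two subtracted terms will pay for truncation. The bounds on [G] and on the weight meet the
    boundedness condition of [ge_cube_integral]. *)
Lemma circular_expectation_ge (N : nat) (G : N.+2.-tuple R -> R) phi1 phi2 :
  continuous phi1 -> continuous phi2 -> (forall t, 0 <= G t <= 1) ->
  (forall t, cweight n t != 0 -> scaled_pairsum phi1 phi2 t
     - scaled_pairsum phi1 phi1 t - scaled_pairsum phi2 phi2 t <= G t) ->
  pair_expect N phi1 phi2 - pair_expect N phi1 phi1 - pair_expect N phi2 phi2 <=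
  circular_expectation (2 * n)%:R G.
Proof.
move=> k1 k2 G0 H; rewrite /circular_expectation /pair_expect.
rewrite (eq_cube_integral (@circular_weightE R n N.+2)) -/(partition_fun n N.+2) -!mulrBl.
rewrite ler_pM2r ?invr_gt0 ?partition_fun_gt0 //.
rewrite (eq_cube_integral (f := fun t => G t * _) (g := fun t => G t * cweight n t)); last first.
  by move=> t; rewrite circular_weightE.
have rf u v : continuous u -> continuous v ->
    rfinrank (fun t : N.+2.-tuple R => scaled_pairsum u v t * cweight n t).
  move=> cu cv; apply: rfinrankM; last exact: rfinrank_cweight.
  by apply: rfinrank_pairsum; exact: continuous_scaled.
have rfN u v : continuous u -> continuous v ->
    rfinrank (fun t : N.+2.-tuple R => -1 * (scaled_pairsum u v t * cweight n t)).
  by move=> cu cv; apply: rfinrankM; [exact: rfinrank_cst | exact: rf].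
set I12 := cube_integral _; set I11 := cube_integral _; set I22 := cube_integral _.
have -> : I12 - I11 - I22 = cube_integral (fun t : N.+2.-tuple R =>
    (scaled_pairsum phi1 phi2 t * cweight n t + -1 * (scaled_pairsum phi1 phi1 t * cweight n t))
     + -1 * (scaled_pairsum phi2 phi2 t * cweight n t)).
  exact: cube_integralB2 (rf _ _ k1 k2) (rf _ _ k1 k1) (rf _ _ k2 k2).
have [M wM] := cweight_bounded N.+2.
apply: (@ge_cube_integral _ _ M).
- by apply: rfinrankD; [apply: rfinrankD; [exact: rf | exact: rfN] | exact: rfN].
- move=> t; have /andP[g0 g1] := G0 t; rewrite mulr_ge0 ?cweight_ge0 //=.
  by apply: le_trans (wM t); rewrite ler_piMl ?cweight_ge0.
- move=> t; have [->|w0] := eqVneq (cweight n t) 0; first by rewrite !(mulr0, addr0).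
  rewrite !mulN1r -!mulrBl ler_wpM2r ?cweight_ge0 //; exact: H.
Qed.

End PairExpectation.

(** * The limiting point process *)

Section PointCounts.
Context {R : realType}.
Implicit Types (X : config R) (D : set R) (a b : R).

(** One finite list serves both linear statistics and counts, so that they can be compared term by
    term. *)
Definition window X a b : seq R :=
  finmap.enum_fset (fset_set (points X `&` [set` `[a, b]])).

Lemma vague_evalE X (phi : test_fun R) a b :
  (forall x, phi x != 0 -> a <= x <= b) ->
  vague_eval X phi = \sum_(x <- window X a b) phi x.
Proof.
move=> supp; rewrite /window -(fsbig_finite _ phi (points_locally_finite X a b)).
apply/esym; apply: fsbig_widen; first exact: subIsetl.
move=> x [Xx nXab] /=; apply/eqP; apply: contra_notT nXab => /supp h.
by split => //; rewrite /= in_itv.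
Qed.

Lemma npointsE X D a b : D `<=` [set` `[a, b]] ->
  npoints X D = ((\sum_(x <- window X a b) \1_D x)%:E)%E.
Proof.
move=> Dab.
have fD : finite_set (points X `&` D).
  by apply: sub_finite_set (points_locally_finite X a b); exact: setIS.
rewrite /npoints /counting asboolT //; congr EFin.
rewrite /window -(fsbig_finite _ (\1_D : R -> R) (points_locally_finite X a b)).
rewrite -(@fsbig_widen _ _ _ _ (points X `&` D)); last 2 first.
- exact: setIS.
- move=> x [[Xx _] nXD] /=; rewrite indicE memNset // => Dx; exact: nXD.
rewrite fsbig_finite //= big_seq (eq_bigr (fun=> 1)); last first.
  move=> x; rewrite in_fset_set // inE => -[_ Dx].
  by rewrite indicE mem_set.
by rewrite -big_seq big_const_seq iter_addr addr0 count_predT.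
Qed.

(** For [c <= d] and [e > 0]: value 1 on [[c, d]], then linear down to 0 over a distance [e] on
    either side. *)
Definition trapezoid (c d e x : R) : R :=
  Num.max 0 (Num.min 1 (Num.min ((x - c) / e + 1) ((d - x) / e + 1))).

Lemma continuous_trapezoid c d e : continuous (trapezoid c d e).
Proof.
have l1 (u v : R) : continuous (fun x : R => (u * x + v) / e + 1).
  move=> x; apply: cvgD; last exact: cvg_cst.
  apply: cvgM; last exact: cvg_cst.
  by apply: cvgD; [exact: mulrl_continuous | exact: cvg_cst].
have l2 : continuous (fun x => (x - c) / e + 1).
  rewrite (_ : (fun x => _) = fun x => (1 * x + - c) / e + 1); first exact: l1.
  by apply/funext => x; rewrite mul1r.
have l3 : continuous (fun x => (d - x) / e + 1).
  rewrite (_ : (fun x => _) = fun x => (-1 * x + d) / e + 1); first exact: l1.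
  by apply/funext => x; rewrite mulN1r (addrC d).
have cmin (f g : R -> R) : continuous f -> continuous g ->
    continuous (fun x => Num.min (f x) (g x)).
  by move=> cf cg x; apply: continuous_min; [exact: cf | exact: cg].
have cmax (f g : R -> R) : continuous f -> continuous g ->
    continuous (fun x => Num.max (f x) (g x)).
  by move=> cf cg x; apply: continuous_max; [exact: cf | exact: cg].
exact: cmax (@cst_continuous _ _ _) (cmin _ _ (@cst_continuous _ _ _) (cmin _ _ l2 l3)).
Qed.

Lemma trapezoid01 c d e x : 0 <= trapezoid c d e x <= 1.
Proof. by rewrite /trapezoid le_max lexx /= ge_max ler01 /= ge_min lexx. Qed.

Lemma trapezoid1 c d e x : 0 < e -> c <= x <= d -> trapezoid c d e x = 1.
Proof.
move=> e0 /andP[cx xd]; rewrite /trapezoid.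
have h1 : 1 <= (x - c) / e + 1 by rewrite lerDr divr_ge0 ?subr_ge0 // ltW.
have h2 : 1 <= (d - x) / e + 1 by rewrite lerDr divr_ge0 ?subr_ge0 // ltW.
by rewrite min_l ?le_min ?h1 ?h2 // max_r.
Qed.

Lemma trapezoid_supp c d e x : 0 < e -> trapezoid c d e x != 0 -> c - e <= x <= d + e.
Proof.
move=> e0; apply: contraNT; rewrite negb_and -!ltNge => h.
rewrite /trapezoid max_l // ge_min ge_min; apply/orP; right; apply/orP.
case/orP: h => h; [left|right].
  have : (x - c) / e <= -1 by rewrite ler_pdivrMr // mulN1r; lra.
  lra.
have : (d - x) / e <= -1 by rewrite ler_pdivrMr // mulN1r; lra.
lra.
Qed.

Lemma trapezoid_compact c d e : 0 < e ->
  compact (closure [set x | trapezoid c d e x != 0]).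
Proof.
move=> e0; apply: (subclosed_compact _ (@segment_compact R (c - e) (d + e))).
    exact: closed_closure.
have cl : closed ([set` `[c - e, d + e]] : set R) by exact: itv_closed.
rewrite [X in _ `<=` X](iffLR (closure_id _) cl); apply: closureS => x /= h.
by rewrite in_itv /= trapezoid_supp.
Qed.

Definition trapezoid_fun c d e (e0 : 0 < e) : test_fun R :=
  TestFun (@continuous_trapezoid c d e) (@trapezoid_compact c d e e0).

Lemma continuous_vague_eval (phi : test_fun R) :
  continuous (fun X : config R => vague_eval X phi).
Proof.
move=> X; apply: (@continuous_comp (config R) {ptws test_fun R -> R} R
  (@vague_eval R) (fun f : {ptws test_fun R -> R} => f phi)).
  exact: (@initial_continuous _ _ (@vague_eval R)).
exact: (@proj_continuous _ (fun _ : test_fun R => R : topologicalType)).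
Qed.

(* By [cweight_eq0] the exceptional tuples have weight zero. *)
Lemma vague_eval_scaled n (m : nat) (t : m.-tuple R) (phi : test_fun R) :
  (0 < n)%N -> (0 < m)%N -> cweight n t != 0 ->
  vague_eval (scaled_config t) phi = \sum_(j < m) phi (m%:R * tnth t j).
Proof.
move=> n0 m0 w0.
have inj : {in [set: 'I_m] &, injective (fun j => m%:R * tnth t j)}.
  move=> j k _ _ E; apply/eqP; apply: contra_neqT w0 => jk.
  apply: (cweight_eq0 n0 jk).
  by apply: (mulfI _ E); rewrite pnatr_eq0 -lt0n.
rewrite /vague_eval /=.
rewrite fsbig_image //.
rewrite fsbig_finite //=; apply: perm_big; apply: uniq_perm.
- exact: finmap.fset_uniq.
- exact: index_enum_uniq.
- move=> j; rewrite [RHS]mem_index_enum in_fset_set; last exact: finite_finset.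
  exact: mem_set.
Qed.

End PointCounts.

Section PairCounts.
Import HBSimple HBNNSimple.
Context {R : realType}.
Variable n : nat.
Hypothesis n_gt0 : (0 < n)%N.
Context (d : measure_display) (T : measurableType d) (P : probability T R)
  (Xi : T -> config R).
Hypothesis sineXi : is_Sine (2 * n)%:R P Xi.
Implicit Types (phi : test_fun R) (X : config R).

(* Integrals of nonnegative functions are suprema over bounded simple
   functions; hence no measurability is needed. *)
Lemma ge0_integral_le_truncated (f : T -> \bar R) (B : \bar R) :
  (forall x, 0 <= f x)%E ->
  (forall C : R, 0 < C -> exists g : T -> \bar R,
     (forall x, Order.min C%:E (f x) <= g x)%E /\ (\int[P]_x g x <= B)%E) ->
  (\int[P]_x f x <= B)%E.
Proof.
move=> f0 H; rewrite ge0_integralTE //.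
apply: ge_ereal_sup => _ [h /= hf <-].
have [M [_ Mh]] := simple_bounded h.
(* [simple_bounded] bounds [h] by every number above [M]; this one is also positive, as a truncation
   level must be, and truncating at it does not cut [h]. *)
have M1 : M < `|M| + 1 by rewrite (le_lt_trans (ler_norm M)) // ltrDl.
have [|g [gf gB]] := H (`|M| + 1); first by rewrite ltr_wpDl.
apply: le_trans gB; rewrite -[sintegral _ _]/(sintegral P h).
have -> : sintegral P h = (\int[P]_x (h x)%:E)%E by rewrite integralT_nnsfun.
apply: le_ge0_integral => x _; first by rewrite lee_fin.
apply: le_trans (gf x); rewrite le_min hf andbT lee_fin.
exact: le_trans (ler_norm _) (Mh _ M1 x I).
Qed.

Definition trunc_eval (K : R) phi1 phi2 X : R :=
  Num.min K (vague_eval X phi1) * Num.min K (vague_eval X phi2).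

Lemma continuous_trunc_eval K phi1 phi2 : continuous (trunc_eval K phi1 phi2).
Proof.
have cmin phi : continuous (fun X : config R => Num.min K (vague_eval X phi)).
  move=> X; apply: (@continuous_min _ _ (fun=> K) (fun X => vague_eval X phi)).
    exact: cst_continuous.
  exact: continuous_vague_eval.
by move=> X; exact: (cvgM (cmin phi1 X) (cmin phi2 X)).
Qed.

Lemma vague_eval_ge0 X phi c d' : (forall x, 0 <= phi x <= 1) ->
  (forall x, phi x != 0 -> c <= x <= d') -> 0 <= vague_eval X phi.
Proof.
move=> p01 supp; rewrite (vague_evalE _ supp) sumr_ge0 // => x _.
by case/andP: (p01 x).
Qed.

Lemma trunc_eval_bounds K phi1 phi2 X c1 d1 c2 d2 : 0 <= K ->
  (forall x, 0 <= phi1 x <= 1) -> (forall x, 0 <= phi2 x <= 1) ->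
  (forall x, phi1 x != 0 -> c1 <= x <= d1) -> (forall x, phi2 x != 0 -> c2 <= x <= d2) ->
  0 <= trunc_eval K phi1 phi2 X <= K * K.
Proof.
move=> K0 p1 p2 s1 s2.
have m1 : 0 <= Num.min K (vague_eval X phi1) by rewrite le_min K0 (vague_eval_ge0 _ p1 s1).
have m2 : 0 <= Num.min K (vague_eval X phi2) by rewrite le_min K0 (vague_eval_ge0 _ p2 s2).
rewrite mulr_ge0 //=; apply: ler_pM => //; by rewrite ge_min lexx.
Qed.

(** [f] need not be measurable: domination by a constant makes the integral finite, so [fine] loses
    nothing. *)
Lemma bounded_Rintegral (f : T -> R) (K : R) : (forall x, 0 <= f x <= K) ->
  ((\int[P]_x f x)%:E = \int[P]_x (f x)%:E)%E.
Proof.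
move=> fK; rewrite fineK // ge0_fin_numE; last first.
  by apply: integral_ge0 => x _; rewrite lee_fin; case/andP: (fK x).
apply: (@le_lt_trans _ _ (\int[P]_x (cst K%:E x))%E).
  by apply: le_ge0_integral => x _; rewrite lee_fin; case/andP: (fK x).
rewrite integral_cst //.
have e : P setT = 1%E by exact: probability_setT.
by rewrite [X in (_ * X)%E]e mule1 ltry.
Qed.

Lemma sine_cvg (F : config R -> R) : continuous F -> bounded_fun F ->
  circular_expectation (2 * n)%:R (fun t : N.+2.-tuple R => F (scaled_config t))
    @[N --> \oo] --> \int[P]_w F (Xi w).
Proof.
move=> cF bF; have := sineXi.2 F cF bF.
pose u m := circular_expectation (2 * n)%:R (fun t : m.-tuple R => F (scaled_config t)).
rewrite -[X in X @ _](_ : u = _) // -(cvg_shiftS u) -(cvg_shiftS (fun m => u m.+1)).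
exact.
Qed.

Lemma npoints_nat X (D : set R) c d' : D `<=` [set` `[c, d']] ->
  exists k : nat, npoints X D = (k%:R%:E)%E.
Proof.
move=> Dcd; rewrite /npoints /counting asboolT; first by eexists.
by apply: sub_finite_set (points_locally_finite X c d'); exact: setIS.
Qed.

Lemma npoints_le_eval X (D : set R) phi c d' : D `<=` [set` `[c, d']] ->
  (forall x, 0 <= phi x <= 1) -> (forall x, phi x != 0 -> c <= x <= d') ->
  (forall x, D x -> phi x = 1) -> (npoints X D <= (vague_eval X phi)%:E)%E.
Proof.
move=> Dcd p01 supp one; rewrite (npointsE _ Dcd) (vague_evalE _ supp) lee_fin.
apply: ler_sum => x _; rewrite indicE; case: (boolP (x \in D)) => [|_].
  by rewrite inE => /one ->.
by case/andP: (p01 x).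
Qed.

Lemma eval_le_npoints X (D : set R) phi c d' : D `<=` [set` `[c, d']] ->
  (forall x, 0 <= phi x <= 1) -> (forall x, phi x != 0 -> D x) ->
  ((vague_eval X phi)%:E <= npoints X D)%E.
Proof.
move=> Dcd p01 suppD.
have supp x : phi x != 0 -> c <= x <= d' by move=> /suppD /Dcd; rewrite /= in_itv.
rewrite (npointsE _ Dcd) (vague_evalE _ supp) lee_fin.
apply: ler_sum => x _; rewrite indicE; have [->|/suppD Dx] := eqVneq (phi x) 0.
  by rewrite ler0n.
by rewrite mem_set //; case/andP: (p01 x).
Qed.

(** The test functions equal 1 on the sets and so dominate the counts. Their product vanishes on the
    diagonal, so the product of the two linear statistics is a sum over pairs of distinct points. *)
Lemma pair_count_le phi1 phi2 (D1 D2 : set R) (c1 d1 c2 d2 B : R) :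
  (forall x, 0 <= phi1 x <= 1) -> (forall x, 0 <= phi2 x <= 1) ->
  c1 <= d1 -> c2 <= d2 ->
  (forall x, phi1 x != 0 -> c1 <= x <= d1) -> (forall x, phi2 x != 0 -> c2 <= x <= d2) ->
  (forall x, D1 x -> phi1 x = 1) -> (forall x, D2 x -> phi2 x = 1) ->
  (forall x, phi1 x * phi2 x = 0) ->
  (forall x y, phi1 x * phi2 y != 0 -> `|x - y| <= B) ->
  (\int[P]_w (npoints (Xi w) D1 * npoints (Xi w) D2) <=
    (kappa n * (B ^+ (2 * n) * ((d1 - c1) * (d2 - c2))))%:E)%E.
Proof.
move=> p1 p2 cd1 cd2 s1 s2 o1 o2 disj H.
have D1i : D1 `<=` [set` `[c1, d1]].
  by move=> x /o1 e; rewrite /= in_itv /= s1 // e oner_neq0.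
have D2i : D2 `<=` [set` `[c2, d2]].
  by move=> x /o2 e; rewrite /= in_itv /= s2 // e oner_neq0.
apply: ge0_integral_le_truncated => [w|C C0].
  have [k1 ->] := npoints_nat (Xi w) D1i; have [k2 ->] := npoints_nat (Xi w) D2i.
  by rewrite -EFinM lee_fin mulr_ge0 ?ler0n.
(* Counts are integers: if one is at least [K] and the other positive, the product of the counts
   truncated at [K >= 1] is at least [K], hence at least [C]. Truncating each factor at [K] thus
   dominates truncating the product at [C]. *)
pose K := C + 1; have K1 : 1 <= K by rewrite lerDr ltW.
have K0 : 0 <= K by apply: le_trans K1.
have bd X : 0 <= trunc_eval K phi1 phi2 X <= K * K by exact: trunc_eval_bounds s1 s2.
exists (fun w => (trunc_eval K phi1 phi2 (Xi w))%:E); split.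
  move=> w; have := npoints_le_eval (Xi w) D1i p1 s1 o1; have := npoints_le_eval (Xi w) D2i p2 s2 o2.
  have [k1 ->] := npoints_nat (Xi w) D1i; have [k2 ->] := npoints_nat (Xi w) D2i.
  rewrite !lee_fin -EFinM -EFin_min lee_fin => h2 h1.
  apply: (@le_trans _ _ (Num.min K k1%:R * Num.min K k2%:R)); last first.
    have mono (x y : R) : x <= y -> Num.min K x <= Num.min K y.
      by move=> xy; rewrite le_min !ge_min lexx xy orbT.
    by apply: ler_pM; [rewrite le_min K0 ler0n | rewrite le_min K0 ler0n | exact: mono | exact: mono].
  case: k1 {h1} => [|k1]; first by rewrite mul0r (min_r (ltW C0)) (min_r K0) mul0r.
  case: k2 {h2} => [|k2]; first by rewrite mulr0 (min_r (ltW C0)) (min_r K0) mulr0.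
  have a1 : 1 <= k1.+1%:R :> R by rewrite ler1n.
  have a2 : 1 <= k2.+1%:R :> R by rewrite ler1n.
  have [kK1|Kk1] := leP K k1.+1%:R.
    rewrite ge_min; apply/orP; left.
    apply: (@le_trans _ _ (K * 1)); first by rewrite mulr1 lerDl.
    by rewrite ler_pM // le_min K1.
  have [kK2|Kk2] := leP K k2.+1%:R.
    rewrite ge_min; apply/orP; left.
    apply: (@le_trans _ _ (1 * K)); first by rewrite mul1r lerDl.
    by rewrite ler_pM.
  by rewrite ge_min lexx orbT.
rewrite -(bounded_Rintegral (fun w => bd (Xi w))) lee_fin.
have bF : bounded_fun (trunc_eval K phi1 phi2).
  exists (K * K); split; first exact: num_real.
  move=> M KM X _ /=; have /andP[b0 b1] := bd X.
  by rewrite ger0_norm // (le_trans b1) // ltW.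
have lim := sine_cvg (@continuous_trunc_eval K phi1 phi2) bF.
have lim' : kappaN n N * (B ^+ (2 * n) * ((d1 - c1) * (d2 - c2))) @[N --> \oo] -->
    kappa n * (B ^+ (2 * n) * ((d1 - c1) * (d2 - c2))).
  by apply: cvgM; [exact: kappaN_cvg | exact: cvg_cst].
apply: (ler_cvg_to lim lim'); near=> N.
apply: le_trans (pair_expect_le n_gt0 N
  (@test_fun_continuous _ phi1) (@test_fun_continuous _ phi2) p1 p2 cd1 cd2 s1 s2 H).
apply: circular_expectation_le => //; try exact: test_fun_continuous.
  by move=> t; case/andP: (bd (scaled_config t)).
move=> t w0; rewrite /trunc_eval !(vague_eval_scaled _ n_gt0) //.
set a := \sum_j _; set b := \sum_j _.
have a0 : 0 <= a by apply: sumr_ge0 => j _; case/andP: (p1 (N.+2%:R * tnth t j)).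
have b0 : 0 <= b by apply: sumr_ge0 => j _; case/andP: (p2 (N.+2%:R * tnth t j)).
apply: (@le_trans _ _ (a * b)).
  by apply: ler_pM; rewrite ?le_min ?K0 // ge_min lexx orbT.
rewrite /scaled_pairsum /pairsum /a mulr_suml; apply: ler_sum => j _.
by rewrite /b mulr_sumr (bigD1 j) //= disj add0r.
Unshelve. all: by end_near. Qed.

End PairCounts.

Section PairCountsLower.
Context {R : realType}.
Variable n : nat.
Hypothesis n_gt0 : (0 < n)%N.
Context (d : measure_display) (T : measurableType d) (P : probability T R)
  (Xi : T -> config R).
Hypothesis sineXi : is_Sine (2 * n)%:R P Xi.
Implicit Types (phi : test_fun R) (X : config R).

(** As [0 <= u j <= 1], the diagonal terms [u j * u j] sum to at most [\sum_j u j]. *)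
Lemma sum_offdiag_ge (m : nat) (u : 'I_m -> R) : (forall j, 0 <= u j <= 1) ->
  (\sum_j u j) * (\sum_j u j) - \sum_j u j <= \sum_j \sum_(k | k != j) u j * u k.
Proof.
move=> u01; rewrite lerBlDr mulr_suml -big_split; apply: ler_sum => j _ /=.
rewrite mulr_sumr (bigD1 j) //= addrC lerD2l.
by have /andP[u0 u1] := u01 j; rewrite ler_piMr.
Qed.

(* The loss due to truncation is controlled by pairs of points in the same
   short interval, which are rare by repulsion. *)
Lemma trunc_mul_ge (a b s1 s2 : R) : 0 <= a -> 0 <= b -> 0 <= s1 -> 0 <= s2 ->
  a * a - a <= s1 -> b * b - b <= s2 -> a * b - s1 - s2 <= Num.min 1 a * Num.min 1 b.
Proof.
move=> a0 b0 s10 s20 h1 h2; have [a1|/ltW a1] := leP 1 a; have [b1|/ltW b1] := leP 1 b.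
(* Half the sum of the three squares is [a^2 + b^2 - a b - a - b + 1], whose sign is the claim when
   both truncations equal 1. *)
- have := sqr_ge0 (a - b); have := sqr_ge0 (a - 1); have := sqr_ge0 (b - 1).
  rewrite !expr2; lra.
- have : 0 <= (a - 1) * (a - b) by apply: mulr_ge0; lra.
  lra.
- have : 0 <= (b - 1) * (b - a) by apply: mulr_ge0; lra.
  lra.
- lra.
Qed.

(** The test functions lie below the indicators and are truncated at level 1. The loss is at most
    the pair sums of [phi1] and of [phi2] with themselves, to which [pair_expect_le] applies with
    the length of the interval as largest distance. *)
Lemma pair_count_ge phi1 phi2 (D1 D2 : set R) (a1 b1 a2 b2 c1 d1 c2 d2 A B : R) :
  (forall x, 0 <= phi1 x <= 1) -> (forall x, 0 <= phi2 x <= 1) ->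
  a1 <= b1 -> a2 <= b2 -> c1 <= d1 -> c2 <= d2 -> 0 <= A -> 0 <= B -> n%:R * B <= 1 ->
  D1 `<=` [set` `[a1, b1]] -> D2 `<=` [set` `[a2, b2]] ->
  (forall x, phi1 x != 0 -> D1 x) -> (forall x, phi2 x != 0 -> D2 x) ->
  (forall x, c1 <= x <= d1 -> phi1 x = 1) -> (forall x, c2 <= x <= d2 -> phi2 x = 1) ->
  (forall x, phi1 x * phi2 x = 0) ->
  (forall x y, phi1 x * phi2 y != 0 -> A <= `|x - y| <= B) ->
  ((kappa n * ((A ^+ 2) ^+ n * (1 - n%:R ^+ 2 * B ^+ 2 / 2) * ((d1 - c1) * (d2 - c2)))
    - kappa n * ((b1 - a1) ^+ (2 * n) * ((b1 - a1) * (b1 - a1)))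
    - kappa n * ((b2 - a2) ^+ (2 * n) * ((b2 - a2) * (b2 - a2))))%:E <=
   \int[P]_w (npoints (Xi w) D1 * npoints (Xi w) D2))%E.
Proof.
move=> p1 p2 ab1 ab2 cd1 cd2 A0 B0 nB D1i D2i sD1 sD2 o1 o2 disj H.
have s1 x : phi1 x != 0 -> a1 <= x <= b1 by move=> /sD1 /D1i; rewrite /= in_itv.
have s2 x : phi2 x != 0 -> a2 <= x <= b2 by move=> /sD2 /D2i; rewrite /= in_itv.
have bd X : 0 <= trunc_eval 1 phi1 phi2 X <= 1.
  by have := trunc_eval_bounds X ler01 p1 p2 s1 s2; rewrite mulr1.
apply: (@le_trans _ _ (\int[P]_w (trunc_eval 1 phi1 phi2 (Xi w))%:E)%E); last first.
  apply: le_ge0_integral => w _; first by rewrite lee_fin; case/andP: (bd (Xi w)).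
  have := eval_le_npoints (Xi w) D1i p1 sD1; have := eval_le_npoints (Xi w) D2i p2 sD2.
  have [k1 ->] := npoints_nat (Xi w) D1i; have [k2 ->] := npoints_nat (Xi w) D2i.
  rewrite -EFinM !lee_fin => h2 h1.
  have e1 := vague_eval_ge0 (Xi w) p1 s1; have e2 := vague_eval_ge0 (Xi w) p2 s2.
  by apply: ler_pM; rewrite ?le_min ?ler01 ?e1 ?e2 // ge_min ?h1 ?h2 orbT.
rewrite -(bounded_Rintegral P (fun w => bd (Xi w))) lee_fin.
have bF : bounded_fun (trunc_eval 1 phi1 phi2).
  exists 1; split; first exact: num_real.
  move=> M KM X _ /=; have /andP[e0 e1] := bd X.
  by rewrite ger0_norm // (le_trans e1) // ltW.
have lim := sine_cvg sineXi (@continuous_trunc_eval _ 1 phi1 phi2) bF.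
pose Y1 := (b1 - a1) ^+ (2 * n) * ((b1 - a1) * (b1 - a1)).
pose Y2 := (b2 - a2) ^+ (2 * n) * ((b2 - a2) * (b2 - a2)).
pose u N := kappaN n N * ((A ^+ 2 * (1 - B ^+ 2 / N.+2%:R ^+ 2 / 12)) ^+ n *
     (1 - n%:R ^+ 2 * B ^+ 2 / 2) * ((d1 - c1) * (d2 - c2))) - kappaN n N * Y1 - kappaN n N * Y2.
have lim' : u N @[N --> \oo] -->
    kappa n * ((A ^+ 2) ^+ n * (1 - n%:R ^+ 2 * B ^+ 2 / 2) * ((d1 - c1) * (d2 - c2)))
    - kappa n * Y1 - kappa n * Y2.
  have kc : kappaN n N @[N --> \oo] --> (kappa n : R) by exact: kappaN_cvg.
  apply: cvgB; [apply: cvgB|]; apply: cvgM => //; try exact: cvg_cst.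
  apply: cvgM; last exact: cvg_cst.
  apply: cvgM; last exact: cvg_cst.
  have i2 : (B ^+ 2 / N.+2%:R ^+ 2 / 12 : R) @[N --> \oo] --> (0 : R).
    have -> : (0 : R) = B ^+ 2 * (0 * 0) / 12 by rewrite !(mul0r, mulr0).
    apply: cvgM; last exact: cvg_cst.
    apply: cvgM; first exact: cvg_cst.
    under eq_cvg do rewrite expr2 invfM.
    by apply: cvgM; exact: cvg_inv_add2.
  have i1 : (A ^+ 2 * (1 - B ^+ 2 / N.+2%:R ^+ 2 / 12) : R) @[N --> \oo] --> A ^+ 2.
    rewrite -[X in _ --> X]mulr1; apply: cvgM; first exact: cvg_cst.
    rewrite -[X in _ --> X]subr0; apply: cvgB => //; exact: cvg_cst.
  elim: (n) => [|k IH]; first by under eq_cvg do rewrite expr0; rewrite expr0; exact: cvg_cst.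
  by under eq_cvg do rewrite exprS; rewrite exprS; apply: cvgM.
apply: (ler_cvg_to lim' lim); near=> N.
have k1 := @test_fun_continuous _ phi1; have k2 := @test_fun_continuous _ phi2.
have Nbig : [/\ `|c1| <= N.+2%:R, `|d1| <= N.+2%:R, `|c2| <= N.+2%:R,
    `|d2| <= N.+2%:R & B <= N.+2%:R].
  have step (x : R) : x <= N%:R -> x <= N.+2%:R.
    by move=> h; rewrite (le_trans h) // ler_nat -addn2 leq_addr.
  by split; apply: step; near: N; exact: nbhs_infty_ger.
have E12 := pair_expect_ge n_gt0 k1 k2 p1 p2 cd1 cd2 A0 B0 o1 o2 H nB Nbig.
have self phi a b : (forall x, phi x != 0 -> a <= x <= b) ->
    forall x y, phi x * phi y != 0 -> `|x - y| <= b - a.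
  move=> s x y; rewrite mulf_eq0 negb_or => /andP[/s hx /s hy].
  by rewrite ler_norml; lra.
have E11 := pair_expect_le n_gt0 N k1 k1 p1 p1 ab1 ab1 s1 s1 (self _ _ _ s1).
have E22 := pair_expect_le n_gt0 N k2 k2 p2 p2 ab2 ab2 s2 s2 (self _ _ _ s2).
apply: (@le_trans _ _ (pair_expect n N phi1 phi2 -
  pair_expect n N phi1 phi1 - pair_expect n N phi2 phi2)).
  by rewrite /u /Y1 /Y2; apply: lerB => //; apply: lerB.
apply: circular_expectation_ge => //; try exact: test_fun_continuous.
move=> t w0; rewrite /trunc_eval !(vague_eval_scaled _ n_gt0) //.
set a := \sum_j _; set b := \sum_j _.
have u1 j : 0 <= phi1 (N.+2%:R * tnth t j) <= 1 by [].
have u2 j : 0 <= phi2 (N.+2%:R * tnth t j) <= 1 by [].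
have -> : scaled_pairsum phi1 phi2 t = a * b.
  rewrite /scaled_pairsum /pairsum /a mulr_suml; apply: eq_bigr => j _.
  by rewrite /b mulr_sumr [RHS](bigD1 j) //= disj add0r.
apply: trunc_mul_ge.
- by apply: sumr_ge0 => j _; case/andP: (u1 j).
- by apply: sumr_ge0 => j _; case/andP: (u2 j).
- apply: sumr_ge0 => j _; apply: sumr_ge0 => k _.
  by rewrite mulr_ge0 //; [case/andP: (u1 j) | case/andP: (u1 k)].
- apply: sumr_ge0 => j _; apply: sumr_ge0 => k _.
  by rewrite mulr_ge0 //; [case/andP: (u2 j) | case/andP: (u2 k)].
- exact: sum_offdiag_ge u1.
- exact: sum_offdiag_ge u2.
Unshelve. all: by end_near. Qed.

End PairCountsLower.

(** * From pair counts to the pair correlation function *)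

Section DensityBounds.
Context {R : realType}.
Local Notation mu := (@lebesgue_measure R).
Variable n : nat.
Hypothesis n_gt0 : (0 < n)%N.
Context (d : measure_display) (T : measurableType d) (P : probability T R)
  (Xi : T -> config R).
Hypothesis sineXi : is_Sine (2 * n)%:R P Xi.
Variable rho : R -> R -> R.
Hypotheses (rhoXi : is_pair_correlation P Xi rho)
  (rho_invariant : forall x y : R, rho x y = rho 0 `|y - x|)
  (rho_continuous : continuous (rho 0)).

Lemma kappa_ge0 : 0 <= @kappa R n.
Proof.
by rewrite /kappa divr_ge0 ?mulr_ge0 ?exprn_ge0 ?ler0n // pi_ge0.
Qed.

Lemma integral_square_cst (M a l : R) : 0 < a ->
  (\int[mu]_(x in `[0%R, a]) \int[mu]_(y in `[l, (l + a)%R]) M%:E = (M * a ^+ 2)%:E)%E.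
Proof.
move=> a0.
have mu_itv (u v : R) : u < v -> mu [set` `[u, v]] = (v - u)%:E%E.
  by move=> uv; rewrite [mu _]lebesgue_measure_itv /= lte_fin uv -EFinB.
have i1 (K : \bar R) u v : (\int[mu]_(x in [set` `[u, v]]) (cst K) x = K * mu [set` `[u, v]])%E.
  by rewrite integral_cst //; exact: measurable_itv.
under eq_integral do rewrite i1.
rewrite i1 !mu_itv // ?ltrDl //.
by rewrite -!EFinM; congr EFin; ring.
Qed.

Lemma rho_square (a l : R) : 0 < a -> a < l ->
  (\int[P]_w (npoints (Xi w) [set` `[0%R, a]] * npoints (Xi w) [set` `[l, (l + a)%R]]) =
   \int[mu]_(x in `[0%R, a]) \int[mu]_(y in `[l, (l + a)%R]) (rho 0 `|y - x|)%:E)%E.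
Proof.
move=> a0 al; have [_ _ _ E] := rhoXi.
rewrite E; [|exact: measurable_itv|exact: measurable_itv|]; last first.
  rewrite -subset0 => x /= []; rewrite !in_itv /= => /andP[_ h1] /andP[h2 _]; lra.
apply: eq_integral => x _; apply: eq_integral => y _.
by rewrite rho_invariant.
Qed.

(** On the square the separation [y - x] is nonnegative and stays within [a] of [l]. The condition
    [0 <= m] serves the comparison of integrals without measurability. *)
Lemma rho_lower_square (a l m : R) : 0 < a -> a < l -> 0 <= m ->
  (forall s, `|s - l| <= a -> m <= rho 0 s) ->
  ((m * a ^+ 2)%:E <=
   \int[P]_w (npoints (Xi w) [set` `[0%R, a]] * npoints (Xi w) [set` `[l, (l + a)%R]]))%E.
Proof.
move=> a0 al m0 H; rewrite rho_square // -(integral_square_cst _ l) //.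
apply: le_ge0_integral => x xa.
  by apply: integral_ge0 => y _; rewrite lee_fin.
apply: le_ge0_integral => y yla; rewrite lee_fin //; apply: H.
move: xa yla; rewrite /= !in_itv /= => /andP[x0 xa] /andP[ly yl].
have yx : 0 <= y - x by lra.
by rewrite (ger0_norm yx) ler_norml; lra.
Qed.

Lemma rho_upper_square (a l m : R) : 0 < a -> a < l ->
  (forall s, `|s - l| <= a -> rho 0 s <= m) ->
  (\int[P]_w (npoints (Xi w) [set` `[0%R, a]] * npoints (Xi w) [set` `[l, (l + a)%R]]) <=
   (m * a ^+ 2)%:E)%E.
Proof.
move=> a0 al H; rewrite rho_square // -(integral_square_cst _ l) //.
have [_ rho0 _ _] := rhoXi.
apply: le_ge0_integral => x xa.
  by apply: integral_ge0 => y _; rewrite lee_fin.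
apply: le_ge0_integral => y yla; rewrite lee_fin //; apply: H.
move: xa yla; rewrite /= !in_itv /= => /andP[x0 xa] /andP[ly yl].
have yx : 0 <= y - x by lra.
by rewrite (ger0_norm yx) ler_norml; lra.
Qed.

End DensityBounds.

Section SmallSeparation.
Context {R : realType}.
Implicit Types f g : R -> R.

Lemma continuousD_R f g : continuous f -> continuous g -> continuous (fun x => f x + g x).
Proof. by move=> cf cg x; apply: cvgD; [exact: cf | exact: cg]. Qed.

Lemma continuousM_R f g : continuous f -> continuous g -> continuous (fun x => f x * g x).
Proof. by move=> cf cg x; apply: cvgM; [exact: cf | exact: cg]. Qed.

Lemma continuousX_R f (k : nat) : continuous f -> continuous (fun x => f x ^+ k).
Proof.
move=> cf; elim: k => [|k IH]; first by move=> x; exact: cvg_cst.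
rewrite (_ : (fun x => _) = fun x => f x * f x ^+ k); first exact: continuousM_R.
by apply/funext => x; rewrite exprS.
Qed.

Lemma continuous_id_R : continuous (fun x : R => x). Proof. by move=> x; exact: cvg_id. Qed.
Lemma continuous_cst_R (c : R) : continuous (fun _ : R => c). Proof. by move=> x; exact: cvg_cst. Qed.

Lemma le_at0 f (c delta : R) : continuous f -> 0 < delta ->
  (forall a, 0 < a < delta -> c <= f a) -> c <= f 0.
Proof.
move=> cf d0 H.
have lim : f a @[a --> 0^'+] --> f 0 by apply: cvg_at_right_filter; exact: cf.
have limc : (fun=> c) a @[a --> (0 : R)^'+] --> c by exact: cvg_cst.
apply: (ler_cvg_to limc lim); near=> a; apply: H; apply/andP; split.
  by near: a; exact: nbhs_right_gt.
by near: a; exact: nbhs_right_lt.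
Unshelve. all: by end_near. Qed.

Lemma ge_at0 f (c delta : R) : continuous f -> 0 < delta ->
  (forall a, 0 < a < delta -> f a <= c) -> f 0 <= c.
Proof.
move=> cf d0 H.
have lim : f a @[a --> 0^'+] --> f 0 by apply: cvg_at_right_filter; exact: cf.
have limc : (fun=> c) a @[a --> (0 : R)^'+] --> c by exact: cvg_cst.
apply: (ler_cvg_to lim limc); near=> a; apply: H; apply/andP; split.
  by near: a; exact: nbhs_right_gt.
by near: a; exact: nbhs_right_lt.
Unshelve. all: by end_near. Qed.

Lemma continuous_ball f (l eta : R) : continuous f -> 0 < eta ->
  exists2 delta, 0 < delta & forall s, `|s - l| < delta -> `|f s - f l| < eta.
Proof.
move=> cf e0; have /cvgrPdist_lt /(_ _ e0) /nbhs_ballP[delta /= d0 H] := cf l.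
exists delta => // s sl; rewrite distrC; apply: H.
by rewrite /ball /= distrC.
Qed.

Variable n : nat.
Hypothesis n_gt0 : (0 < n)%N.
Context (d : measure_display) (T : measurableType d) (P : probability T R)
  (Xi : T -> config R).
Hypothesis sineXi : is_Sine (2 * n)%:R P Xi.
Variable rho : R -> R -> R.
Hypotheses (rhoXi : is_pair_correlation P Xi rho)
  (rho_invariant : forall x y : R, rho x y = rho 0 `|y - x|)
  (rho_continuous : continuous (rho 0)).

(** The mean of [rho] over a square of side [a] is compared with [pair_count_le], then [a] tends to
    0. The trapezoids overshoot the intervals by [a^2], negligible against [a]. *)
Lemma rho_le (l : R) : 0 < l -> rho 0 l <= kappa n * l ^+ (2 * n).
Proof.
move=> l0; have k0 := @kappa_ge0 R n.
apply/ler_addgt0Pr => eta eta0; rewrite -lerBlDr.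
(* If [rho 0 l - eta] is not positive the claim is trivial; otherwise it is an admissible lower
   bound on the square. *)
have [m0|m0] := leP (rho 0 l - eta) 0.
  by rewrite (le_trans m0) // mulr_ge0 // exprn_ge0 // ltW.
have [delta delta0 H] := continuous_ball l rho_continuous eta0.
(* The bound of [pair_count_le] divided by [a^2]: the enlarged intervals have length [a (1 + 2 a)],
   and their points are at most [l + a + 2 a^2] apart. *)
pose U (a : R) := kappa n * ((l + a + 2 * a ^+ 2) ^+ (2 * n) * (1 + 2 * a) ^+ 2).
have cU : continuous U.
  have ca := continuous_id_R.
  have c1 := continuousD_R (continuousD_R (@continuous_cst_R l) ca)
    (continuousM_R (@continuous_cst_R 2) (continuousX_R (k := 2) ca)).
  have c2 := continuousD_R (@continuous_cst_R 1) (continuousM_R (@continuous_cst_R 2) ca).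
  exact: (continuousM_R (@continuous_cst_R (kappa n))
    (continuousM_R (continuousX_R (k := 2 * n) c1) (continuousX_R (k := 2) c2))).
have U0 : U 0 = kappa n * l ^+ (2 * n).
  by rewrite /U expr0n /= !mulr0 !addr0 expr1n mulr1.
(* [a < 1] gives [a^2 <= a]; with [a < l / 4] the enlarged intervals remain disjoint, since
   [a + 2 a^2 <= 3 a < l]. *)
rewrite -U0; apply: (@le_at0 U _ (Num.min delta (Num.min (l / 4) 1))) => //.
  by rewrite !lt_min delta0 divr_gt0 // ltr01.
move=> a /andP[a0]; rewrite !lt_min => /and3P[ad al4 a1].
have e0 : 0 < a ^+ 2 by rewrite exprn_gt0.
have ea : a ^+ 2 <= a by rewrite expr2 ler_piMr // ltW.
have al : a < l by lra.
have low := rho_lower_square rhoXi rho_invariant a0 al (ltW m0).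
have lowm s : `|s - l| <= a -> rho 0 l - eta <= rho 0 s.
  move=> sl; have := H s (le_lt_trans sl ad); rewrite ltr_norml; lra.
have {}low := low lowm.
have := @pair_count_le R n n_gt0 d T P Xi sineXi
  (trapezoid_fun 0 a e0) (trapezoid_fun l (l + a) e0) [set` `[0%R, a]] [set` `[l, l + a]]
  (0 - a ^+ 2) (a + a ^+ 2) (l - a ^+ 2) (l + a + a ^+ 2) (l + a + 2 * a ^+ 2)
  (trapezoid01 _ _ _) (trapezoid01 _ _ _).
have s1 x : trapezoid_fun 0 a e0 x != 0 -> 0 - a ^+ 2 <= x <= a + a ^+ 2 by exact: trapezoid_supp.
have s2 x : trapezoid_fun l (l + a) e0 x != 0 -> l - a ^+ 2 <= x <= l + a + a ^+ 2 by exact: trapezoid_supp.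
have nz (u v : R) : u * v != 0 -> u != 0 /\ v != 0 by rewrite mulf_eq0 negb_or => /andP.
have o1 x : [set` `[0%R, a]] x -> trapezoid_fun 0 a e0 x = 1.
  by rewrite /= in_itv => h; exact: trapezoid1.
have o2 x : [set` `[l, l + a]] x -> trapezoid_fun l (l + a) e0 x = 1.
  by rewrite /= in_itv => h; exact: trapezoid1.
have disj x : trapezoid_fun 0 a e0 x * trapezoid_fun l (l + a) e0 x = 0.
  by apply/eqP; apply: contraT => /nz[/s1 /andP[_ h1] /s2 /andP[h2 _]]; lra.
have dist x y : trapezoid_fun 0 a e0 x * trapezoid_fun l (l + a) e0 y != 0 ->
    `|x - y| <= l + a + 2 * a ^+ 2.
  by move=> /nz[/s1 /andP[h1 h2] /s2 /andP[h3 h4]]; rewrite ler_norml; lra.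
have cd1 : 0 - a ^+ 2 <= a + a ^+ 2 by lra.
have cd2 : l - a ^+ 2 <= l + a + a ^+ 2 by lra.
move=> up; have {}up := up cd1 cd2 s1 s2 o1 o2 disj dist.
have := le_trans low up; rewrite lee_fin => le12.
rewrite -(ler_pM2r e0); apply: le_trans le12 _.
by rewrite le_eqVlt; apply/orP; left; apply/eqP; rewrite /U; ring.
Qed.

(** The trapezoids now fit inside the intervals. After division by [a^2] the truncation costs
    [2 kappa a^(2n)], which vanishes as [a] tends to 0 because [n > 0]. *)
Lemma rho_ge (l : R) : 0 < l -> n%:R * l < 1 ->
  kappa n * (l ^+ (2 * n) * (1 - n%:R ^+ 2 * l ^+ 2 / 2)) <= rho 0 l.
Proof.
move=> l0 nl; have k0 := @kappa_ge0 R n.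
have n0 : 0 < n%:R :> R by rewrite ltr0n.
apply/ler_addgt0Pr => eta eta0.
have [delta delta0 H] := continuous_ball l rho_continuous eta0.
(* The bound of [pair_count_ge] divided by [a^2]: plateaus of length [a (1 - 2 a)], distances
   between [l - a] and [l + a]. Differences are written with [-1 *] so that continuity follows from
   sums and products alone. *)
pose L (a : R) := kappa n * (((l + -1 * a) ^+ 2) ^+ n * (1 + -1 * (n%:R ^+ 2 * (l + a) ^+ 2 / 2)) *
   (1 + -1 * (2 * a)) ^+ 2) + -1 * (2 * kappa n * a ^+ (2 * n)).
have cL : continuous L.
  have ca := continuous_id_R; have cN f := @continuousM_R _ f (@continuous_cst_R (-1)).
  have c1 := continuousD_R (@continuous_cst_R l) (cN _ ca).
  have c2 := continuousD_R (@continuous_cst_R 1) (cN _ (continuousM_R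
    (continuousM_R (@continuous_cst_R (n%:R ^+ 2))
      (continuousX_R (k := 2) (continuousD_R (@continuous_cst_R l) ca))) (@continuous_cst_R 2^-1))).
  have c3 := continuousD_R (@continuous_cst_R 1) (cN _ (continuousM_R (@continuous_cst_R 2) ca)).
  exact: (continuousD_R (continuousM_R (@continuous_cst_R (kappa n))
    (continuousM_R (continuousM_R (continuousX_R (k := n) (continuousX_R (k := 2) c1)) c2) (continuousX_R (k := 2) c3)))
    (cN _ (continuousM_R (@continuous_cst_R (2 * kappa n)) (continuousX_R (k := 2 * n) ca)))).
have L0 : L 0 = kappa n * (l ^+ (2 * n) * (1 - n%:R ^+ 2 * l ^+ 2 / 2)).
  rewrite /L !mulr0 !addr0 expr1n mulr1 expr0n muln_eq0 /= (gtn_eqF n_gt0) !mulr0 addr0.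
  by rewrite exprM mulN1r.
(* [a < 1 / 4] keeps the plateaus nonempty, [a < l / 4] the intervals disjoint, and [a < 1 / n - l]
   gives [n (l + a) <= 1]. *)
rewrite -L0; apply: (@ge_at0 L _ (Num.min delta (Num.min (l / 4) (Num.min (1 / 4) (n%:R^-1 - l))))) => //.
  rewrite !lt_min delta0 !divr_gt0 // subr_gt0 /=.
  by rewrite -(ltr_pM2l n0) mulfV // gt_eqF.
move=> a /andP[a0]; rewrite !lt_min => /and4P[ad al4 a1 anl].
have e0 : 0 < a ^+ 2 by rewrite exprn_gt0.
have ea : 4 * a ^+ 2 <= a by rewrite expr2 mulrA ler_piMl // ?ltW //; lra.
have al : a < l by lra.
have upm s : `|s - l| <= a -> rho 0 s <= rho 0 l + eta.
  move=> sl; have := H s (le_lt_trans sl ad); rewrite ltr_norml; lra.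
have up := rho_upper_square rhoXi rho_invariant a0 al upm.
have s1 x : trapezoid_fun (a ^+ 2) (a - a ^+ 2) e0 x != 0 -> 0 <= x <= a.
  move/trapezoid_supp => /(_ e0); lra.
have s2 x : trapezoid_fun (l + a ^+ 2) (l + a - a ^+ 2) e0 x != 0 -> l <= x <= l + a.
  move/trapezoid_supp => /(_ e0); lra.
have nz (u v : R) : u * v != 0 -> u != 0 /\ v != 0 by rewrite mulf_eq0 negb_or => /andP.
have := @pair_count_ge R n n_gt0 d T P Xi sineXi
  (trapezoid_fun (a ^+ 2) (a - a ^+ 2) e0) (trapezoid_fun (l + a ^+ 2) (l + a - a ^+ 2) e0)
  [set` `[0%R, a]] [set` `[l, l + a]]
  0 a l (l + a) (a ^+ 2) (a - a ^+ 2) (l + a ^+ 2) (l + a - a ^+ 2) (l - a) (l + a)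
  (trapezoid01 _ _ _) (trapezoid01 _ _ _).
have o1 x : a ^+ 2 <= x <= a - a ^+ 2 -> trapezoid_fun (a ^+ 2) (a - a ^+ 2) e0 x = 1.
  exact: trapezoid1.
have o2 x : l + a ^+ 2 <= x <= l + a - a ^+ 2 ->
    trapezoid_fun (l + a ^+ 2) (l + a - a ^+ 2) e0 x = 1.
  exact: trapezoid1.
have disj x : trapezoid_fun (a ^+ 2) (a - a ^+ 2) e0 x *
    trapezoid_fun (l + a ^+ 2) (l + a - a ^+ 2) e0 x = 0.
  by apply/eqP; apply: contraT => /nz[/s1 /andP[_ h1] /s2 /andP[h2 _]]; lra.
have dist x y : trapezoid_fun (a ^+ 2) (a - a ^+ 2) e0 x *
    trapezoid_fun (l + a ^+ 2) (l + a - a ^+ 2) e0 y != 0 -> l - a <= `|x - y| <= l + a.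
  move=> /nz[/s1 /andP[h1 h2] /s2 /andP[h3 h4]].
  have yx : x - y <= 0 by lra.
  by rewrite (ler0_norm yx); lra.
have nB : n%:R * (l + a) <= 1.
  have : l + a <= n%:R^-1 by lra.
  by rewrite -(ler_pM2l n0) mulfV ?gt_eqF.
have sD1 x : trapezoid_fun (a ^+ 2) (a - a ^+ 2) e0 x != 0 -> [set` `[0%R, a]] x.
  by move=> /s1; rewrite /= in_itv.
have sD2 x : trapezoid_fun (l + a ^+ 2) (l + a - a ^+ 2) e0 x != 0 -> [set` `[l, l + a]] x.
  by move=> /s2; rewrite /= in_itv.
have ab1 : 0 <= a by exact: ltW.
have ab2 : l <= l + a by lra.
have cd1 : a ^+ 2 <= a - a ^+ 2 by lra.
have cd2 : l + a ^+ 2 <= l + a - a ^+ 2 by lra.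
have A0 : 0 <= l - a by lra.
have B0 : 0 <= l + a by lra.
move=> low; have {}low := low ab1 ab2 cd1 cd2 A0 B0 nB (fun _ h => h) (fun _ h => h)
  sD1 sD2 o1 o2 disj dist.
have := le_trans low up; rewrite lee_fin => le12.
rewrite -(ler_pM2r e0); apply: le_trans le12.
rewrite le_eqVlt; apply/orP; left; apply/eqP; rewrite /L subr0.
have -> : l + a - l = a by ring.
by rewrite !mulN1r; move: (((l - a) ^+ 2) ^+ n) (a ^+ (2 * n)) (n%:R ^+ 2) (kappa n) => X Y Z K; ring.
Qed.

End SmallSeparation.

(** * The asymptotics at zero separation *)

Unset Implicit Arguments.
Set Strict Implicit.

Theorem corollary5 (R : realType) (n : nat) (n_ge1 : (1 <= n)%N)
    (d : measure_display) (T : measurableType d) (P : probability T R)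
    (Xi : T -> config R) (sineXi : is_Sine (2 * n)%:R P Xi)
    (rho : R -> R -> R) (rhoXi : is_pair_correlation P Xi rho)
    (rho_invariant : forall x y : R, rho x y = rho 0 `|y - x|)
    (rho_continuous : continuous (rho 0)) :
  (fun l : R => rho 0 l) =
    (fun l : R => 1 / (4 * pi ^+ 2) *
       (((n ^ (2 * n) * n`! ^ 3)%N)%:R / (((2 * n)`! * (3 * n)`!)%N)%:R) *
       l ^+ (2 * n))
    +O_ (0^') (fun l : R => l ^+ (2 * n + 2)).
Proof.
set K := 1 / (4 * pi ^+ 2) * _.
have KE : K = kappa n.
  have f0 k : k`!%:R != 0 :> R by rewrite pnatr_eq0 -lt0n fact_gt0.
  have p0 : pi != 0 :> R by rewrite gt_eqF // pi_gt0.
  rewrite /K /kappa !natrM !natrX.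
  move: (pi : R) p0 ((2 * n)`!%:R : R) (f0 (2 * n)%N) ((3 * n)`!%:R : R) (f0 (3 * n)%N)
    (n%:R ^+ (2 * n) : R) => q q0 a a0 b b0 c.
  by field; rewrite q0 a0 b0.
have n0 : 0 < n%:R :> R by rewrite ltr0n.
rewrite KE; apply/eqaddOP; near=> k; near=> l.
rewrite /= !fctE /=.
have l0 : l != 0 by near: l; exact: nbhs_dnbhs_neq.
(* The radius [1 / n] is the range of validity of [rho_ge]. *)
have ln : `|l| < n%:R^-1 by near: l; apply: dnbhs0_lt; rewrite invr_gt0 ltr0n.
have lp : 0 < `|l| by rewrite normr_gt0.
have nl : n%:R * `|l| < 1 by rewrite mulrC -ltr_pdivlMr // div1r.
(* Invariance makes [rho 0] even, which covers negative [l]. *)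
have lE : rho 0 l = rho 0 `|l| by rewrite rho_invariant subr0.
have l2n m : l ^+ (2 * m) = `|l| ^+ (2 * m) by rewrite !exprM real_normK ?num_real.
have up := rho_le n_ge1 sineXi rhoXi rho_invariant rho_continuous lp.
have low := rho_ge n_ge1 sineXi rhoXi rho_invariant rho_continuous lp nl.
have -> : (2 * n + 2 = 2 * n.+1)%N by rewrite mulnS addnC.
rewrite lE !l2n normrX normr_id.
(* This constant is the error term of [rho_ge]; the upper bound [rho_le] has none, so the difference
   is never positive. *)
have kk : kappa n * n%:R ^+ 2 / 2 <= k by near: k; apply: nbhs_pinfty_ge; exact: num_real.
apply: (@le_trans _ _ (kappa n * n%:R ^+ 2 / 2 * `|l| ^+ (2 * n.+1))); last first.
  by rewrite ler_wpM2r // exprn_ge0.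
have -> : `|l| ^+ (2 * n.+1) = `|l| ^+ (2 * n) * `|l| ^+ 2 by rewrite mulnS addnC exprD.
rewrite ler_norml; apply/andP; split.
  rewrite -subr_ge0; rewrite -subr_ge0 in low; apply: le_trans low _.
  by rewrite le_eqVlt; apply/orP; left; apply/eqP; ring.
apply: (@le_trans _ _ 0); first by rewrite subr_le0.
apply: mulr_ge0; last by rewrite mulr_ge0 // exprn_ge0.
by rewrite divr_ge0 // mulr_ge0 ?kappa_ge0 // exprn_ge0 // ltW.
Unshelve. all: by end_near. Qed.
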